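(* Suppose that (S* ) for each $x\in\mathbb{X}$ the function $a\mapsto c(x,a)$ is inf-compact on $\mathbb{A}$, and for each $x\in\mathbb{X}$ the transition probability $q(\cdot|x,a)$ is setwise continuous in $a\in\mathbb{A}$; and that a sequence $\{\alpha_n\}_{n\ge1}\subset[0,1)$ with $\alpha_n\uparrow1$ satisfies ($\underline{B}_{\{\alpha_n\}}$) $w^*:=\inf_{x\in\mathbb{X}}w(x)<+\infty$ and $\liminf_{n\to\infty}u_{\alpha_n}(x)<+\infty$ for all $x\in\mathbb{X}$; (LEC$_{\{\alpha_n\}}$(ii)) $\lim_{n\to\infty}u_{\alpha_n}(x)$ exists for each $x\in\mathbb{X}$; (LEC$_{\{\alpha_n\}}$(iii)) for each $x\in\mathbb{X}$ and $a\in\mathbb{A}$ the sequence $\{u_{\alpha_n}\}_{n\ge1}$ is asymptotically uniformly integrable with respect to the probability measure $q(\cdot|x,a)$. Let $u(x):=\liminf_{n\to\infty}u_{\alpha_n}(x)$, $x\in\mathbb{X}$. Then there exists a deterministic policy $\phi$ such that the average-cost optimality equation holds: $$w^*+u(x)=c(x,\phi(x))+\int_{\mathbb{X}}u(y)\,q(dy|x,\phi(x))=\min_{a\in\mathbb{A}}\left[c(x,a)+\int_{\mathbb{X}}u(y)\,q(dy|x,a)\right],\qquad x\in\mathbb{X}.$$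
   Context: Setting (MDP). The state space $\mathbb{X}$ and the action space $\mathbb{A}$ are Borel subsets of Polish spaces; every action in $\mathbb{A}$ is available at every state. The one-step cost $c:\mathbb{X}\times\mathbb{A}\to\mathbb{R}\cup\{+\infty\}$ is measurable and bounded below. The transition kernel $q(B|x,a)$ ($B\in\mathcal{B}(\mathbb{X})$) is a regular (measurable) transition probability from $\mathbb{X}\times\mathbb{A}$ to $\mathbb{X}$. A policy $\pi=(\pi_0,\pi_1,\dots)$ is a sequence of decision rules, $\pi_t$ being a regular transition probability from the histories $(\mathbb{X}\times\mathbb{A})^t\times\mathbb{X}$ to $\mathbb{A}$; $\Pi$ is the set of all policies. A deterministic policy is identified with a measurable map $\phi:\mathbb{X}\to\mathbb{A}$, which prescribes action $\phi(x)$ whenever the current state is $x$. For an initial state $x$ and policy $\pi$, $\mathbb{E}_x^\pi$ is the expectation with respect to the induced probability measure on trajectories $(x_0,a_0,x_1,a_1,\dots)$ (Ionescu Tulcea theorem). Criteria. $v_{N,\alpha}^\pi(x)=\mathbb{E}_x^\pi\sum_{t=0}^{N-1}\alpha^t c(x_t,a_t)$ for $N\in\{1,2,\dots\}$, $\alpha\in[0,1]$; $v_\alpha^\pi(x)=\mathbb{E}_x^\pi\sum_{t=0}^{\infty}\alpha^t c(x_t,a_t)$ for $\alpha\in[0,1)$; $v_\alpha(x)=\inf_{\pi\in\Pi}v_\alpha^\pi(x)$; $w^\pi(x)=\limsup_{N\to\infty}\frac1N v_{N,1}^\pi(x)$; $w(x)=\inf_{\pi\in\Pi}w^\pi(x)$.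 Notation. $m_\alpha=\inf_{x\in\mathbb{X}}v_\alpha(x)$ (finite for all $\alpha\in[0,1)$ when $w^*<+\infty$), $u_\alpha(x)=v_\alpha(x)-m_\alpha$. Definitions. A function $f:\mathbb{U}\to\mathbb{R}\cup\{+\infty\}$ on a metric space $\mathbb{U}$ is inf-compact if for every $\lambda\in\mathbb{R}$ the level set $\{s\in\mathbb{U}:f(s)\le\lambda\}$ is compact. Setwise continuity of $q(\cdot|x,a)$ in $a$ means that $a\mapsto q(B|x,a)$ is continuous on $\mathbb{A}$ for every $B\in\mathcal{B}(\mathbb{X})$. The sequence $\{u_{\alpha_n}\}$ of nonnegative functions is asymptotically uniformly integrable with respect to a probability measure $\mu$ on $\mathbb{X}$ if $\lim_{K\to+\infty}\limsup_{n\to\infty}\int_{\mathbb{X}}u_{\alpha_n}(z)\mathbf{1}\{u_{\alpha_n}(z)\ge K\}\,\mu(dz)=0$; equivalently, there exists $N\ge1$ such that $\{u_{\alpha_N},u_{\alpha_{N+1}},\dots\}$ is uniformly integrable with respect to $\mu$. *)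

(* Defs.v *)
From HB Require Import structures.
From mathcomp Require Import all_boot all_order all_algebra.
From mathcomp Require Import all_classical all_reals all_analysis.
From mathcomp Require Import measurable_realfun.

Set Implicit Arguments.
Unset Strict Implicit.
Unset Printing Implicit Defensive.
Import Order.TTheory GRing.Theory Num.Theory.
Import numFieldNormedType.Exports.

Local Open Scope classical_set_scope.
Local Open Scope ring_scope.
Local Open Scope ereal_scope.

Notation borel T := (g_sigma_algebraType (@open T)).

(* [X] is homeomorphic to a Borel subset [range i] of a Polish space [P]. A
   Hausdorff pseudometric space is a metric space, so [P] below is a complete
   separable metric space; the third condition on [i] says that [X] carries the
   subspace topology of [range i]. *)
Definition borel_subset_of_polish (R : realType) (X : topologicalType) : Prop :=
  exists (P : completePseudoMetricType R) (i : X -> P),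
    [/\ hausdorff_space P,
        (exists2 D : set P, countable D & dense D),
        injective i,
        (forall U : set X, open U <-> exists2 V : set P, open V & U = i @^-1` V) &
        <<s (@open P) >> (range i)].

Definition inf_compact (R : realType) (U : topologicalType) (f : U -> \bar R) : Prop :=
  forall l : R, compact [set s | f s <= l%:E].

Definition asymptotically_uniformly_integrable (R : realType)
    d (T : measurableType d) (mu : {measure set T -> \bar R})
    (f : (T -> \bar R)^nat) : Prop :=
  limn_esup (fun n => \int[mu]_(z in [set z | K%:E <= f n z]) f n z)
    @[K --> +oo%R] --> 0.

Section MarkovDecisionProcess.
Context (R : realType) (X A : ptopologicalType).

(* Histories [(x_0, a_0), ..., (x_{t-1}, a_{t-1}), x_t]. *)
Definition history (t : nat) : Type := (t.-tuple (borel X * borel A) * borel X)%type.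
HB.instance Definition _ t := Measurable.on (history t).

Definition policy : Type := forall t : nat, R.-pker (history t) ~> borel A.

(* Trajectories [(x_t, a_t)_t], with the sigma-algebra generated by the
   coordinates. *)
Definition trajectory_generators : set (set (nat -> borel X * borel A)) :=
  \bigcup_t preimage_set_system [set: nat -> borel X * borel A]
              (fun w => w t) measurable.

Definition trajectory : Type := g_sigma_algebraType trajectory_generators.
HB.instance Definition _ := Measurable.on trajectory.

Definition past (t : nat) (w : trajectory) : t.-tuple (borel X * borel A) :=
  [tuple w i | i < t].

Definition history_of (t : nat) (w : trajectory) : history t :=
  (past t w, (w t).1).

Section Kernel.
Variable q : R.-pker (borel X * borel A)%type ~> borel X.

(* [P] is the law of the process started at [x] and controlled by [pi]: [x_0 = x],
   the conditional law of [a_t] given the history [h_t] is [pi t h_t], and the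
   conditional law of [x_{t+1}] given [(h_t, a_t)] is [q (x_t, a_t)]. *)
Definition is_strategic_measure (pi : policy) (x : X)
    (P : probability trajectory R) : Prop :=
  [/\ forall B : set (borel X), measurable B ->
        P [set w | B (w 0%N).1] = \d_(x : borel X) B,
      forall (t : nat) (H : set (history t)) (C : set (borel A)),
        measurable H -> measurable C ->
        P [set w | H (history_of t w) /\ C (w t).2] =
        \int[P]_(w in [set w | H (history_of t w)]) pi t (history_of t w) C &
      forall (t : nat) (G : set (t.+1.-tuple (borel X * borel A)))
          (B : set (borel X)),
        measurable G -> measurable B ->
        P [set w | G (past t.+1 w) /\ B (w t.+1).1] =
        \int[P]_(w in [set w | G (past t.+1 w)]) q (w t) B].

(* There is exactly one such law by the Ionescu Tulcea theorem, so the default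
   value [\d_point] of [xget] is never reached. *)
Definition strategic_measure (pi : policy) (x : X) : probability trajectory R :=
  xget (\d_(point : trajectory) : probability trajectory R)
    [set P | is_strategic_measure pi x P].

Variable c : borel X * borel A -> \bar R.

Definition finite_horizon_cost (N : nat) (alpha : R) (pi : policy) (x : X) : \bar R :=
  \int[strategic_measure pi x]_w \sum_(0 <= t < N) ((alpha ^+ t)%:E * c (w t)).

Definition discounted_cost (alpha : R) (pi : policy) (x : X) : \bar R :=
  \int[strategic_measure pi x]_w \sum_(0 <= t <oo) ((alpha ^+ t)%:E * c (w t)).

Definition discounted_value (alpha : R) (x : X) : \bar R :=
  ereal_inf (range (fun pi : policy => discounted_cost alpha pi x)).

(* The horizon is [N.+1], as the average over [N] steps requires [N >= 1]. *)
Definition average_cost (pi : policy) (x : X) : \bar R :=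
  limn_esup (fun N => (N.+1%:R^-1)%:E * finite_horizon_cost N.+1 1%R pi x).

Definition average_value (x : X) : \bar R :=
  ereal_inf (range (fun pi : policy => average_cost pi x)).

Definition min_average_value : \bar R := ereal_inf (range average_value).

Definition min_discounted_value (alpha : R) : \bar R :=
  ereal_inf (range (discounted_value alpha)).

Definition relative_value (alpha : R) (x : X) : \bar R :=
  discounted_value alpha x - min_discounted_value alpha.

Definition assumption_S_star : Prop :=
  (forall x : X, inf_compact (fun a : A => c (x, a))) /\
  (forall (x : X) (B : set (borel X)), measurable B ->
     continuous (fun a : A => q (x, a) B)).

Section Sequence.
Variable alpha : R^nat.

Definition assumption_B_lower : Prop :=
  min_average_value < +oo /\
  forall x : X, limn_einf (fun n => relative_value (alpha n) x) < +oo.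

Definition assumption_LEC_ii : Prop :=
  forall x : X, cvgn (fun n => relative_value (alpha n) x).

Definition assumption_LEC_iii : Prop :=
  forall (x : X) (a : A), asymptotically_uniformly_integrable (q (x, a))
    (fun n => relative_value (alpha n)).

Definition limit_relative_value (x : X) : \bar R :=
  limn_einf (fun n => relative_value (alpha n) x).

End Sequence.

End Kernel.
End MarkovDecisionProcess.

(* Main.v *)
Require Import Defs.
From HB Require Import structures.
From mathcomp Require Import finmap all_boot all_order all_algebra.
From mathcomp Require Import all_classical all_reals all_analysis.
From mathcomp Require Import measurable_realfun lra.

(** The proof follows the vanishing discount method.

    Subtracting its lower bound from [c] adds a constant to average costs and
    leaves relative values unchanged, so [c] may be taken nonnegative. Write
    [T_b V (x, a) = c (x, a) + b \int V dq(x, a)] for the Bellman operator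
    ([bellman]).

    For a fixed discount factor [b], setwise continuity makes [a |-> \int V dq(x, a)]
    lower semicontinuous for every measurable [V >= 0] ([closed_sublevels_integral]),
    so [T_b V] is inf-compact in [a]. Its minimum over [a] is a measurable
    function of [x] and is attained by a measurable selector
    ([measurable_minimiser]). Value iteration from [0] therefore increases to
    a measurable solution of [V = min T_b V], which is the discounted value
    ([discounted_value_optimal]). Let [m_n] be its infimum over the states for the
    discount factor [alpha_n], and [lam_n = (1 - alpha_n) m_n]; the relative value
    [u_n] satisfies
        [u_n(x) + lam_n = min_a T_(alpha_n) u_n (x, a)].

    Let [n] tend to infinity. Abel summation gives [limsup lam_n <= w]
    ([normalised_minimum_le]). Whenever [limsup lam_n <= L], nested compact level
    sets produce an action with [T_1 u (x, a) <= L + u(x)]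
    ([optimality_inequality]); iterating this inequality along a minimising
    stationary policy bounds its average cost by [L], hence [w <= L]
    ([min_average_value_le]). So [limsup lam_n = w], and [L = w] gives one half
    of the optimality equation. For the other half fix [a]: asymptotic uniform
    integrability gives [limsup \int u_n dq(x, a) <= \int u dq(x, a)]
    ([asymptotically_uniformly_integrable_limit]), and letting [n] tend to
    infinity along indices with [lam_n] close to [w] in
    [u_n(x) + lam_n <= T_(alpha_n) u_n (x, a)] yields [u(x) + w <= T_1 u (x, a)].

    Two classical theorems carry these arguments. Measurable selection for
    Borel sets with compact sections rests on Novikov's separation theorem for
    Suslin sets ([novikov_separation]), which shows that the points of [X] whose
    section meets a given closed set form a Borel set ([measurable_section_meets]).
    Costs can be computed from the transition probabilities because strategic
    measures exist, by the Ionescu Tulcea theorem ([ionescu_tulcea]). *)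

Import Order.TTheory GRing.Theory Num.Theory.
Import numFieldNormedType.Exports.
Local Open Scope classical_set_scope.
Local Open Scope ring_scope.
Local Open Scope ereal_scope.
Set Implicit Arguments.
Unset Strict Implicit.
Unset Printing Implicit Defensive.

(** * Suslin sets and Novikov's separation theorem *)

Definition agree (E : Type) (n : nat) (s t : nat -> E) : Prop :=
  forall i, (i < n)%N -> s i = t i.

Definition update (E : Type) (k : nat) (s : nat -> E) (e : E) : nat -> E :=
  fun i => if i == k then e else s i.

Lemma agree_update (E : Type) (k : nat) (s : nat -> E) (e : E) :
  agree k s (update k s e).
Proof. by move=> i ik; rewrite /update ltn_eqF. Qed.

Lemma agree_le (E : Type) (m n : nat) (s t : nat -> E) :
  (m <= n)%N -> agree n s t -> agree m s t.
Proof. by move=> mn st i im; apply: st; exact: leq_trans im mn. Qed.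

Lemma agree_sym (E : Type) (n : nat) (s t : nat -> E) : agree n s t -> agree n t s.
Proof. by move=> st i /st. Qed.

Lemma agree_trans (E : Type) (n : nat) (s t r : nat -> E) :
  agree n s t -> agree n t r -> agree n s r.
Proof. by move=> st tr i ni; rewrite st// tr. Qed.

(** Dependent choice along a sequence. As [Q k] depends only on the first [k]
terms, the diagonal of the successive updates satisfies all the [Q k]. It builds
the branch of a non-separable family in Novikov's theorem and the trajectory in
the Ionescu Tulcea theorem. *)
Lemma sequence_of_updates (E : Type) (Q : nat -> (nat -> E) -> Prop)
    (w0 : nat -> E) :
  (forall k s t, agree k s t -> Q k s -> Q k t) ->
  Q 0%N w0 ->
  (forall k s, Q k s -> exists e, Q k.+1 (update k s e)) ->
  exists w, forall k, Q k w.
Proof.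
move=> Qagree Q0 QS.
have step (ks : nat * (nat -> E)) : exists e, Q ks.1 ks.2 ->
    Q ks.1.+1 (update ks.1 ks.2 e).
  have [/QS[e ?]|nQ] := pselect (Q ks.1 ks.2); first by exists e.
  by exists (w0 0%N).
have [g gP] := choice step.
pose fix w n := if n is k.+1 then update k (w k) (g (k, w k)) else w0.
have Qw n : Q n (w n) by elim: n => // k IH; exact: (gP (k, w k)).
have wS n i : (i < n)%N -> w n i = w i.+1 i.
  elim: n => // n IH; rewrite ltnS leq_eqVlt => /predU1P[->//|i_n].
  by rewrite -IH// /= /update ltn_eqF.
exists (fun i => w i.+1 i) => k; apply: Qagree (Qw k) => i; exact: wS.
Qed.

(** A Suslin set is a continuous image of a closed set of sequences of integers.
The topology of [T] enters only through a countable subbase [U], so that the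
theory applies to a measurable space for any convenient choice of [U]. *)

Section suslin.
Variables (T : Type) (U : nat -> set T).

Definition closed_branches (F : set (nat -> nat)) : Prop :=
  forall s, (forall n, exists2 t, F t & agree n s t) -> F s.

Definition branch_continuous (F : set (nat -> nat)) (f : (nat -> nat) -> T) : Prop :=
  forall s k, F s -> U k (f s) ->
    exists n, forall t, F t -> agree n s t -> U k (f t).

Definition suslin (S : set T) : Prop :=
  exists F f, [/\ closed_branches F, branch_continuous F f & S = f @` F].

Lemma suslin0 (x : T) : suslin set0.
Proof.
exists set0, (fun=> x); split => //; last by rewrite image_set0.
by move=> s /(_ 0%N)[].
Qed.

(** The first term of a branch tells which of the sets the rest of the branch
represents. *)
Lemma suslin_bigcup (S : nat -> set T) :
  (forall n, suslin (S n)) -> suslin (\bigcup_n S n).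
Proof.
move=> /choice[F /choice[f FfP]].
exists [set s | F (s 0%N) (fun i => s i.+1)],
  (fun s => f (s 0%N) (fun i => s i.+1)); split.
- move=> s H /=; have [clF _ _] := FfP (s 0%N).
  apply: clF => n; have [t /= Ft st] := H n.+1.
  exists (fun i => t i.+1); first by rewrite st.
  by move=> i i_n; apply: st.
- move=> s k /= Fs Uk; have [_ ctf _] := FfP (s 0%N).
  have [n nP] := ctf _ _ Fs Uk; exists n.+1 => t Ft st.
  rewrite -(st 0%N)//; apply: nP; first by rewrite (st 0%N).
  by move=> i i_n; apply: st.
- apply/seteqP; split.
    move=> x [n _]; have [_ _ ->] := FfP n; move=> [s Fs <-].
    by exists (fun i => if i is j.+1 then s j else n).
  move=> x [s /= Fs <-]; exists (s 0%N) => //; have [_ _ ->] := FfP (s 0%N).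
  by exists (fun i => s i.+1).
Qed.

Lemma suslinU (A B : set T) : suslin A -> suslin B -> suslin (A `|` B).
Proof.
move=> sA sB; rewrite -bigcup2E; apply: suslin_bigcup => -[|[|n]] //=.
by have [F [f [_ _ _]]] := sA; exact: (suslin0 (f (fun=> 0%N))).
Qed.

(** A sequence codes countably many sequences, its columns, along the pairing of
[nat * nat]. *)
Definition column (n : nat) (s : nat -> nat) (m : nat) : nat := s (pickle (n, m)).

Lemma column_update (n m k e : nat) (s : nat -> nat) :
  (pickle (n, m) < k)%N -> column n (update k s e) m = column n s m.
Proof. by move=> nmk; rewrite /column /update ltn_eqF. Qed.

Lemma column_surjective (t : nat -> nat -> nat) :
  exists s, forall n, column n s = t n.
Proof.
exists (fun k => if pickle_inv k is Some nm then t nm.1 nm.2 else 0%N) => n.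
by apply/funext => m; rewrite /column pickleK_inv.
Qed.

Lemma agree_column (n N : nat) :
  exists M, forall s t, agree M s t -> agree N (column n s) (column n t).
Proof.
exists (\max_(m < N) (pickle (n, nat_of_ord m)).+1)%N => s t st m mN.
apply: st; exact: (@leq_bigmax _ (fun m : 'I_N => (pickle (n, nat_of_ord m)).+1) (Ordinal mN)).
Qed.

Definition separates_points : Prop :=
  forall x y, x <> y -> exists i j, [/\ U i x, U j y & U i `&` U j = set0].

Hypothesis Usep : separates_points.

(** The columns of a branch represent points of the successive sets, and the
branches all of whose columns represent the same point form a closed set because
the subbase separates points. *)
Lemma suslin_bigcap (S : nat -> set T) :
  (forall n, suslin (S n)) -> suslin (\bigcap_n S n).
Proof.
move=> /choice[F /choice[f FfP]].
exists [set s | forall n, F n (column n s) /\ f n (column n s) = f 0%N (column 0 s)],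
  (fun s => f 0%N (column 0 s)); split.
- move=> s H.
  have Fs n : F n (column n s).
    have [clF _ _] := FfP n; apply: clF => N.
    have [M MP] := agree_column n N; have [t Ft st] := H M.
    by exists (column n t); [case: (Ft n)|exact: MP].
  move=> n; split => //; apply: contrapT => /Usep[i [j [Ui Uj Uij]]].
  have [_ ctn _] := FfP n; have [_ ct0 _] := FfP 0%N.
  have [N NP] := ctn _ _ (Fs n) Ui; have [N0 N0P] := ct0 _ _ (Fs 0%N) Uj.
  have [M MP] := agree_column n N; have [M0 M0P] := agree_column 0 N0.
  have [t Ft st] := H (maxn M M0).
  have [Ftn ftn] := Ft n; have [Ft0 _] := Ft 0%N.
  suff : (U i `&` U j) (f 0%N (column 0 t)) by rewrite Uij.
  split; last by apply: N0P => //; apply/M0P/agree_le/st; exact: leq_maxr.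
  by rewrite -ftn; apply: NP => //; apply/MP/agree_le/st; exact: leq_maxl.
- move=> s k Fs Uk; have [_ ct0 _] := FfP 0%N.
  have [N NP] := ct0 _ _ (Fs 0%N).1 Uk; have [M MP] := agree_column 0 N.
  by exists M => t Ft st; apply: NP; [case: (Ft 0%N)|exact: MP].
- apply/seteqP; split.
    move=> x Sx.
    have /choice[t tP] : forall n, exists t, F n t /\ f n t = x.
      by move=> n; have := Sx n Logic.I; have [_ _ ->] := FfP n => -[t ? <-]; exists t.
    have [s sP] := column_surjective t.
    exists s; last by rewrite sP; case: (tP 0%N).
    by move=> n; rewrite !sP; case: (tP n) => ? ->; case: (tP 0%N).
  move=> x [s Fs <-] n _; have [_ _ ->] := FfP n.
  by case: (Fs n) => Fn fn; exists (column n s).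
Qed.

Hypothesis UT : suslin setT.

(** An open set is the union over [n] of the closed sets of branches whose first
[n] terms force the image to lie in [U k]; the additional first term of a branch
is this [n]. The complement of [U k] is the image of a closed set of branches. *)
Lemma suslin_subbase k : suslin (U k) /\ suslin (~` U k).
Proof.
have [F [f [clF ctf TE]]] := UT; split.
  exists [set s | F (fun i => s i.+1) /\ forall t, F t ->
    agree (s 0%N) (fun i => s i.+1) t -> U k (f t)], (fun s => f (fun i => s i.+1)).
  split.
  - move=> s H; split.
      apply: clF => n; have [t [Ft _] st] := H n.+1.
      by exists (fun i => t i.+1) => // i i_n; exact: st.
    move=> t Ft st; have [r [Fr rP] sr] := H (s 0%N).+1.
    apply: rP => //; rewrite -sr//; apply: agree_trans st.
    by apply: agree_sym => i i_n; exact: sr.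
  - move=> s l [Fs _] Ul; have [n nP] := ctf _ _ Fs Ul.
    by exists n.+1 => t [Ft _] st; apply: nP => // i i_n; exact: st.
  - apply/seteqP; split.
      move=> x Ux; have : [set: T] x by [].
      rewrite TE => -[s Fs fs]; rewrite -fs in Ux *.
      have [n nP] := ctf _ _ Fs Ux.
      by exists (fun i => if i is j.+1 then s j else n).
    by move=> _ [s [Fs sP] <-]; exact: sP.
exists (F `&` [set s | ~ U k (f s)]), f; split.
- move=> s H; have Fs : F s by apply: clF => n; have [t []] := H n; exists t.
  split => // Us; have [n nP] := ctf _ _ Fs Us.
  by have [t [Ft Ut] st] := H n; apply: Ut; exact: nP.
- move=> s l [Fs _] Ul; have [n nP] := ctf _ _ Fs Ul.
  by exists n => t [Ft _]; exact: nP.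
- apply/seteqP; split; last by move=> _ [s []] ? ? <-.
  move=> x Ux; have : [set: T] x by [].
  by rewrite TE => -[s Fs fs]; exists s => //; split => //=; rewrite fs.
Qed.

(** Sets that are Suslin together with their complement form a sigma-algebra. *)
Lemma suslin_sigma_algebra (S : set T) : <<s range U >> S -> suslin S.
Proof.
suff H : <<s range U >> `<=` [set S | suslin S /\ suslin (~` S)].
  by move=> /H[].
apply: smallest_sub; last by move=> _ [k _ <-]; exact: suslin_subbase.
split.
- split; last by rewrite setC0.
  by have [F [f _]] := UT; exact: (suslin0 (f (fun=> 0%N))).
- by move=> A [sA sAC]; rewrite /= setTD setCK.
- move=> A sA; split; first by apply: suslin_bigcup => n; case: (sA n).
  by rewrite setC_bigcup; apply: suslin_bigcap => n; case: (sA n).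
Qed.

End suslin.

Section novikov.
Context d (T : measurableType d) (U : nat -> set T).
Hypothesis Usep : separates_points U.
Hypothesis mU : forall k, measurable (U k).

Definition separable_family (S : nat -> set T) : Prop :=
  exists B : nat -> set T,
    [/\ forall n, measurable (B n), forall n, S n `<=` B n & \bigcap_n B n = set0].

(** Separating sets for all the pieces of [S m] combine into separating sets for
[S] by a union at [m] and intersections elsewhere. Contrapositively, if [S] is not
separable and countably many pieces cover [S m], then some piece can replace [S m]
without making the family separable. *)
Lemma separable_family_split (S : nat -> set T) (m : nat) (S' : nat -> set T) :
  S m = \bigcup_i S' i ->
  (forall i, separable_family (fun n => if n == m then S' i else S n)) ->
  separable_family S.
Proof.
move=> Sm /choice[B BP].
exists (fun n => if n == m then \bigcup_i B i n else \bigcap_i B i n); split.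
- move=> n; case: ifPn => _.
    by apply: bigcup_measurable => i _; case: (BP i).
  by apply: bigcap_measurable => // i _; case: (BP i).
- move=> n x; case: ifPn => [/eqP ->|nm].
    rewrite Sm => -[i _ Six]; exists i => //; have [_ + _] := BP i.
    by move=> /(_ m); rewrite eqxx; exact.
  by move=> Snx i _; have [_ + _] := BP i; move=> /(_ n); rewrite (negbTE nm); exact.
- rewrite -subset0 => x Bx; have := Bx m Logic.I; rewrite eqxx => -[i _ Bimx].
  have [_ _ Bi0] := BP i; rewrite -Bi0 => n _; have := Bx n Logic.I.
  by case: ifPn => [/eqP ->//|_]; exact.
Qed.

Lemma separable_family2 (S : nat -> set T) (m n : nat) (A B : set T) :
  m != n -> measurable A -> measurable B -> A `&` B = set0 ->
  S m `<=` A -> S n `<=` B -> separable_family S.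
Proof.
move=> mn mA mB AB SA SB.
exists (fun i => if i == m then A else if i == n then B else setT); split.
- by move=> i; case: ifP => // _; case: ifP.
- by move=> i; case: ifP => [/eqP ->//|_]; case: ifP => [/eqP ->|].
- rewrite -subset0 => x Bx; rewrite -AB; split.
    by have := Bx m Logic.I; rewrite eqxx.
  by have := Bx n Logic.I; rewrite eqxx eq_sym (negbTE mn).
Qed.

(** A family that is not separable can be refined for ever: fixing one after the
other the terms of the branches that represent the points of all the sets, by
[separable_family_split], keeps it non-separable. In the limit there
remains one branch per set. If these branches represent one and the same point,
it is a common point of the sets; otherwise two of them have images in disjoint
sets [U i] and [U j], and, by continuity, so do all the points of the
corresponding pieces at a finite stage, which are thus separable. *)
Theorem novikov_separation (S : nat -> set T) :
  (forall n, suslin U (S n)) -> \bigcap_n S n = set0 -> separable_family S.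
Proof.
move=> /choice[F /choice[f FfP]] S0; apply: contrapT => nsep.
(* the points of [S n] represented by a branch whose terms with a code below
   [k] agree with column [n] of [t] *)
pose piece k (t : nat -> nat) n := f n @` (F n `&`
  [set s | forall m : nat, (pickle (n, m) < k)%N -> s m = column n t m]).
have [t tP] : exists t, forall k, ~ separable_family (piece k t).
  apply: (@sequence_of_updates nat (fun k t => ~ separable_family (piece k t)) (fun=> 0%N)).
  - move=> k s t st; apply: contra_not; congr separable_family.
    apply/funext => n; congr image; congr setI; apply/seteqP.
    by split => r rP m mk; rewrite rP// /column st.
  - move=> H; apply: nsep; move: H; congr separable_family; apply/funext => n.
    by have [_ _ ->] := FfP n; rewrite /piece; congr image; apply/seteqP; split => [s []|s Fs].
  - move=> k s; apply: contra_notP => /forallNP H.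
    have {}H e : separable_family (piece k.+1 (update k s e)) by exact: contrapT.
    case Ek : (@pickle_inv (nat * nat)%type k) => [[m j]|]; last first.
      have := H 0%N; congr separable_family; apply/funext => n; congr image.
      congr setI; apply/seteqP; split => r rP i ik.
        by rewrite (rP i (ltnW ik)) column_update.
      move: ik; rewrite ltnS leq_eqVlt => /predU1P[ik|ik].
        by move: Ek; rewrite -ik pickleK_inv.
      by rewrite (rP i _) ?column_update.
    have kE : k = pickle (m, j).
      by have := @pickle_invK (nat * nat)%type k; rewrite /obind/oapp /= Ek.
    apply: (@separable_family_split _ m (fun e => piece k.+1 (update k s e) m)).
      rewrite /piece -image_bigcup; congr image; rewrite -setI_bigcupr; congr setI.
      apply/seteqP; split => [r rP|r [e _ rP] i ik].
        exists (r j) => // i; rewrite ltnS leq_eqVlt => /predU1P[|ik].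
          rewrite {1}kE => /(pcan_inj (@pickleK _))[->].
          by rewrite /column -kE /update eqxx.
        by rewrite (rP i _) ?column_update.
      by rewrite (rP i (ltnW ik)) column_update.
    move=> e; have := H e; congr separable_family; apply/funext => n.
    case: ifPn => [/eqP ->//|nm]; congr image; congr setI.
    apply/seteqP; split => r rP i ik.
      by rewrite (rP i (ltnW ik)) column_update.
    move: ik; rewrite ltnS leq_eqVlt => /predU1P[|ik].
      by rewrite kE => /(pcan_inj (@pickleK _))[nmE]; rewrite nmE eqxx in nm.
    by rewrite (rP i _) ?column_update.
(* every finite part of column [n] is determined from some stage on *)
have bound n N : exists k, forall k', (k <= k')%N -> forall s,
    (forall m, (pickle (n, m) < k')%N -> s m = column n t m) -> agree N (column n t) s.
  exists (\max_(m < N) (pickle (n, nat_of_ord m)).+1)%N => k' kk' s sP m mN.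
  rewrite sP//; apply: leq_trans kk'.
  exact: (@leq_bigmax _ (fun m : 'I_N => (pickle (n, nat_of_ord m)).+1) (Ordinal mN)).
have Ft n : F n (column n t).
  have [clF _ _] := FfP n; apply: clF => N; have [k kP] := bound n N.
  apply: contrapT => H; apply: (tP k).
  apply: (@separable_family2 _ n n.+1 set0 setT); rewrite ?setIT//.
    by rewrite neq_ltn ltnSn.
  move=> _ [s [Fs sP] <-]; apply: H; exists s => //; exact: (kP k).
have [fE|/existsNP[n fn]] := pselect (forall n, f n (column n t) = f 0%N (column 0 t)).
  suff : (\bigcap_n S n) (f 0%N (column 0 t)) by rewrite S0.
  by move=> n _; rewrite -(fE n); have [_ _ ->] := FfP n; exists (column n t).
have [i [j [Ui Uj Uij]]] := Usep fn.
have [_ ctn _] := FfP n; have [_ ct0 _] := FfP 0%N.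
have [N NP] := ctn _ _ (Ft n) Ui; have [N0 N0P] := ct0 _ _ (Ft 0%N) Uj.
have [k kP] := bound n N; have [k0 k0P] := bound 0%N N0.
apply: (tP (maxn k k0)).
apply: (@separable_family2 _ n 0%N (U i) (U j)) => //.
- by apply/eqP => n0; apply: fn; rewrite n0.
- by move=> _ [s [Fs sP] <-]; apply: NP => //; apply: kP sP; exact: leq_maxl.
- by move=> _ [s [Fs sP] <-]; apply: N0P => //; apply: k0P sP; exact: leq_maxr.
Qed.

(** Novikov's theorem for the family [A, B, B, ...]. *)
Lemma lusin_separation (A B : set T) : suslin U A -> suslin U B ->
  A `&` B = set0 -> exists C, [/\ measurable C, A `<=` C & C `&` B = set0].
Proof.
move=> sA sB AB.
have [C [mC SC C0]] : separable_family (fun n => if n is 0%N then A else B).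
  apply: novikov_separation => [[|n] //|].
  rewrite -subset0 => x H; rewrite -AB.
  by split; [exact: (H 0%N Logic.I)|exact: (H 1%N Logic.I)].
exists (C 0%N); split; [by []|exact: (SC 0%N)|].
rewrite -subset0 => x [C0x Bx]; rewrite -C0 => -[|n] _ //; exact: (SC n.+1).
Qed.

End novikov.

(** * Borel subsets of Polish spaces as Suslin spaces *)

(** The properties of standard Borel spaces on which separation and selection
rely; unlike a complete metric they pass to Borel subsets and to products. *)
Definition standard_subbase d (T : measurableType d) (U : nat -> set T) : Prop :=
  [/\ @measurable d T = <<s range U>>, separates_points U & suslin U setT].

Section standard_subbase_theory.
Context d (T : measurableType d) (U : nat -> set T).
Hypothesis sU : standard_subbase U.

Lemma standard_subbase_measurable k : measurable (U k).
Proof. by have [-> _ _] := sU; apply: sub_sigma_algebra; exists k. Qed.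

Lemma measurable_suslin (S : set T) : measurable S -> suslin U S.
Proof.
by have [mE Usep UT] := sU; rewrite mE; exact: suslin_sigma_algebra.
Qed.

End standard_subbase_theory.

Lemma suslin_image (T T' : Type) (U : nat -> set T) (U' : nat -> set T')
    (h : T -> T') (S : set T) :
  (forall k, exists l, forall x, S x -> U' k (h x) <-> U l x) ->
  suslin U S -> suslin U' (h @` S).
Proof.
move=> hU [F [f [clF ctf SE]]]; exists F, (h \o f); split => //.
- have Sf s : F s -> S (f s) by rewrite SE => Fs; exists s.
  move=> s k Fs Uk; have [l lP] := hU k.
  have [n nP] := ctf _ _ Fs ((lP _ (Sf _ Fs)).1 Uk).
  by exists n => t Ft /nP - /(_ Ft) Ul; apply/(lP _ (Sf _ Ft)).
- by rewrite SE image_comp.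
Qed.

Definition prod_subbase (T1 T2 : Type) (U1 : nat -> set T1) (U2 : nat -> set T2)
    (k : nat) : set (T1 * T2) :=
  if odd k then snd @^-1` U2 k./2 else fst @^-1` U1 k./2.

Lemma prod_subbase_fst (T1 T2 : Type) (U1 : nat -> set T1) (U2 : nat -> set T2) k :
  prod_subbase U1 U2 k.*2 = fst @^-1` U1 k.
Proof. by rewrite /prod_subbase odd_double doubleK. Qed.

Lemma prod_subbase_snd (T1 T2 : Type) (U1 : nat -> set T1) (U2 : nat -> set T2) k :
  prod_subbase U1 U2 k.*2.+1 = snd @^-1` U2 k.
Proof. by rewrite /prod_subbase /= odd_double uphalf_double. Qed.

(** Even and odd terms of a branch represent the two components. *)
Lemma suslinX (T1 T2 : Type) (U1 : nat -> set T1) (U2 : nat -> set T2)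
    (S1 : set T1) (S2 : set T2) :
  suslin U1 S1 -> suslin U2 S2 -> suslin (prod_subbase U1 U2) (S1 `*` S2).
Proof.
move=> [F1 [f1 [cl1 ct1 ->]]] [F2 [f2 [cl2 ct2 ->]]].
pose ev (s : nat -> nat) i := s i.*2; pose od (s : nat -> nat) i := s i.*2.+1.
have evP n s t : agree n.*2 s t -> agree n (ev s) (ev t).
  by move=> st i i_n; apply: st; rewrite ltn_double.
have odP n s t : agree n.*2 s t -> agree n (od s) (od t).
  by move=> st i i_n; apply: st; rewrite ltn_Sdouble.
exists [set s | F1 (ev s) /\ F2 (od s)], (fun s => (f1 (ev s), f2 (od s))); split.
- move=> s H; split.
    apply: cl1 => n; have [t [? _] st] := H n.*2.
    by exists (ev t) => //; exact: evP.
  apply: cl2 => n; have [t [_ ?] st] := H n.*2.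
  by exists (od t) => //; exact: odP.
- move=> s k [F1s F2s]; rewrite /prod_subbase; case: ifP => _ Uk.
    have [n nP] := ct2 _ _ F2s Uk; exists n.*2 => t [_ Ft] st.
    by apply: nP => //; exact: odP.
  have [n nP] := ct1 _ _ F1s Uk; exists n.*2 => t [Ft _] st.
  by apply: nP => //; exact: evP.
- apply/seteqP; split; last by move=> _ [s [? ?] <-]; split; [exists (ev s)|exists (od s)].
  move=> [_ _] [/= [s1 F1s <-] [s2 F2s <-]].
  pose s i := if odd i then s2 i./2 else s1 i./2.
  have evs : ev s = s1 by apply/funext => i; rewrite /ev /s odd_double doubleK.
  have ods : od s = s2.
    by apply/funext => i; rewrite /od /s /= odd_double uphalf_double.
  by exists s; rewrite /= ?evs ?ods.
Qed.

Section product.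
Context d1 d2 (T1 : measurableType d1) (T2 : measurableType d2).
Variables (U1 : nat -> set T1) (U2 : nat -> set T2).
Hypotheses (sU1 : standard_subbase U1) (sU2 : standard_subbase U2).

Lemma standard_subbase_prod : standard_subbase (prod_subbase U1 U2).
Proof.
have [m1 sep1 T1s] := sU1; have [m2 sep2 T2s] := sU2; split.
- apply/seteqP; split; last first.
    apply: smallest_sub; first exact: sigma_algebra_measurable.
    move=> _ [k _ <-]; rewrite /prod_subbase; case: ifP => _.
      rewrite -[X in measurable X]setTI; apply: measurable_snd => //.
      exact: standard_subbase_measurable sU2 _.
    rewrite -[X in measurable X]setTI; apply: measurable_fst => //.
    exact: standard_subbase_measurable sU1 _.
  apply: smallest_sub; first exact: smallest_sigma_algebra.
  rewrite subUset; split.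
    rewrite m1 -g_sigma_preimageE; apply: smallest_sub; first exact: smallest_sigma_algebra.
    move=> _ [_ [k _ <-] <-]; rewrite setTI -(prod_subbase_fst U1 U2).
    by apply: sub_sigma_algebra; exists k.*2.
  rewrite m2 -g_sigma_preimageE; apply: smallest_sub; first exact: smallest_sigma_algebra.
  move=> _ [_ [k _ <-] <-]; rewrite setTI -(prod_subbase_snd U1 U2).
  by apply: sub_sigma_algebra; exists k.*2.+1.
- move=> [x1 x2] [y1 y2] xy; have [xy1|xy1] := pselect (x1 = y1); last first.
    have [i [j [Ui Uj Uij]]] := sep1 _ _ xy1.
    exists i.*2, j.*2; rewrite !prod_subbase_fst; split => //.
    by rewrite -preimage_setI Uij preimage_set0.
  have /sep2[i [j [Ui Uj Uij]]] : x2 <> y2 by move=> xy2; apply: xy; rewrite xy1 xy2.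
  exists i.*2.+1, j.*2.+1; rewrite !prod_subbase_snd; split => //.
  by rewrite -preimage_setI Uij preimage_set0.
- by rewrite -setXTT; exact: suslinX.
Qed.

Lemma suslin_fst (S : set (T1 * T2)) :
  suslin (prod_subbase U1 U2) S -> suslin U1 (fst @` S).
Proof.
by apply: suslin_image => k; exists k.*2; rewrite prod_subbase_fst.
Qed.

End product.

Section polish.
Context (R : realType) (P : completePseudoMetricType R).
Local Open Scope ring_scope.

(** Interiors are taken because a ball of a pseudometric structure need not be
open. *)
Definition rational_ball (e : nat -> P) (k : nat) : set P :=
  if @unpickle (nat * nat)%type k is Some (i, n) then (ball (e i) n.+1%:R^-1)° else set0.

Lemma rational_ballE (e : nat -> P) i n :
  rational_ball e (pickle (i, n)) = (ball (e i) n.+1%:R^-1)°.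
Proof. by rewrite /rational_ball pickleK. Qed.

Lemma open_rational_ball (e : nat -> P) k : open (rational_ball e k).
Proof.
rewrite /rational_ball; case: unpickle => [[i n]|]; last exact: open0.
exact: open_interior.
Qed.

Variable e : nat -> P.
Hypothesis de : dense (range e).

Lemma rational_ball_basis (V : set P) (x : P) : open V -> V x ->
  exists k, rational_ball e k x /\ rational_ball e k `<=` V.
Proof.
move=> oV Vx; have : nbhs x V by exact: open_nbhs_nbhs.
rewrite -nbhs_ballE => -[/= r r0 rV].
have [n nr] : exists n, n.+1%:R^-1 < r / 2.
  near \oo => n; exists n; near: n; apply: near_infty_natSinv_lt (PosNum _) => //.
  exact: divr_gt0.
have n0 : (0 < n.+1%:R^-1 / 2 :> R) by exact: divr_gt0.
have [y [yx [i _ iy]]] : (ball x (n.+1%:R^-1 / 2))° `&` range e !=set0.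
  apply: de; last exact: open_interior.
  by exists x; apply: nbhsx_ballx.
have {}yx : ball x (n.+1%:R^-1 / 2) (e i) by rewrite iy; exact: interior_subset yx.
exists (pickle (i, n)); rewrite rational_ballE; split.
  rewrite /interior/= -nbhs_ballE; exists (n.+1%:R^-1 / 2) => //= z xz.
  by apply: (@ball_split _ _ x); [exact: ball_sym|].
move=> z /interior_subset/= iz; apply: rV; apply: (@ball_split _ _ (e i)).
  apply: le_ball yx; apply: (le_trans _ (ltW nr)).
  by rewrite ler_pdivrMr// ler_peMr// ler1n.
exact: le_ball (ltW nr) _ iz.
Unshelve. all: by end_near. Qed.

Lemma separates_points_rational_ball :
  hausdorff_space P -> separates_points (rational_ball e).
Proof.
rewrite open_hausdorff => haus x y xy.
have [[A B] [/= /set_mem Ax /set_mem By] [oA oB AB]] := haus x y (introN eqP xy).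
have [i [ix iA]] := rational_ball_basis oA Ax.
have [j [jy jB]] := rational_ball_basis oB By.
exists i, j; split => //; rewrite -subset0 => z [/iA Az /jB Bz].
by move/eqP: AB => AB; have : (A `&` B) z by []; rewrite AB.
Qed.

(** A sequence [s] represents the point common to the closed balls of radius
[1 / (n + 1)] around [e (s n)], when there is one. The sequences with such a point
form a closed set by completeness, and density of [e] makes every point
represented. *)
Lemma suslin_polish : hausdorff_space P -> suslin (rational_ball e) setT.
Proof.
move=> haus.
pose cb (s : nat -> nat) n : set P := closure (ball (e (s n)) n.+1%:R^-1).
have cbP s n x y : cb s n x -> cb s n y -> ball x (5 * n.+1%:R^-1) y.
  move=> sx sy.
  have aux z : cb s n z -> ball (e (s n)) (n.+1%:R^-1 + n.+1%:R^-1) z.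
    move=> /(_ (ball z n.+1%:R^-1))[|w [sw zw]]; first exact: nbhsx_ballx.
    by apply: ball_triangle sw _; exact: ball_sym.
  apply: le_ball (ball_triangle (ball_sym (aux _ sx)) (aux _ sy)).
  rewrite -!mulr2n -mulrnA -[leLHS]mulr_natl; apply: ler_wpM2r => //.
  by rewrite ler_nat.
have small (r : R) : 0 < r -> exists N, forall n, (N <= n)%N -> 5 * n.+1%:R^-1 < r.
  move=> r0; have r5 : 0 < r / 5 by exact: divr_gt0.
  have [N _ NP] := near_infty_natSinv_lt (PosNum r5).
  by exists N => n /NP /=; rewrite ltr_pdivlMr// mulrC.
pose F := [set s | exists x, forall n, cb s n x].
have /choice[f fP] : forall s, exists x, F s -> forall n, cb s n x.
  move=> s; have [[x sx]|nF] := pselect (F s); first by exists x.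
  by exists (e 0%N).
exists F, f; split.
- move=> s H.
  have /choice[t tP] : forall n, exists t, F t /\ agree n.+1 s t.
    by move=> n; have [t] := H n.+1; exists t.
  have cbt m n : (m <= n)%N -> cb s m (f (t n)).
    move=> mn; have [Ft st] := tP n; have := fP _ Ft m.
    by rewrite /cb (st m).
  pose G := (f \o t) @ \oo.
  have : cvg G.
    apply: cauchy_cvg; apply: cauchy_exP => r r0.
    have [N NP] := small _ r0; exists (f (t N)); exists N => // n /= Nn.
    by apply: le_ball (ltW (NP _ (leqnn N))) _ _; apply: (cbP s); exact: cbt.
  move=> cG; exists (lim G) => m.
  apply: (closed_cvg _ (@closed_closure _ _) _ _ cG).
  by exists m => // n /= mn; exact: cbt.
- move=> s k Fs Uk.
  have : nbhs (f s) (rational_ball e k).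
    by apply: open_nbhs_nbhs; split => //; exact: open_rational_ball.
  rewrite -nbhs_ballE => -[/= r /small[N NP] rU]; exists N.+1 => t Ft st.
  apply: rU; apply: le_ball (ltW (NP _ (leqnn N))) _ _.
  by apply: (cbP s); [exact: fP|have := fP _ Ft N; rewrite /cb st].
- apply/esym/seteqP; split => // x _.
  have /choice[s sP] : forall n, exists i, ball (e i) n.+1%:R^-1 x.
    move=> n; have [y [xy [i _ iy]]] : (ball x n.+1%:R^-1)° `&` range e !=set0.
      apply: de; last exact: open_interior.
      by exists x; apply: nbhsx_ballx.
    by exists i; rewrite iy; apply: ball_sym; exact: interior_subset xy.
  have Fs : F s by exists x => n; exact: subset_closure.
  exists s => //; apply: haus => A B /= nA nB.
  move: nA; rewrite -nbhs_ballE => -[/= r /small[N NP] rA].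
  exists x; split; last exact: nbhs_singleton.
  apply: rA; apply: le_ball (ltW (NP _ (leqnn N))) _ _.
  by apply: (cbP s); [exact: fP|exact: subset_closure].
Qed.

Lemma standard_subbase_polish :
  hausdorff_space P -> standard_subbase (rational_ball e : nat -> set (borel P)).
Proof.
move=> haus; split.
- apply/seteqP; split; last first.
    apply: smallest_sub; first exact: smallest_sigma_algebra.
    move=> _ [k _ <-]; apply: sub_sigma_algebra; exact: open_rational_ball.
  apply: smallest_sub; first exact: smallest_sigma_algebra.
  move=> V /= oV.
  rewrite [V](_ : _ = \bigcup_(k in [set k | rational_ball e k `<=` V]) rational_ball e k).
    have := @bigcup_measurable _ (g_sigma_algebraType (range (rational_ball e))).
    by apply => k _; apply: sub_sigma_algebra; exists k.
  apply/seteqP; split => [x Vx|x [k kV]]; last exact: kV.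
  by have [k [kx kV]] := rational_ball_basis oV Vx; exists k.
- exact: separates_points_rational_ball.
- exact: suslin_polish.
Qed.

End polish.

Section embedding.
Context (R : realType) (X : ptopologicalType) (P : completePseudoMetricType R).
Variable i : X -> P.
Hypothesis i_inj : injective i.
Hypothesis i_open : forall O : set X, open O <-> exists2 V : set P, open V & O = i @^-1` V.
Hypothesis mi : <<s (@open P) >> (range i).

(** The inverse of the embedding, extended by a constant outside its range, is
measurable because the range is Borel. *)
Lemma embedding_retraction : exists r : borel P -> borel X,
  measurable_fun setT r /\ cancel i r.
Proof.
have /choice[r rP] : forall p, exists x, (forall y, i y = p -> x = y) /\
    (~ range i p -> x = point).
  move=> p; have [[x _ <-]|np] := pselect (range i p).
    by exists x; split => [y /i_inj //|[]]; exists x.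
  by exists point; split => // y yp; exfalso; apply: np; exists y.
have ir : cancel i r by move=> x; exact: (rP _).1.
exists r; split => //.
apply: (@measurability _ _ (borel P) (borel X) setT r (@open X)) => // _ [ O oO <-]; rewrite setTI.
have [V oV OE] := (i_open O).1 oO.
rewrite (_ : _ @^-1` _ = (V `&` range i) `|`
    (~` range i `&` [set _ | O point])); last first.
  apply/seteqP; split => [p /= Op|p [[Vp [x _ xp]]|[np /=]]].
  - have [ip|np] := pselect (range i p); last by right; split => //=; rewrite -((rP p).2 np).
    by left; split => //; case: ip Op => x _ <-; rewrite ir OE.
  - by rewrite /= -xp ir OE /= xp.
  - by rewrite ((rP p).2 np).
apply: measurableU.
  by apply: measurableI => //; exact: sub_sigma_algebra.
apply: measurableI; first exact: measurableC.
have [Op|nOp] := pselect (O point).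
  by rewrite (_ : [set _ | _] = setT) //; apply/seteqP; split.
by rewrite (_ : [set _ | _] = set0) //; apply/seteqP; split.
Qed.

Hypothesis haus : hausdorff_space P.
Variable e : nat -> P.
Hypothesis de : dense (range e).

(** The Borel set [range i] is Suslin in [P], and the retraction maps it onto
[X] compatibly with the subbases. *)
Lemma standard_subbase_embedding :
  standard_subbase (fun k => i @^-1` rational_ball e k : set (borel X)).
Proof.
have [mE sep PT] := standard_subbase_polish de haus.
have [r [_ ir]] := embedding_retraction.
split.
- apply/seteqP; split; last first.
    apply: smallest_sub; first exact: smallest_sigma_algebra.
    move=> _ [k _ <-]; apply: sub_sigma_algebra; apply/i_open.
    by exists (rational_ball e k) => //; exact: open_rational_ball.
  apply: smallest_sub; first exact: smallest_sigma_algebra.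
  move=> O /i_open[V oV ->].
  rewrite [V](_ : _ = \bigcup_(k in [set k | rational_ball e k `<=` V]) rational_ball e k).
    rewrite preimage_bigcup.
    have := @bigcup_measurable _ (g_sigma_algebraType
      (range (fun k => i @^-1` rational_ball e k : set (borel X)))).
    by apply => k _; apply: sub_sigma_algebra; exists k.
  apply/seteqP; split => [x Vx|x [k kV]]; last exact: kV.
  by have [k [kx kV]] := rational_ball_basis de oV Vx; exists k.
- move=> x y xy.
  have /sep[k [l [kx ly kl]]] : i x <> i y by move=> /i_inj.
  by exists k, l; split => //; rewrite -preimage_setI kl preimage_set0.
- rewrite [setT](_ : _ = r @` range i); last first.
    by apply/esym/seteqP; split => // x _; exists (i x); [exists x|exact: ir].
  apply: (@suslin_image _ _ (rational_ball e)).
    by move=> k; exists k => _ [x _ <-]; rewrite /= ir.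
  exact: (measurable_suslin (standard_subbase_polish de haus)).
Qed.

End embedding.

Lemma countable_dense_sequence (P : ptopologicalType) (D : set P) :
  countable D -> dense D -> exists e : nat -> P, dense (range e).
Proof.
move=> /countable_injP[f] f_inj dD.
have /choice[e eP] : forall n, exists x, forall y, D y -> f y = n -> x = y.
  move=> n; have [[y [Dy fy]]|nD] := pselect (exists y, D y /\ f y = n).
    by exists y => z Dz fz; apply: f_inj; rewrite ?inE// fz.
  by exists point => y Dy fy; exfalso; apply: nD; exists y.
exists e => O O0 oO; have [x [Ox Dx]] := dD _ O0 oO.
by exists x; split => //; exists (f x) => //; exact: eP.
Qed.

Lemma borel_subset_of_polish_standard (R : realType) (X : ptopologicalType) :
  borel_subset_of_polish R X -> exists U : nat -> set (borel X), standard_subbase U.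
Proof.
move=> [P [i [haus [D cD dD] i_inj i_open mi]]].
have [e de] := countable_dense_sequence cD dD.
by eexists; exact: (standard_subbase_embedding i_inj i_open mi haus de).
Qed.

(** * Borel sets with compact sections *)

Section projection.
Context d (X : measurableType d) (U : nat -> set X).
Hypothesis sU : standard_subbase U.
Context (R : realType) (Q : completePseudoMetricType R).
Hypothesis haus : hausdorff_space Q.
Variable e : nat -> Q.
Hypothesis de : dense (range e).

Let V := rational_ball e : nat -> set Q.
Let sV : standard_subbase (V : nat -> set (borel Q)) := standard_subbase_polish de haus.
Let UV := prod_subbase U (V : nat -> set (borel Q)).
Let sUV : standard_subbase UV := standard_subbase_prod sU sV.

Let measurable_open (O : set Q) : open O -> measurable (O : set (borel Q)).
Proof. exact: sub_sigma_algebra. Qed.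

(** An open set that misses a compact set as soon as [m] is large enough. Missing
[far_from_centers k (b k)] for all [k] is a total boundedness condition, stated
through countably many open sets. *)
Definition far_from_centers (k m : nat) : set Q :=
  ~` \bigcup_(j in `I_m) closure (ball (e j) k.+1%:R^-1%R).

Lemma open_far_from_centers k m : open (far_from_centers k m).
Proof.
apply: closed_openC; apply: closed_bigcup; first exact: finite_II.
by move=> j _; exact: closed_closure.
Qed.

(** For every [k], finitely many closed balls of radius [1 / (k + 1)] contain a
tail of the sequence, so an ultrafilter containing the tails is Cauchy. Its limit lies
in every closed set that contains a tail. *)
Lemma cluster_of_bounded (y : nat -> Q) (b : nat -> nat) :
  (forall k, \forall n \near \oo, ~ far_from_centers k (b k) (y n)) ->
  exists z, forall W, closed W -> (\forall n \near \oo, W (y n)) -> W z.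
Proof.
move=> yb.
have [G [GU yG]] := @ultraFilterLemma _ (y @ \oo) _.
have finite_choice m (A : nat -> set Q) :
    G (\bigcup_(j in `I_m) A j) -> exists j, G (A j).
  elim: m => [|m IH].
    by rewrite II0 bigcup_set0 => /filter_not_empty.
  rewrite IIS bigcup_setU bigcup_set1 => GA.
  have [|GnA] := in_ultra_setVsetC (A m) GU; first by exists m.
  apply: IH; apply: filterS (filterI GA GnA) => z [[//|Az nAz]].
  by case: nAz.
have cG : cvg G.
  apply: cauchy_cvg; apply: cauchy_exP => r r0.
  have r2 : (0 < r / 2)%R by exact: divr_gt0.
  have [k _ kP] := near_infty_natSinv_lt (PosNum r2).
  have {}kP : (k.+1%:R^-1 < r / 2)%R by exact: (kP k (leqnn k)).
  have /finite_choice[j Gj] : G (\bigcup_(j in `I_(b k)) closure (ball (e j) k.+1%:R^-1%R)).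
    by apply: yG; apply: filterS (yb k) => n /contrapT.
  exists (e j); apply: filterS Gj => z zj.
  have [w [jw zw]] := zj _ (nbhsx_ballx z _ r2).
  apply: (@ball_split _ _ w); last exact: ball_sym.
  exact: le_ball (ltW kP) _ jw.
exists (lim G) => W cW yW.
have GW : G W by exact: yG.
by have := @closed_cvg _ _ G _ id W cW GW (lim G); apply.
Qed.

Variable C : set (X * borel Q).
Hypothesis mC : measurable C.
Hypothesis cC : forall x, compact ([set y | C (x, y)] : set Q).

Definition section_misses (O : set Q) : set X := [set x | forall y, C (x, y) -> ~ O y].

Lemma suslin_section_meets (O : set Q) : open O -> suslin U (~` section_misses O).
Proof.
move=> oO.
have -> : ~` section_misses O = fst @` (C `&` snd @^-1` O).
  apply/seteqP; split => [x /existsNP[y /not_implyP[Cxy /contrapT Oy]]|].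
    by exists (x, y).
  by move=> _ [[x y] [/= Cxy Oy] <-] /(_ _ Cxy).
apply: suslin_fst; apply: (measurable_suslin sUV); apply: measurableI => //.
by rewrite -[X in measurable X]setTI; apply: measurable_snd => //; exact: measurable_open.
Qed.

(** The Kunugui-Novikov theorem: the complement of [C], whose sections are open,
is a countable union of rectangles [B n `*` V n] with [B n] Borel. The sections
give the decomposition with [section_misses (V n)] instead of [B n]. These sets are
only complements of Suslin sets, so Novikov's theorem shrinks the rectangles to
Borel sets that still cover, and Lusin's theorem inserts a Borel set between the
projection of each shrunk rectangle and [section_misses (V n)]. *)
Lemma open_sections_decomposition : exists B : nat -> set X,
  [/\ forall n, measurable (B n), forall n, B n `<=` section_misses (V n) &
      forall x y, ~ C (x, y) -> exists n, B n x /\ V n y].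
Proof.
have [_ sepU _] := sU; have [_ sepUV _] := sUV; have [_ sepV VT] := sV.
have oV n : open (V n) by exact: open_rational_ball.
pose S n : set (X * borel Q) := if n is m.+1 then
  ~` (section_misses (V m) `*` V m) else ~` C.
have [B [mB SB B0]] : separable_family S.
  apply: (@novikov_separation _ _ _ sepUV); first exact: standard_subbase_measurable sUV.
    move=> [|n]; first by apply: (measurable_suslin sUV); exact: measurableC.
    have -> : S n.+1 = (~` section_misses (V n) `*` setT) `|` (snd @^-1` (~` V n)).
      apply/seteqP; split => [[x y] /not_andP[] ?|[x y] [[? _]|?]].
      - by left.
      - by right.
      - by case.
      - by case.
    apply: suslinU; first by apply: suslinX => //; exact: suslin_section_meets.
    apply: (measurable_suslin sUV).
    rewrite -[X in measurable X]setTI; apply: measurable_snd => //.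
    by apply: measurableC; exact: measurable_open.
  rewrite -subset0 => -[x y] H.
  have nC := H 0%N Logic.I.
  have oD : open (~` [set y | C (x, y)] : set Q).
    by apply: closed_openC; exact: compact_closed.
  have [n [ny nD]] := rational_ball_basis de oD nC.
  apply: (H n.+1 Logic.I); split => //= z Cxz Vz; exact: (nD z Vz).
have /choice[D DP] : forall n, exists D, [/\ measurable D,
    fst @` (~` B n.+1) `<=` D & D `&` ~` section_misses (V n) = set0].
  move=> n; apply: (@lusin_separation _ _ U) => //.
  - exact: standard_subbase_measurable sU.
  - apply: suslin_fst; apply: (measurable_suslin sUV); exact: measurableC.
  - exact: suslin_section_meets.
  - rewrite -subset0 => x [[[a y] /= nB <-] nM]; apply: nB; apply: (SB n.+1).
    by move=> [].
exists D; split.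
- by move=> n; case: (DP n).
- move=> n x Dx; apply: contrapT => nM; have [_ _ D0] := DP n.
  by have : (D n `&` ~` section_misses (V n)) x by []; rewrite D0.
- move=> x y nC; have : ~ (\bigcap_n B n) (x, y) by rewrite B0.
  move=> /existsNP[[|n] /not_implyP[_ nB]]; first by case: nB; exact: (SB 0%N).
  exists n; have [_ DB _] := DP n; split; first by apply: DB; exists (x, y).
  by apply: contrapT => nV; apply: nB; apply: (SB n.+1) => -[].
Qed.

(** A compact section misses [far_from_centers k m] for large [m]; Novikov's
theorem replaces these conditions on [x], which are complements of Suslin
conditions, by stronger Borel ones that still cover [X]. *)
Lemma section_bounds (k : nat) : exists B : nat -> set X,
  [/\ forall m, measurable (B m),
      forall m, B m `<=` section_misses (far_from_centers k m) &
      forall x, exists m, B m x].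
Proof.
have [_ sepU _] := sU.
have [B [mB SB B0]] :
    separable_family (fun m => ~` section_misses (far_from_centers k m)).
  apply: (@novikov_separation _ _ _ sepU); first exact: standard_subbase_measurable sU.
    by move=> m; apply: suslin_section_meets; exact: open_far_from_centers.
  rewrite -subset0 => x H.
  have k0 : (0 < k.+1%:R^-1 / 2 :> R)%R by exact: divr_gt0.
  have /compact_near_coveringP/(_ nat \oo (fun m y => ~ far_from_centers k m y)) := (@cC x).
  case.
    move=> y Cxy.
    have [z [yz [j _ jz]]] : (ball y (k.+1%:R^-1 / 2)%R)° `&` range e !=set0.
      by apply: de; [exists y; exact: nbhsx_ballx|exact: open_interior].
    have {}yz : ball y (k.+1%:R^-1 / 2)%R (e j) by rewrite jz; exact: interior_subset yz.
    exists (ball y (k.+1%:R^-1 / 2)%R, [set m | (j < m)%N]).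
      by split; [exact: nbhsx_ballx|exists j.+1].
    move=> [y' m] [/= yy' jm]; apply; exists j => //; apply: subset_closure.
    by apply: (@ball_split _ _ y) => //; exact: ball_sym.
  move=> m _ mP; apply: (H m Logic.I) => y Cxy; exact: (mP m (leqnn m)).
exists (fun m => ~` B m); split.
- by move=> m; exact: measurableC.
- by move=> m x nB; apply: contrapT => nM; apply: nB; exact: SB.
- move=> x; have : ~ (\bigcap_n B n) x by rewrite B0.
  by move=> /existsNP[m /not_implyP[_ ?]]; exists m.
Qed.

(** A section misses the closed set [W] exactly when finitely many open sets,
among countably many known to miss the section, cover [W]: each open set [O i] is
known to miss the section of the points of a Borel set [B i], so this is a
countable union of Borel conditions. If no finite list covers [W], points [y n]
of [W] escape the first [n] known sets; the known sets from [section_bounds] give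
the sequence [y] a cluster point, and those from [open_sections_decomposition]
force it into the section. *)
Lemma measurable_section_meets (W : set Q) : closed W ->
  measurable [set x | exists y, C (x, y) /\ W y].
Proof.
move=> cW.
have [B1 [mB1 B1M B1C]] := open_sections_decomposition.
have /choice[B2 B2P] := section_bounds.
(* one index for both countable families of open sets *)
pose I : countType := (nat + nat * nat)%type.
pose O (i : I) : set Q := match i with inl n => V n | inr km => far_from_centers km.1 km.2 end.
pose B (i : I) : set X := match i with inl n => B1 n | inr km => B2 km.1 km.2 end.
have mB i : measurable (B i) by case: i => [n|[k m]] //=; case: (B2P k).
have oO i : open (O i).
  by case: i => [n|[k m]]; [exact: open_rational_ball|exact: open_far_from_centers].
have BO i x y : B i x -> C (x, y) -> ~ O i y.
  case: i => [n|[k m]] /= Bx Cxy; first exact: (B1M n x Bx).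
  by have [_ /(_ m x Bx) + _] := B2P k; apply.
pose cover (L : seq I) := W `<=` [set y | exists2 i, i \in L & O i y].
rewrite [X in measurable X](_ : _ = ~` \bigcup_(L in [set L : seq I | cover L])
    \bigcap_(i in [set i | i \in L]) B i); last first.
  apply/seteqP; split => [x [y [Cxy Wy]] [L cL Bx]|x nL].
    have [i iL Oi] := cL _ Wy; exact: (BO i x y (Bx i iL)).
  apply: contrapT => nCW; pose L (n : nat) : seq I :=
    [seq i <- pmap (@unpickle I) (iota 0 n) | `[< B i x >]].
  (* [L n] lists the indices with code below [n] that are known at [x] *)
  have LP i : B i x -> \forall n \near \oo, i \in L n.
    move=> Bi; exists (pickle i).+1 => // n /= pin.
    rewrite mem_filter mem_pmap asboolT//=; apply/mapP; exists (pickle i).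
      by rewrite mem_iota add0n.
    by rewrite pickleK.
  have /choice[y yP] : forall n, exists y, W y /\ forall i, i \in L n -> ~ O i y.
    move=> n; apply: contrapT => H; apply: nL; exists (L n).
      move=> y Wy; apply: contrapT => H'; apply: H; exists y; split => // i iL Oi.
      by apply: H'; exists i.
    by move=> i; rewrite /= mem_filter => /andP[/asboolP].
  have /choice[b bP] : forall k, exists m, B2 k m x by move=> k; case: (B2P k).
  have [k|z zP] := @cluster_of_bounded y b.
    by apply: filterS (LP (inr (k, b k)) (bP k)) => n /(yP n).2.
  apply: nCW; exists z; split; last by apply: zP => //; exists 0%N => // n _; exact: (yP n).1.
  apply: contrapT => /B1C[n [Bn Vn]].
  have /zP : closed (~` V n) by apply: open_closedC; exact: open_rational_ball.
  by move=> /(_ _)[]//; apply: filterS (LP (inl n) Bn) => k /(yP k).2.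
apply: measurableC; rewrite bigcup_mkcond; apply: countable_bigcupT_measurable => //.
move=> L; case: ifP => _ //.
by apply: fin_bigcap_measurable => //; exact: finite_seq.
Qed.

End projection.

(** * Measurable selection *)

Lemma nested_compact_sets (T : topologicalType) (K : nat -> set T) :
  compact (K 0%N) -> (forall n, closed (K n)) -> (forall n, K n.+1 `<=` K n) ->
  (forall n, K n !=set0) -> exists z, forall n, K n z.
Proof.
move=> cK0 clK KS K0.
have Kle m n : (m <= n)%N -> K n `<=` K m.
  by move=> /subnK <-; elim: (n - m)%N => // k IH; rewrite addSn; exact: subset_trans (KS _) IH.
have /choice[y yK] : forall n, exists y, K n y by move=> n; exact: K0.
have [|z [_ zK]] := cK0 (y @ \oo) _; first by exists 0%N => // n _; exact: Kle (yK n).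
exists z => n; apply: clK => B nB; apply: (zK (K n) B) => //.
by exists n => // m nm; exact: Kle nm _ (yK m).
Qed.

Section selection.
Context d (X : measurableType d) (U : nat -> set X).
Hypothesis sU : standard_subbase U.

Section complete_range.
Context (R : realType) (Q : completePseudoMetricType R).
Hypothesis haus : hausdorff_space Q.
Variable e : nat -> Q.
Hypothesis de : dense (range e).

Let cball k j : set Q := closure (ball (e j) k.+1%:R^-1%R).

Let cball_cover k y : exists j, cball k j y.
Proof.
have [z [yz [j _ jz]]] : (ball y k.+1%:R^-1%R)° `&` range e !=set0.
  by apply: de; [exists y; exact: nbhsx_ballx|exact: open_interior].
exists j; apply: subset_closure; rewrite jz; apply: ball_sym; exact: interior_subset yz.
Qed.

Let cball_separated x y : (forall k, exists j, cball k j x /\ cball k j y) -> x = y.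
Proof.
move=> xy; apply: haus => A B /= nA nB.
move: nA; rewrite -nbhs_ballE => -[/= r r0 rA].
have r4 : (0 < r / 2 / 2)%R by rewrite !divr_gt0.
have [k _ kP] := near_infty_natSinv_lt (PosNum r4).
have {}kP : (k.+1%:R^-1 < r / 2 / 2)%R by exact: (kP k (leqnn k)).
have [j [xj yj]] := xy k; exists y; split; last exact: nbhs_singleton.
have aux z : cball k j z -> ball (e j) (r / 2)%R z.
  move=> zj; have [w [jw zw]] := zj _ (nbhsx_ballx z _ r4).
  apply: (@ball_split _ _ w); last exact: ball_sym.
  exact: le_ball (ltW kP) _ jw.
apply: rA; apply: (@ball_split _ _ (e j)); last exact: aux.
by apply: ball_sym; exact: aux.
Qed.

Let compact_sections (C : set (X * borel Q)) : Prop :=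
  measurable C /\ forall x, compact ([set y | C (x, y)] : set Q) /\ exists y, C (x, y).

(** The section at [x] is intersected with the first closed ball of radius
[1 / (k + 1)] around a term of [e] that it meets; which ball is the first depends
measurably on [x] by [measurable_section_meets]. *)
Let shrink_sections (k : nat) (C : set (X * borel Q)) : compact_sections C ->
  exists C', [/\ compact_sections C', C' `<=` C &
    forall x, exists j, forall y, C' (x, y) -> cball k j y].
Proof.
move=> [mC CP].
pose J j := [set x | exists y, C (x, y) /\ cball k j y].
have mJ j : measurable (J j).
  apply: (measurable_section_meets sU haus de mC); first by move=> x; case: (CP x).
  exact: closed_closure.
have JT x : exists j, seqDU J j x.
  have [y Cxy] := (CP x).2; have [j jy] := cball_cover k y.
  have : (\bigcup_j seqDU J j) x by rewrite -seqDU_bigcup_eq; exists j => //; exists y.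
  by case=> i _; exists i.
have JU x i j : seqDU J i x -> seqDU J j x -> i = j.
  by move=> Ji Jj; apply: (@trivIset_seqDU _ J) => //; exists x.
pose C' : set (X * borel Q) := C `&` \bigcup_j (seqDU J j `*` (cball k j : set (borel Q))).
have C'E x j : seqDU J j x -> [set y | C' (x, y)] = [set y | C (x, y)] `&` cball k j.
  move=> Jjx; apply/seteqP; split => y /=.
    by move=> [Cxy [i _ [Jix]]]; rewrite (JU _ _ _ Jjx Jix).
  by move=> [Cxy jy]; split => //; exists j.
exists C'; split.
- split; last first.
    move=> x; have [j Jjx] := JT x; rewrite (C'E _ _ Jjx); split.
      apply: compact_closedI; first by case: (CP x).
      exact: closed_closure.
    have [y [Cxy jy]] : J j x by case: Jjx.
    by exists y; split => //; exists j.
  apply: measurableI => //; apply: bigcup_measurable => j _; apply: measurableX.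
    apply: measurableD => //; apply: bigsetU_measurable => i _; exact: mJ.
  rewrite -[X in measurable X]setCK; apply: measurableC; apply: sub_sigma_algebra.
  by apply: closed_openC; exact: closed_closure.
- by move=> ? [].
- move=> x; have [j Jjx] := JT x; exists j => y C'xy.
  by have : [set y | C' (x, y)] y by []; rewrite (C'E _ _ Jjx) => -[].
Qed.

(** Shrinking the sections for [k = 0, 1, ...] leaves a single point [phi x]. By
compactness, [phi x] lies in a closed set iff all the successive
sections meet this set, which is a measurable condition on [x]. *)
Lemma measurable_selection_complete (C : set (X * borel Q)) :
  measurable C -> (forall x, compact ([set y | C (x, y)] : set Q)) ->
  (forall x, exists y, C (x, y)) ->
  exists phi : X -> borel Q, measurable_fun setT phi /\ forall x, C (x, phi x).
Proof.
move=> mC cC C0.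
have /choice[step stepP] : forall kC : nat * set (X * borel Q), exists C',
    compact_sections kC.2 -> [/\ compact_sections C', C' `<=` kC.2 &
    forall x, exists j, forall y, C' (x, y) -> cball kC.1 j y].
  move=> [k D]; have [/(shrink_sections k)[D' D'P]|nD] := pselect (compact_sections D).
    by exists D'.
  by exists set0.
pose fix D k := if k is l.+1 then step (l, D l) else C.
have DP k : compact_sections (D k).
  by elim: k => [|k IH]; [split|case: (stepP (k, D k) IH)].
have DS k : D k.+1 `<=` D k by case: (stepP (k, D k) (DP k)).
have DB k x : exists j, forall y, D k.+1 (x, y) -> cball k j y.
  by have [_ _] := stepP (k, D k) (DP k); exact.
have DN x (W : set Q) : closed W -> (forall k, exists y, D k (x, y) /\ W y) ->
    exists y, forall k, D k (x, y) /\ W y.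
  move=> cW DW; apply: (@nested_compact_sets _ (fun k => [set y | D k (x, y)] `&` W)).
  - by apply: compact_closedI => //; exact: cC.
  - move=> k; apply: closedI => //; apply: compact_closed => //.
    by case: (DP k) => _ /(_ x)[].
  - by move=> k y [/DS].
  - by move=> k; have [y] := DW k; exists y.
have /choice[phi phiP] : forall x, exists y, forall k, D k (x, y).
  move=> x; have [|k|y yP] := DN x setT; first exact: closedT.
    by have [y Dy] := ((DP k).2 x).2; exists y.
  by exists y => k; case: (yP k).
have phiU x y : (forall k, D k (x, y)) -> y = phi x.
  move=> Dy; apply: cball_separated => k; have [j jP] := DB k x.
  by exists j; split; apply: jP.
exists phi; split; last by move=> x; exact: (phiP x 0%N).
apply: (@measurability _ _ X (borel Q) setT phi (@open Q)) => // _ [W oW <-].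
rewrite setTI (_ : phi @^-1` W = ~` \bigcap_k [set x | exists y, D k (x, y) /\ (~` W) y]).
  apply: measurableC; apply: bigcap_measurable => // k _.
  have [mD cD] := DP k.
  apply: (measurable_section_meets sU haus de mD); first by move=> x; case: (cD x).
  exact: open_closedC.
apply/seteqP; split => x /=.
  move=> Wx H; have [||y yP] := DN x (~` W); first exact: open_closedC.
    by move=> k; exact: H.
  by have [_] := yP 0%N; apply; rewrite (phiU x y) // => k; case: (yP k).
move=> H; apply: contrapT => nW; apply: H => k _; exists (phi x); split => //.
Qed.

End complete_range.

Context (R : realType) (A : ptopologicalType).
Hypothesis A_borel : borel_subset_of_polish R A.

(** The construction above uses the completeness of the range, so [C] is
carried along the embedding of [A] in a Polish space; the Borel retraction [r]
brings the points of the new sections back to [A]. *)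
Let completed_sections (C : set (X * borel A)) : measurable C ->
  (forall x, compact ([set a | C (x, a)] : set A)) ->
  exists (Q : completePseudoMetricType R) (e : nat -> Q) (r : borel Q -> borel A)
    (D : set (X * borel Q)),
  [/\ hausdorff_space Q, dense (range e), measurable_fun setT r, measurable D &
      forall x, [/\ compact ([set y | D (x, y)] : set Q),
        forall y, D (x, y) -> C (x, r y) &
        forall a, C (x, a) -> exists y, D (x, y)]].
Proof.
move=> mC cC; have [Q [j [haus [S cS dS] j_inj j_open mj]]] := A_borel.
have [e de] := countable_dense_sequence cS dS.
have [r [mr jr]] := embedding_retraction j_inj j_open mj.
have ctj : continuous j by apply/continuousP => V oV; apply/j_open; exists V.
exists Q, e, r, ((fun xy => (xy.1, r xy.2)) @^-1` C `&` snd @^-1` range j).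
split => //.
  apply: measurableI; rewrite -[X in measurable X]setTI.
    have : measurable_fun setT (fun xy : X * borel Q => (xy.1, r xy.2)).
      by apply: measurable_fun_pair => //; exact: measurableT_comp.
    exact.
  exact: measurable_snd.
move=> x; split; [|by move=> y []|by move=> a Cxa; exists (j a); split; [rewrite /= jr|exists a]].
rewrite [X in compact X](_ : _ = j @` [set a | C (x, a)]).
  apply: continuous_compact => //; exact: continuous_subspaceT.
apply/seteqP; split => [y [/= Cxy [a _ ay]]|_ [a /= Cxa <-]].
  by exists a => //; move: Cxy; rewrite /= -ay jr.
by split; [rewrite /= jr|exists a].
Qed.

Lemma measurable_projection_compact_sections (C : set (X * borel A)) :
  measurable C -> (forall x, compact ([set a | C (x, a)] : set A)) ->
  measurable [set x | exists a, C (x, a)].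
Proof.
move=> mC cC; have [Q [e [r [D [haus de mr mD DP]]]]] := completed_sections mC cC.
rewrite [X in measurable X](_ : _ = [set x | exists y, D (x, y) /\ setT y]).
  apply: (measurable_section_meets sU haus de mD); last exact: closedT.
  by move=> x; have [] := DP x.
apply/seteqP; split => x; have [_ DC CD] := DP x.
  by move=> [a /CD[y Dxy]]; exists y.
by move=> [y [/DC Cxy _]]; exists (r y).
Qed.

Theorem measurable_selection_compact_sections (C : set (X * borel A)) :
  measurable C -> (forall x, compact ([set a | C (x, a)] : set A)) ->
  (forall x, exists a, C (x, a)) ->
  exists phi : X -> borel A, measurable_fun setT phi /\ forall x, C (x, phi x).
Proof.
move=> mC cC C0; have [Q [e [r [D [haus de mr mD DP]]]]] := completed_sections mC cC.
have [||psi [mpsi psiP]] := measurable_selection_complete haus de mD.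
- by move=> x; have [] := DP x.
- by move=> x; have [_ _ CD] := DP x; have [a /CD] := C0 x.
exists (r \o psi); split; first exact: measurableT_comp.
by move=> x; have [_ DC _] := DP x; apply: DC; exact: psiP.
Qed.

End selection.

(** * Measurable minimisation of functions with compact level sets *)

Lemma borel_subset_of_polish_hausdorff (R : realType) (A : ptopologicalType) :
  borel_subset_of_polish R A -> hausdorff_space A.
Proof.
move=> [P [i [haus _ i_inj i_open _]]].
move: haus; rewrite !open_hausdorff => haus x y xy.
have [[V W] [/= /set_mem Vx /set_mem Wy] [oV oW VW]] := haus (i x) (i y) (contra_neq (@i_inj _ _) xy).
exists (i @^-1` V, i @^-1` W); first by split; exact: mem_set.
split; [by apply/i_open; exists V|by apply/i_open; exists W|].
by rewrite -preimage_setI (eqP VW) preimage_set0.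
Qed.

Section level_sets.
Context (R : realType) (A : topologicalType).
Hypothesis haus : hausdorff_space A.

(** The sets [g n a <= l + 1 / (n + 1)] are compact, nonempty and decreasing. This
is how minimisers pass to the limit, in value iteration as well as in the
vanishing discount. *)
Lemma inf_compact_nondecreasing_limit (g : nat -> A -> \bar R) (l : R) :
  (forall k, inf_compact (g k)) -> (forall k a, g k a <= g k.+1 a) ->
  (forall k (r : R), (0 < r)%R -> exists a, g k a <= (l + r)%:E) ->
  exists a, forall k, g k a <= l%:E.
Proof.
move=> cg gS gl.
have gle a m n : (m <= n)%N -> g m a <= g n a.
  move=> /subnK <-; elim: (n - m)%N => // k IH; rewrite addSn.
  exact: le_trans IH (gS _ _).
pose K n := [set a | g n a <= (l + n.+1%:R^-1)%:E].
have [||||a aK] := @nested_compact_sets A K.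
- exact: cg.
- by move=> n; apply: compact_closed => //; exact: cg.
- move=> n a; rewrite /K /= => /(le_trans (gS _ _))/le_trans; apply.
  by rewrite lee_fin lerD2l lef_pV2 ?posrE// ler_nat.
- by move=> n; exact: gl.
exists a => k; apply/lee_addgt0Pr => r r0.
have [n nk rn] : exists2 n, (k <= n)%N & (n.+1%:R^-1 < r)%R.
  have [n0 _ H] := near_infty_natSinv_lt (PosNum r0).
  by exists (maxn n0 k); [exact: leq_maxr|apply: H; exact: leq_maxl].
rewrite (le_trans (gle a k n nk))// (le_trans (aK n))//.
by rewrite -EFinD lee_fin lerD2l ltW.
Qed.

Lemma inf_compact_attains_inf (g : A -> \bar R) :
  inf_compact g -> (forall a, 0 <= g a) -> ereal_inf (range g) < +oo ->
  exists a, g a = ereal_inf (range g).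
Proof.
move=> cg g0 goo.
have gfin : ereal_inf (range g) \is a fin_num.
  by rewrite ge0_fin_numE//; apply: le_ereal_inf_tmp => _ [a _ <-].
have [|||a aP] := @inf_compact_nondecreasing_limit (fun=> g) (fine (ereal_inf (range g))) => //.
  move=> _ r r0; have : ereal_inf (range g) < ereal_inf (range g) + r%:E.
    by rewrite lteDl.
  by move=> /ereal_inf_lt[_ [a _ <-]] /ltW; exists a; rewrite EFinD fineK.
exists a; apply/eqP; rewrite eq_le ereal_inf_lbound ?andbT; last by exists a.
by rewrite -[leRHS]fineK//; exact: (aP 0%N).
Qed.

End level_sets.

Section measurable_minimum.
Context d (X : measurableType d) (U : nat -> set X).
Hypothesis sU : standard_subbase U.
Context (R : realType) (A : ptopologicalType).
Hypothesis A_borel : borel_subset_of_polish R A.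
Variable g : X * borel A -> \bar R.
Hypothesis mg : measurable_fun setT g.
Hypothesis cg : forall x, inf_compact (fun a : A => g (x, a)).

Definition minimum (x : X) : \bar R := ereal_inf (range (fun a : A => g (x, a))).

(** The minimum is less than [r] iff one of the sublevel sets of [g] at
[r - 1 / (n + 1)], whose sections are compact, has a nonempty section at [x]. *)
Lemma measurable_minimum : measurable_fun setT minimum.
Proof.
apply: (measurability _ (ErealGenInftyO.measurableE R)) => _ /= -[_ [r ->] <-].
rewrite setTI preimage_itvNyo.
rewrite [X in measurable X](_ : _ = \bigcup_n
    [set x | exists a, g (x, a) <= (r - n.+1%:R^-1)%:E]); last first.
  apply/seteqP; split => x /=.
    move=> /ereal_inf_lt[_ [a _ <-] gr].
    have [n nP] : exists n : nat, g (x, a) <= (r - n.+1%:R^-1)%:E.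
      case: (g (x, a)) gr => [s|//|_]; last by exists 0%N; rewrite leNye.
      rewrite lte_fin -subr_gt0 => sr.
      have [n _ nP] := near_infty_natSinv_lt (PosNum sr).
      by exists n; rewrite lee_fin lerBrDr addrC -lerBrDr ltW// (nP n (leqnn n)).
    by exists n => //; exists a.
  move=> [n _ [a ga]]; apply: (@le_lt_trans _ _ (g (x, a))).
    by apply: ereal_inf_lbound; exists a.
  by apply: le_lt_trans ga _; rewrite lte_fin ltrBlDr ltrDl.
apply: bigcup_measurable => n _.
apply: (measurable_projection_compact_sections sU A_borel
  (C := [set xa | g xa <= (r - n.+1%:R^-1)%:E])); last by move=> x; exact: cg.
by rewrite -[X in measurable X]setTI; exact: emeasurable_fun_infty_c.
Qed.

(** Where the minimum is finite, the minimisers form a nonempty compact set. Where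
it is infinite every action is a minimiser, and a fixed one is taken in order to
keep the sections compact. *)
Theorem measurable_minimiser : (forall xa, 0 <= g xa) ->
  exists phi : X -> borel A,
    measurable_fun setT phi /\ forall x, g (x, phi x) = minimum x.
Proof.
move=> g0; have hausA := borel_subset_of_polish_hausdorff A_borel.
have mfst : measurable_fun setT (fun xa : X * borel A => minimum xa.1).
  by apply: measurableT_comp => //; exact: measurable_minimum.
pose finite_part : set (X * borel A) := [set xa | minimum xa.1 < +oo] `&` [set xa | g xa <= minimum xa.1].
pose infinite_part : set (X * borel A) := [set xa | +oo <= minimum xa.1] `&` snd @^-1` [set (point : borel A)].
have CE x : [set a | (finite_part `|` infinite_part) (x, a)] =
    if minimum x < +oo then [set a : A | g (x, a) <= minimum x] else [set (point : A)].
  apply/seteqP; split => a /=; case: ifPn => [xoo|].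
  - by move=> [[]//|[/= oox]]; rewrite ltNge oox in xoo.
  - by rewrite -leNgt => oox [[/= xoo]|[]//]; rewrite ltNge oox in xoo.
  - by move=> ?; left.
  - by rewrite -leNgt => oox ->; right.
have [|||phi [mphi phiP]] := measurable_selection_compact_sections sU A_borel
    (C := finite_part `|` infinite_part).
- apply: measurableU; apply: measurableI.
  + by rewrite -[X in measurable X]setTI; exact: emeasurable_fun_infty_o.
  + by rewrite -[X in measurable X]setTI; apply: measurable_lee.
  + by rewrite -[X in measurable X]setTI; exact: emeasurable_fun_c_infty.
  + rewrite -[X in measurable X]setTI; apply: measurable_snd => //.
    rewrite -[X in measurable X]setCK; apply: measurableC; apply: sub_sigma_algebra.
    apply: closed_openC; apply: compact_closed => //; exact: compact_set1.
- move=> x; rewrite CE; case: ifPn => xoo; last exact: compact_set1.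
  have mfin : minimum x \is a fin_num.
    by rewrite ge0_fin_numE//; apply: le_ereal_inf_tmp => _ [a _ <-].
  by rewrite -(fineK mfin); exact: cg.
- move=> x; suff [a] : exists a, [set a | (finite_part `|` infinite_part) (x, a)] a by exists a.
  rewrite CE; case: ifPn => xoo; last by exists point.
  have [a ga] := inf_compact_attains_inf hausA (@cg x) (fun a => g0 (x, a)) xoo.
  by exists a => /=; rewrite ga.
exists phi; split => // x; apply/eqP; rewrite eq_le ereal_inf_lbound ?andbT; last by exists (phi x).
by have [[//]|[/= oox _]] := phiP x; apply: le_trans oox; exact: leey.
Qed.

End measurable_minimum.

(** * Composition of probability kernels *)

Section kernel_precomposition.
Context d d' d'' (S : measurableType d) (T : measurableType d')
  (Z : measurableType d'') (R : realType).
Variables (k : R.-pker T ~> Z) (f : S -> T) (mf : measurable_fun setT f).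

(** The measurability proof is an argument so that the kernel instance can be
found from the term. *)
Definition kernel_precomp (_ : measurable_fun setT f) (s : S) :
  {measure set Z -> \bar R} := k (f s).

Let measurable_kernel_precomp U : measurable U ->
  measurable_fun setT (kernel_precomp mf ^~ U).
Proof. by move=> mU; apply: (measurableT_comp (measurable_kernel k U mU)). Qed.

HB.instance Definition _ := isKernel.Build _ _ _ _ _ (kernel_precomp mf)
  measurable_kernel_precomp.

Let kernel_precomp_prob s : kernel_precomp mf s setT = 1.
Proof. exact: prob_kernel. Qed.

HB.instance Definition _ := Kernel_isProbability.Build _ _ _ _ _
  (kernel_precomp mf) kernel_precomp_prob.

End kernel_precomposition.
Arguments kernel_precomp {d d' d'' S T Z R} k {f}.

Section kernel_sequential_composition.
Context d d' d'' (S : measurableType d) (T : measurableType d')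
  (Z : measurableType d'') (R : realType).
Variables (l : R.-pker S ~> T) (k : R.-pker (S * T)%type ~> Z).

(** The law of [z] when [t] is drawn from [l s] and then [z] from [k (s, t)]. *)
Definition kernel_seq (s : S) : {measure set Z -> \bar R} := mkcomp l k s.

Let measurable_kernel_seq U : measurable U -> measurable_fun setT (kernel_seq ^~ U).
Proof. by move=> mU; exact: measurable_fun_mkcomp_sfinite. Qed.

HB.instance Definition _ := isKernel.Build _ _ _ _ _ kernel_seq
  measurable_kernel_seq.

Let kernel_seq_prob s : kernel_seq s setT = 1.
Proof.
rewrite /kernel_seq /mkcomp /= /kcomp; under eq_integral do rewrite prob_kernel.
by rewrite integral_cst// mul1e; exact: prob_kernel.
Qed.

HB.instance Definition _ := Kernel_isProbability.Build _ _ _ _ _ kernel_seq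
  kernel_seq_prob.

Lemma kernel_seqE s U : kernel_seq s U = \int[l s]_t k (s, t) U.
Proof. by []. Qed.

Lemma integral_kernel_seq s (g : Z -> \bar R) : (forall z, 0 <= g z) ->
  measurable_fun setT g ->
  \int[kernel_seq s]_z g z = \int[l s]_t \int[k (s, t)]_z g z.
Proof. exact: integral_kcomp. Qed.

End kernel_sequential_composition.

Lemma prob_integral_cst d (T : measurableType d) (R : realType)
    (mu : {measure set T -> \bar R}) (x : \bar R) : mu setT = 1 ->
  \int[mu]_t x = x.
Proof. by move=> mu1; rewrite integral_cst// mu1 mule1. Qed.

(** * The Ionescu Tulcea theorem *)

Section trajectories.
Context (X A : ptopologicalType).
Notation E := (borel X * borel A)%type.
Notation W := (trajectory X A).

Lemma measurable_coordinate t : measurable_fun setT (fun w : W => w t).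
Proof.
move=> _ B mB; apply: sub_sigma_algebra; exists t => //; exists B => //.
Qed.

Lemma measurable_to_trajectory d (T : measurableType d) (h : T -> W) :
  (forall t, measurable_fun setT (fun x => h x t : E)) -> measurable_fun setT h.
Proof.
move=> mh; apply: (@measurability _ _ T W setT h (@trajectory_generators X A)) => //.
move=> _ [_ [t _ [B mB <-]] <-]; rewrite !setTI.
by rewrite -[X in measurable X]setTI; exact: mh.
Qed.

Lemma measurable_past t : measurable_fun setT (@past X A t).
Proof.
apply/measurable_fun_tnthP => i.
rewrite [X in measurable_fun _ X](_ : _ = fun w : W => w i).
  exact: measurable_coordinate.
by apply/funext => w /=; rewrite tnth_mktuple.
Qed.

Lemma measurable_update t :
  measurable_fun setT (fun we : W * E => update t we.1 we.2 : W).
Proof.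
apply: measurable_to_trajectory => i; case it : (i == t).
  rewrite [X in measurable_fun _ X](_ : _ = snd); first exact: measurable_snd.
  by apply/funext => -[w e]; rewrite /update it.
rewrite [X in measurable_fun _ X](_ : _ = (fun w : W => w i) \o fst).
  exact: (measurableT_comp (measurable_coordinate i) measurable_fst).
by apply/funext => -[w e]; rewrite /update it.
Qed.

Lemma measurable_update_at t (w : W) :
  measurable_fun setT (fun e : E => update t w e : W).
Proof.
apply: measurable_to_trajectory => i; rewrite /update.
by case: (i == t); [exact: measurable_id|exact: measurable_cst].
Qed.

Lemma past_agree t (w w' : W) : agree t w w' -> past t w = past t w'.
Proof. by move=> ww'; apply: eq_from_tnth => i; rewrite !tnth_mktuple ww'. Qed.

(** Turns a function of the first [t] coordinates into a composite with
a measurable map, so that its integral depends only on the law of cylinders. *)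
Definition truncate (t : nat) (w : W) : W := fun i => if (i < t)%N then w i else point.

Lemma measurable_truncate t : measurable_fun setT (truncate t).
Proof.
apply: measurable_to_trajectory => i; rewrite /truncate; case: (i < t)%N => //.
exact: measurable_coordinate.
Qed.

Lemma agree_truncate t w : agree t w (truncate t w).
Proof. by move=> i it; rewrite /truncate it. Qed.

Definition cylinder (t : nat) (C : set W) : Prop :=
  measurable C /\ forall w w', agree t w w' -> C w -> C w'.

Lemma cylinder_le s t C : (s <= t)%N -> cylinder s C -> cylinder t C.
Proof.
by move=> st [mC CP]; split => // w w' /(agree_le st); exact: CP.
Qed.

Lemma cylinderC t C : cylinder t C -> cylinder t (~` C).
Proof.
move=> [mC CP]; split; first exact: measurableC.
by move=> w w' /agree_sym ww' nC /(CP _ _ ww').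
Qed.

Lemma cylinderU t B C : cylinder t B -> cylinder t C -> cylinder t (B `|` C).
Proof.
move=> [mB BP] [mC CP]; split; first exact: measurableU.
by move=> w w' ww' [/(BP _ _ ww')|/(CP _ _ ww')]; [left|right].
Qed.

Lemma cylinderD t B C : cylinder t B -> cylinder t C -> cylinder t (B `\` C).
Proof.
by move=> cB cC; rewrite setDE -[X in X `&` _]setCK -setCU;
  apply/cylinderC/cylinderU => //; exact: cylinderC.
Qed.

Lemma cylinder_bigsetU t n (F : nat -> set W) : (forall i, (i < n)%N -> cylinder t (F i)) ->
  cylinder t (\big[setU/set0]_(i < n) F i).
Proof.
move=> cF; elim/big_ind : _ => //; [exact: cylinderU|move=> i _; exact: cF].
Qed.

Lemma cylinder_coordinate t B : measurable B -> cylinder t.+1 [set w : W | B (w t)].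
Proof.
move=> mB; split; last by move=> w w' /(_ t (ltnSn t)) /= <-.
by rewrite -[X in measurable X]setTI; exact: measurable_coordinate.
Qed.

Context (R : realType).
Variable step : nat -> R.-pker W ~> E.

(** The law of the trajectory obtained from [w] by drawing anew, one after the
other, the coordinates [k], ..., [k + d - 1] from the kernels [step]. Kernels on
the whole trajectory space avoid a different product space for each time. *)
Fixpoint run (d k : nat) : R.-pker W ~> W :=
  if d is d'.+1 then
    kernel_seq (step k) (kernel_precomp (run d' k.+1) (measurable_update k))
  else kdirac (@measurable_id _ W setT).

Lemma run0 k w (C : set W) : run 0 k w C = \d_w C.
Proof. by []. Qed.

Lemma runS d k w (C : set W) :
  run d.+1 k w C = \int[step k w]_e run d k.+1 (update k w e) C.
Proof. by []. Qed.

Lemma run_prob d k w : run d k w setT = 1.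
Proof. exact: prob_kernel. Qed.

Lemma integral_runS d k w (g : W -> \bar R) : (forall w, 0 <= g w) ->
  measurable_fun setT g ->
  \int[run d.+1 k w]_w' g w' = \int[step k w]_e \int[run d k.+1 (update k w e)]_w' g w'.
Proof. exact: integral_kernel_seq. Qed.

Lemma integral_run0 k w (g : W -> \bar R) : measurable_fun setT g ->
  \int[run 0 k w]_w' g w' = g w.
Proof. by move=> mg; rewrite /= integral_dirac// diracT mul1e. Qed.

Lemma integral_run1 k w (g : W -> \bar R) : (forall w, 0 <= g w) ->
  measurable_fun setT g ->
  \int[run 1 k w]_w' g w' = \int[step k w]_e g (update k w e).
Proof.
move=> g0 mg; rewrite integral_runS//; apply: eq_integral => e _.
by rewrite integral_run0.
Qed.

Lemma measurable_integral_run d k (g : W -> \bar R) : (forall w, 0 <= g w) ->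
  measurable_fun setT g -> measurable_fun setT (fun w => \int[run d k w]_w' g w').
Proof.
move=> g0 mg; apply: measurable_fun_integral_kernel => // U mU.
exact: measurable_kernel.
Qed.

Lemma integral_run_last d k w (g : W -> \bar R) : (forall w, 0 <= g w) ->
  measurable_fun setT g ->
  \int[run d.+1 k w]_w' g w' =
  \int[run d k w]_w' \int[run 1 (k + d) w']_w'' g w''.
Proof.
move=> g0 mg; elim: d k w => [|d IH] k w.
  by rewrite addn0 integral_run0//; exact: measurable_integral_run.
rewrite integral_runS// [RHS]integral_runS//; last 2 first.
- by move=> w'; exact: integral_ge0.
- exact: measurable_integral_run.
by apply: eq_integral => e _; rewrite IH addSnnS.
Qed.

Lemma run_fixes_past d k w C : cylinder k C -> run d k w C = \d_w C.
Proof.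
elim: d k w => // d IH k w cC; rewrite runS.
transitivity (\int[step k w]_e (\d_w C : \bar R)).
  apply: eq_integral => e _; rewrite IH; last exact: cylinder_le cC.
  rewrite !diracE; congr (_%:R%:E); congr nat_of_bool.
  have [_ CP] := cC.
  by apply/idP/idP => /set_mem Cw; apply/mem_set; apply: CP Cw;
    [apply: agree_sym|]; exact: agree_update.
by apply: prob_integral_cst => //; exact: prob_kernel.
Qed.

(** Coordinates drawn after those on which [C] depends do not matter. *)
Lemma run_level d d' k w C : cylinder (k + d) C -> cylinder (k + d') C ->
  run d k w C = run d' k w C.
Proof.
elim: d d' k w => [|d IH] d' k w.
  by rewrite addn0 => cC _; rewrite !run_fixes_past.
case: d' => [|d'] cC cC'; first by rewrite addn0 in cC'; rewrite !run_fixes_past.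
rewrite !runS; apply: eq_integral => e _; apply: IH; rewrite addSnnS//.
Qed.

Hypothesis step_adapted : forall t w w' B, agree t w w' -> measurable B ->
  step t w B = step t w' B.

Lemma run_adapted d k w w' C : cylinder (k + d) C -> agree k w w' ->
  run d k w C = run d k w' C.
Proof.
elim: d k w w' => [|d IH] k w w' cC ww'.
  rewrite addn0 in cC; have [_ CP] := cC; rewrite !run0 !diracE.
  congr (_%:R%:E); congr nat_of_bool.
  by apply/idP/idP => /set_mem Cw; apply/mem_set; apply: CP Cw => //; exact: agree_sym.
rewrite !runS; transitivity (\int[step k w']_e run d k.+1 (update k w e) C).
  by apply: eq_measure_integral => B mB _; exact: step_adapted.
apply: eq_integral => e _; apply: IH; first by rewrite addSnnS.
move=> i; rewrite /update ltnS leq_eqVlt; case: eqP => //= _; exact: ww'.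
Qed.

Lemma integral_run1_adapted t (g : W -> \bar R) :
  (forall w, 0 <= g w) -> measurable_fun setT g ->
  (forall w w', agree t.+1 w w' -> g w = g w') ->
  forall w w', agree t w w' ->
    \int[run 1 t w]_w'' g w'' = \int[run 1 t w']_w'' g w''.
Proof.
move=> g0 mg ag w w' ww'; rewrite !integral_run1//.
transitivity (\int[step t w']_e g (update t w e)).
  by apply: eq_measure_integral => B mB _; exact: step_adapted.
apply: eq_integral => e _; apply: ag => i; rewrite /update ltnS leq_eqVlt.
by case: eqP => //= _; exact: ww'.
Qed.

End trajectories.

Section cylinder_ring.
Context (X A : ptopologicalType).

(** A copy of the trajectories whose measurable sets are the cylinders only: they
form a ring of sets, on which the law is first defined and from which it is then
extended. *)
Definition cylinder_space : Type := trajectory X A.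

HB.instance Definition _ := Pointed.on cylinder_space.

Definition is_cylinder : set (set cylinder_space) :=
  [set C | exists t, @cylinder X A t C].

Lemma is_cylinder_common (B C : set cylinder_space) :
  is_cylinder B -> is_cylinder C -> exists t, cylinder t B /\ cylinder t C.
Proof.
move=> [s cB] [t cC]; exists (maxn s t); split.
  by apply: cylinder_le cB; exact: leq_maxl.
by apply: cylinder_le cC; exact: leq_maxr.
Qed.

Let is_cylinder0 : is_cylinder set0.
Proof. by exists 0%N. Qed.

Let is_cylinderU : setU_closed is_cylinder.
Proof.
by move=> B C cB /(is_cylinder_common cB)[t [? ?]]; exists t; exact: cylinderU.
Qed.

Let is_cylinderD : setD_closed is_cylinder.
Proof.
by move=> B C cB /(is_cylinder_common cB)[t [? ?]]; exists t; exact: cylinderD.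
Qed.

HB.instance Definition _ := isRingOfSets.Build default_measure_display
  cylinder_space is_cylinder0 is_cylinderU is_cylinderD.

End cylinder_ring.

Section ionescu_tulcea.
Context (X A : ptopologicalType) (R : realType).
Notation E := (borel X * borel A)%type.
Notation W := (trajectory X A).
Variable step : nat -> R.-pker W ~> E.
Hypothesis step_adapted : forall t w w' B, agree t w w' -> measurable B ->
  step t w B = step t w' B.
Variable w0 : W.

(** Any level at which [C] is a cylinder gives the same value, by [run_level]. *)
Definition cylinder_law (C : set (cylinder_space X A)) : \bar R :=
  run step (xget 0%N [set t | cylinder t C]) 0 w0 C.

Lemma cylinder_lawE t C : cylinder t C -> cylinder_law C = run step t 0 w0 C.
Proof.
move=> cC; apply: run_level; rewrite ?add0n//.
by case: xgetP => [s _ //|/(_ t)].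
Qed.

Lemma cylinder_law_ge0 C : 0 <= cylinder_law C.
Proof. exact: measure_ge0. Qed.

Lemma cylinder_law0 : cylinder_law set0 = 0.
Proof. exact: measure0. Qed.

Lemma run_le1 d k w C : measurable C -> run step d k w C <= 1.
Proof.
move=> mC; rewrite -(run_prob step d k w).
by apply: le_measure => //; rewrite inE.
Qed.

(** The heart of the Ionescu Tulcea theorem. A trajectory is built coordinate by
coordinate so that the probabilities [f k n w] of the sets [C n], given the first
[k] coordinates, remain at least [eps] for all [n]. A next coordinate exists:
otherwise the decreasing limit [h] of these probabilities would be less than [eps]
for every choice of it, although its integral is at least [eps] by dominated
convergence. Once [k] reaches the level of [C n], the probability [f k n w] is [0]
or [1], so the trajectory belongs to [C n]. *)
Lemma decreasing_cylinders_meet (C : nat -> set W) (t : nat -> nat) (eps : R) :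
  (0 < eps)%R -> (forall n, cylinder (t n) (C n)) ->
  (forall n, C n.+1 `<=` C n) -> (forall n, eps%:E <= cylinder_law (C n)) ->
  \bigcap_n C n !=set0.
Proof.
move=> eps0 cC CS Ceps.
pose f k n w := run step (t n) k w (C n).
have mC n : measurable (C n) by case: (cC n).
have fS k n w : f k n w = \int[step k w]_e f k.+1 n (update k w e).
  rewrite -runS; apply: run_level; first by apply: cylinder_le (cC n); rewrite leq_addl.
  by apply: cylinder_le (cC n); rewrite addnS leqW// leq_addl.
have f_dec k w : nonincreasing_seq (fun n => f k n w).
  apply/nonincreasing_seqP => n.
  have le1 : (t n.+1 <= maxn (t n.+1) (t n))%N by exact: leq_maxl.
  have le2 : (t n <= maxn (t n.+1) (t n))%N by exact: leq_maxr.
  have cS : cylinder (k + maxn (t n.+1) (t n)) (C n.+1).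
    by apply: cylinder_le (cC n.+1); rewrite (leq_trans le1)// leq_addl.
  have cn : cylinder (k + maxn (t n.+1) (t n)) (C n).
    by apply: cylinder_le (cC n); rewrite (leq_trans le2)// leq_addl.
  rewrite /f (@run_level _ _ _ step (t n.+1) (maxn (t n.+1) (t n)))//; last first.
    by apply: cylinder_le (cC n.+1); rewrite leq_addl.
  rewrite (@run_level _ _ _ step (t n) (maxn (t n.+1) (t n)))//; last first.
    by apply: cylinder_le (cC n); rewrite leq_addl.
  by apply: le_measure; rewrite ?inE//; exact: CS.
have mf k n : measurable_fun setT (f k n).
  exact: measurable_kernel.
have [w wP] : exists w, forall k n, eps%:E <= f k n w.
  apply: (@sequence_of_updates E (fun k w => forall n, eps%:E <= f k n w) w0).
  - move=> k s s' ss' fs n; rewrite (le_trans (fs n))// /f.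
    rewrite (@run_adapted _ _ _ step step_adapted _ _ s s')//.
    by apply: cylinder_le (cC n); rewrite leq_addl.
  - by move=> n; rewrite (le_trans (Ceps n))// (cylinder_lawE (cC n)).
  - move=> k w fw; apply: contrapT => /forallNP H.
    pose h e := ereal_inf (range (fun n => f k.+1 n (update k w e))).
    have hcvg e : f k.+1 n (update k w e) @[n --> \oo] --> h e.
      exact: ereal_nonincreasing_cvgn.
    have mfu n : measurable_fun setT (fun e : E => f k.+1 n (update k w e)).
      apply: (measurableT_comp (mf k.+1 n)).
      exact: measurable_update_at.
    have mh : measurable_fun setT h.
      by apply: (emeasurable_fun_cvg _ h mfu) => e _; exact: hcvg.
    have h0 e : 0 <= h e by apply: le_ereal_inf_tmp => _ [n _ <-]; exact: measure_ge0.
    have heps e : h e < eps%:E.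
      apply: contrapT => /negP; rewrite -leNgt => eh; apply: (H e) => n.
      by rewrite (le_trans eh)//; apply: ereal_inf_lbound; exists n.
    have int_h : \int[step k w]_e f k.+1 n (update k w e) @[n --> \oo] -->
        \int[step k w]_e h e.
      have f_h : {ae step k w, forall e, [set: E] e ->
          f k.+1 n (update k w e) @[n --> \oo] --> h e}.
        by apply: aeW => e _; exact: hcvg.
      have i1 : (step k w).-integrable setT (cst 1 : E -> \bar R).
        apply/integrableP; split=> //; under eq_integral do rewrite /= normr1.
        by rewrite prob_integral_cst ?ltry//; exact: prob_kernel.
      have f1 : {ae step k w, forall e n, [set: E] e ->
          `|f k.+1 n (update k w e)| <= (cst 1 : E -> \bar R) e}.
        by apply: aeW => e n _; rewrite gee0_abs//; exact: run_le1.
      by have [] := dominated_convergence measurableT mfu mh f_h i1 f1.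
    have eps_h : eps%:E <= \int[step k w]_e h e.
      rewrite -(cvg_lim _ int_h)//; apply: lime_ge; first by apply/cvg_ex; eexists; exact: int_h.
      by near=> n; rewrite -fS; exact: fw.
    have gap0 e : 0 <= eps%:E - h e.
      move: (h0 e) (heps e); case: (h e) => [s| |]//= _.
      by rewrite lte_fin -EFinB lee_fin subr_ge0 => /ltW.
    have mgap : measurable_fun setT (fun e => eps%:E - h e) by exact: emeasurable_funB.
    have int_gap : \int[step k w]_e (eps%:E - h e) = 0.
      have : \int[step k w]_e (eps%:E - h e) + \int[step k w]_e h e = eps%:E.
        rewrite -ge0_integralD//.
        under eq_integral => e _.
          rewrite subeK; last by rewrite ge0_fin_numE// (lt_trans (heps e))// ltry.
          over.
        by rewrite prob_integral_cst//; exact: prob_kernel.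
      have gap_ge0 : 0 <= \int[step k w]_e (eps%:E - h e) by exact: integral_ge0.
      have h_ge0 : 0 <= \int[step k w]_e h e by exact: integral_ge0.
      move: gap_ge0 h_ge0 eps_h.
      case: (\int[step k w]_e (eps%:E - h e)) => [p| |]//;
        case: (\int[step k w]_e h e) => [q| |]//=.
      rewrite !lee_fin -EFinD => p0 q0 epsq [pq]; congr (_%:E).
      by apply/eqP; rewrite eq_le p0 andbT -(lerD2r q) add0r pq.
    have /(ae_eq_integral_abs (step k w) measurableT mgap).1 :
        \int[step k w]_(e in setT) `|eps%:E - h e| = 0.
      by rewrite -int_gap; apply: eq_integral => e _; rewrite gee0_abs.
    move=> [N [mN N0 subN]].
    have : step k w setT <= step k w N.
      apply: le_measure; rewrite ?inE// => e _; apply: subN => /(_ Logic.I) /=.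
      move: (h0 e) (heps e); case: (h e) => [s| |]//= _.
      by rewrite lte_fin -EFinB => + [/eqP]; rewrite subr_eq0 => /lt_eqF; rewrite eq_sym => ->.
    by rewrite N0 prob_kernel lee_fin ler10.
exists w => n _; have := wP (t n) n.
rewrite /f run_fixes_past; last exact: cC.
rewrite diracE; case: (boolP (w \in C n)) => [/set_mem //|_].
by rewrite lee_fin leNgt eps0.
Unshelve. all: by end_near. Qed.

(** Finite additivity holds because finitely many cylinders have a common level;
the remainders [B n] decrease to the empty set, so their laws tend to [0] by
[decreasing_cylinders_meet]. *)
Lemma cylinder_law_sigma_additive : semi_sigma_additive cylinder_law.
Proof.
move=> F mF tF mUF.
have /choice[l lP] : forall n, exists t, cylinder t (F n) by exact: mF.
have [lU cU] := mUF.
have level n : exists t, (forall i, (i < n)%N -> cylinder t (F i)) /\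
    cylinder t (\bigcup_i F i).
  exists (maxn lU (\max_(i < n) l i))%N; split.
    move=> i i_n; apply: cylinder_le (lP i); rewrite leq_max; apply/orP; right.
    exact: (@leq_bigmax _ (fun i : 'I_n => l i) (Ordinal i_n)).
  by apply: cylinder_le cU; exact: leq_maxl.
pose B n := \bigcup_i F i `\` \big[setU/set0]_(i < n) F i.
have /choice[t tB] : forall n, exists t, cylinder t (B n).
  move=> n; have [t [tF' tU]] := level n.
  by exists t; apply: cylinderD => //; exact: cylinder_bigsetU.
have split n : cylinder_law (\bigcup_i F i) =
    \sum_(0 <= i < n) cylinder_law (F i) + cylinder_law (B n).
  have [s [sF sU]] := level n.
  have sB : cylinder s (B n) by apply: cylinderD => //; exact: cylinder_bigsetU.
  rewrite big_mkord (cylinder_lawE sU) (cylinder_lawE sB).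
  under eq_bigr => i _ do rewrite (cylinder_lawE (sF i (ltn_ord i))).
  have mF' i : (i < n)%N -> measurable (F i : set W) by move=> /sF[].
  have mFn : measurable (\big[setU/set0]_(i < n) F i : set W).
    by apply: bigsetU_measurable => i _; exact: mF'.
  rewrite -(@measure_semi_additive_ord_I _ _ _ (run step s 0 w0) F n)//; last exact: sub_trivIset tF.
  rewrite (@measureDI _ _ _ (run step s 0 w0) _ (\big[setU/set0]_(i < n) F i))//; last by case: sU.
  rewrite addeC; congr (_ + _); congr (run _ _ _ _ _); apply/setIidr.
  by rewrite -bigcup_mkord; apply: bigcup_sub => i _; exact: bigcup_sup.
have B_dec n : B n.+1 `<=` B n.
  by move=> w [Uw nw]; split => // nw'; apply: nw; rewrite big_ord_recr; left.
have B0 : \bigcap_n B n = set0.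
  rewrite -subset0 => w Bw; have [[i _ Fi] _] := Bw 0%N Logic.I.
  have [_] := Bw i.+1 Logic.I; apply; rewrite -bigcup_mkord; exists i => //=.
have S_nd : nondecreasing_seq (fun n => \sum_(0 <= i < n) cylinder_law (F i)).
  by apply: ereal_nondecreasing_series => *; exact: cylinder_law_ge0.
have := ereal_nondecreasing_cvgn S_nd.
congr (_ --> _); apply/eqP; rewrite eq_le; apply/andP; split.
  by apply: ge_ereal_sup => _ [n _ <-]; rewrite (split n) leeDl//; exact: cylinder_law_ge0.
apply/lee_addgt0Pr => r r0.
have [n nr] : exists n, cylinder_law (B n) < r%:E.
  apply: contrapT => /forallNP H.
  have : \bigcap_n B n !=set0.
    apply: (decreasing_cylinders_meet r0 tB B_dec) => n.
    by rewrite leNgt; apply/negP; exact: H.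
  by rewrite B0 => -[].
rewrite (split n) leeD// ?(ltW nr)//; apply: ereal_sup_ubound; by exists n.
Qed.

HB.instance Definition _ := isMeasure.Build _ (cylinder_space X A) R cylinder_law
  cylinder_law0 cylinder_law_ge0 cylinder_law_sigma_additive.

Lemma measurable_sub_cylinders (C : set W) : measurable C ->
  <<s @measurable _ (cylinder_space X A) >> C.
Proof.
move: C; apply: smallest_sub; first exact: smallest_sigma_algebra.
move=> _ [t _ [B mB <-]]; apply: sub_sigma_algebra; exists t.+1; rewrite setTI.
exact: cylinder_coordinate.
Qed.

(** The outer measure is restricted to the sigma-algebra of the coordinates, which
is the one generated by the cylinders. *)
Definition ionescu_tulcea_law (C : set W) : \bar R := measure_extension cylinder_law C.

Let law0 : ionescu_tulcea_law set0 = 0.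
Proof. exact: measure0. Qed.

Let law_ge0 C : 0 <= ionescu_tulcea_law C.
Proof. exact: measure_ge0. Qed.

Let law_sigma_additive : semi_sigma_additive ionescu_tulcea_law.
Proof.
move=> F mF tF mUF; apply: (@measure_semi_sigma_additive _ _ _ (measure_extension cylinder_law)) => //.
  by move=> n; exact: measurable_sub_cylinders.
exact: measurable_sub_cylinders.
Qed.

HB.instance Definition _ := isMeasure.Build _ W R ionescu_tulcea_law
  law0 law_ge0 law_sigma_additive.

Lemma ionescu_tulcea_cylinder t C : cylinder t C ->
  ionescu_tulcea_law C = run step t 0 w0 C.
Proof.
move=> cC; rewrite -(cylinder_lawE cC); apply: measurable_mu_extE; by exists t.
Qed.

Let law_prob : ionescu_tulcea_law setT = 1.
Proof. by rewrite (@ionescu_tulcea_cylinder 0)//; exact: run_prob. Qed.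

HB.instance Definition _ := Measure_isProbability.Build _ W R ionescu_tulcea_law law_prob.

Lemma integral_ionescu_tulcea t (g : W -> \bar R) :
  (forall w, 0 <= g w) -> measurable_fun setT g ->
  (forall w w', agree t w w' -> g w = g w') ->
  \int[ionescu_tulcea_law]_w g w = \int[run step t 0 w0]_w g w.
Proof.
move=> g0 mg ag.
have gE : g = g \o truncate t by apply/funext => w; apply: ag; exact: agree_truncate.
have pushE (m : {measure set W -> \bar R}) := @ge0_integral_pushforward _ _ _ _ R
  _ (measurable_truncate t) m setT g measurableT mg (fun w _ => g0 w).
rewrite preimage_setT -gE in pushE.
rewrite -pushE -[RHS]pushE.
apply: eq_measure_integral => [||? ? C mC _]; try exact: measurable_truncate.
apply: ionescu_tulcea_cylinder; split.
  by rewrite -[X in measurable X]setTI; exact: measurable_truncate.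
move=> w w' ww'; rewrite /preimage /=.
suff -> : truncate t w = truncate t w' by [].
by apply/funext => i; rewrite /truncate; case: ifPn => // /ww'.
Qed.

(** The defining property of the law, in integrated form: given the coordinates
below [t], coordinate [t] has law [step t]. *)
Theorem ionescu_tulcea t (g : W -> \bar R) :
  (forall w, 0 <= g w) -> measurable_fun setT g ->
  (forall w w', agree t.+1 w w' -> g w = g w') ->
  \int[ionescu_tulcea_law]_w g w =
  \int[ionescu_tulcea_law]_w \int[step t w]_e g (update t w e).
Proof.
move=> g0 mg ag; rewrite (integral_ionescu_tulcea g0 mg ag) integral_run_last//.
rewrite -(@integral_ionescu_tulcea t)//; last 3 first.
- by move=> w; exact: integral_ge0.
- exact: measurable_integral_run.
- exact: integral_run1_adapted.
by apply: eq_integral => w _; rewrite integral_run1.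
Qed.

End ionescu_tulcea.

(** * Existence of strategic measures *)

Section strategic_measures.
Context (R : realType) (X A : ptopologicalType).
Notation E := (borel X * borel A)%type.
Notation W := (trajectory X A).
Variables (q : R.-pker E ~> borel X) (pi : policy R X A) (x : X).

Definition state_law (t : nat) : R.-pker W ~> borel X :=
  if t is s.+1 then kernel_precomp q (measurable_coordinate s)
  else kdirac (measurable_cst (x : borel X)).

Lemma measurable_history t :
  measurable_fun setT (fun wx : W * borel X => (past t wx.1, wx.2) : history X A t).
Proof.
apply: measurable_fun_pair; last exact: measurable_snd.
exact: (measurableT_comp (@measurable_past _ _ t) measurable_fst).
Qed.

Lemma measurable_state_action :
  measurable_fun setT (fun wxa : (W * borel X) * borel A => (wxa.1.2, wxa.2) : E).
Proof.
apply: measurable_fun_pair; last exact: measurable_snd.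
exact: (measurableT_comp measurable_snd measurable_fst).
Qed.

(** The state is carried along with the action drawn from it. *)
Definition action_law (t : nat) : R.-pker (W * borel X)%type ~> E :=
  kernel_seq (kernel_precomp (pi t) (@measurable_history t))
    (kdirac measurable_state_action).

Definition policy_step (t : nat) : R.-pker W ~> E :=
  kernel_seq (state_law t) (action_law t).

Lemma integral_policy_step t w (g : E -> \bar R) : (forall e, 0 <= g e) ->
  measurable_fun setT g ->
  \int[policy_step t w]_e g e =
  \int[state_law t w]_y \int[pi t (past t w, y)]_a g (y, a).
Proof.
move=> g0 mg; rewrite integral_kernel_seq//; apply: eq_integral => y _.
rewrite integral_kernel_seq//; apply: eq_integral => a _.
by rewrite [LHS]integral_dirac// diracT mul1e.
Qed.

Lemma state_law_agree t w w' : agree t w w' -> state_law t w = state_law t w'.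
Proof.
case: t => [//|t] /(_ t (ltnSn t)) ww'.
by rewrite /state_law /= /kernel_precomp ww'.
Qed.

Lemma policy_step_adapted t w w' B : agree t w w' -> measurable B ->
  policy_step t w B = policy_step t w' B.
Proof.
move=> ww' mB; rewrite /policy_step !kernel_seqE (state_law_agree ww').
by apply: eq_integral => y _; rewrite !kernel_seqE /= /kernel_precomp /= (past_agree ww').
Qed.

Let P : probability W R :=
  ionescu_tulcea_law policy_step_adapted (point : W).

(** One step of the law, with the state drawn first and then the action; each of
the three defining properties of a strategic measure is an instance of it. *)
Let law_step t (S : set W) : cylinder t.+1 S ->
  P S = \int[P]_w \int[state_law t w]_y \int[pi t (past t w, y)]_a
    (\1_S (update t w (y, a)))%:E.
Proof.
move=> [mS aS].
have -> : P S = \int[P]_w (\1_S w)%:E by rewrite integral_indic// setIT.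
rewrite (ionescu_tulcea policy_step_adapted point (t := t))//; last 2 first.
- exact/measurable_EFinP.
- move=> w w' ww'; congr (_%:E); rewrite !indicE; congr (nat_of_bool _)%:R%R.
  by apply/idP/idP => /set_mem Sw; apply/mem_set; apply: aS Sw => //; exact: agree_sym.
apply: eq_integral => w _; rewrite integral_policy_step//.
apply/measurable_EFinP; apply: (@measurableT_comp _ _ _ _ _ _ (\1_S : W -> R)).
  exact: measurable_indic.
exact: measurable_update_at.
Qed.

Lemma update_at t (w : W) e : update t w e t = e.
Proof. by rewrite /update eqxx. Qed.

Lemma past_update t (w : W) e : past t (update t w e) = past t w.
Proof. by apply/esym/past_agree; exact: agree_update. Qed.

Lemma measurable_history_of t : measurable_fun setT (@history_of X A t).
Proof.
apply: measurable_fun_pair; first exact: measurable_past.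
by apply: (measurableT_comp measurable_fst (measurable_coordinate t)).
Qed.

Lemma history_of_agree t (w w' : W) : agree t.+1 w w' -> history_of t w = history_of t w'.
Proof.
move=> ww'; rewrite /history_of (ww' t)//; congr (_, _).
by apply: past_agree; exact: agree_le ww'.
Qed.

Let integral_restrict (D : set W) (g : W -> \bar R) :
  \int[P]_(w in D) g w = \int[P]_w ((\1_D w)%:E * g w).
Proof.
rewrite integral_mkcond; apply: eq_integral => w _.
by rewrite patchE indicE; case: ifPn => _; rewrite ?mul1e ?mul0e.
Qed.

Let eq_indic (S T : Type) (B : set S) (C : set T) (s : S) (t : T) :
  (B s <-> C t) -> (\1_B s = \1_C t :> R).
Proof.
move=> BC; rewrite !indicE; congr (nat_of_bool _)%:R%R.
by apply/idP/idP => /set_mem; [move/BC|move/BC] => ?; apply/mem_set.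
Qed.

Let eq_indicM (S T V : Type) (B : set S) (C : set T) (D : set V) s t v :
  (B s <-> C t /\ D v) -> ((\1_B s)%:E = (\1_C t)%:E * (\1_D v)%:E :> \bar R).
Proof.
move=> BCD; rewrite -EFinM !indicE -natrM mulnb; congr (nat_of_bool _)%:R%:E.
apply/idP/andP => [/set_mem/BCD[? ?]|[/set_mem ? /set_mem ?]].
  by split; apply/mem_set.
by apply/mem_set/BCD.
Qed.

Lemma strategic_measure_exists : exists P, is_strategic_measure q pi x P.
Proof.
exists P; split.
- move=> B mB; rewrite (@law_step 0); last first.
    have : cylinder 1 [set w : W | (B `*` setT) (w 0%N)].
      by apply: cylinder_coordinate; exact: measurableX.
    by congr cylinder; apply/seteqP; split => w => [[]|].
  rewrite -[RHS](@prob_integral_cst _ W R P)//; last exact: probability_setT.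
  apply: eq_integral => w _.
  transitivity (\int[state_law 0 w]_y (\1_B y)%:E); last by rewrite integral_indic// setIT.
  apply: eq_integral => y _; rewrite -[RHS](@prob_integral_cst _ _ R (pi 0%N (past 0 w, y))).
    apply: eq_integral => a _; congr (_%:E); exact: eq_indic.
  exact: prob_kernel.
- move=> t H C mH mC; rewrite (@law_step t); last first.
    split.
      apply: (@measurableI _ _ (@history_of X A t @^-1` H) ((fun w : W => (w t).2) @^-1` C)).
        by rewrite -[X in measurable X]setTI; exact: measurable_history_of.
      rewrite -[X in measurable X]setTI.
      exact: (measurableT_comp measurable_snd (measurable_coordinate t)).
    move=> w w' ww' /= [Hw Cw].
    by rewrite -(history_of_agree ww') -(ww' t).
  pose g h : \bar R := (\1_H h)%:E * pi t h C.
  have mg : measurable_fun setT (fun w : W => g (history_of t w)).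
    apply: (measurableT_comp (f := g)); last exact: measurable_history_of.
    apply: emeasurable_funM; last exact: measurable_kernel.
    by apply/measurable_EFinP; exact: measurable_indic.
  have g0 h : 0 <= g h by apply: mule_ge0 => //; rewrite lee_fin.
  rewrite [RHS]integral_restrict.
  transitivity (\int[P]_w g (history_of t w)); last by [].
  have ag (w w' : W) : agree t.+1 w w' -> g (history_of t w) = g (history_of t w').
    by move=> ww'; rewrite (history_of_agree ww').
  have -> := ionescu_tulcea policy_step_adapted point (fun w : W => g0 (history_of t w)) mg ag.
  apply: eq_integral => w _; rewrite integral_policy_step//; last first.
    exact: (measurableT_comp mg (@measurable_update_at _ _ t w)).
  apply: eq_integral => y _.
  have hE a : history_of t (update t w (y, a)) = (past t w, y).
    by rewrite /history_of past_update update_at.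
  under [RHS]eq_integral => a _ do rewrite hE.
  rewrite prob_integral_cst; last exact: prob_kernel.
  transitivity (\int[pi t (past t w, y)]_a ((\1_H (past t w, y))%:E * (\1_C a)%:E)).
    apply: eq_integral => a _.
    by apply: eq_indicM; rewrite /mkset hE update_at.
  rewrite ge0_integralZl//; last by apply/measurable_EFinP; exact: measurable_indic.
  by rewrite integral_indic// setIT.
- move=> t G B mG mB; rewrite (@law_step t.+1); last first.
    split.
      apply: (@measurableI _ _ (@past X A t.+1 @^-1` G) ((fun w : W => (w t.+1).1) @^-1` B)).
        by rewrite -[X in measurable X]setTI; exact: measurable_past.
      rewrite -[X in measurable X]setTI.
      exact: (measurableT_comp measurable_fst (measurable_coordinate t.+1)).
    move=> w w' ww' /= [Gw Bw].
    by rewrite -(past_agree (agree_le (leqnSn _) ww')) -(ww' t.+1).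
  rewrite [RHS]integral_restrict; apply: eq_integral => w _.
  transitivity (\int[state_law t.+1 w]_y ((\1_G (past t.+1 w))%:E * (\1_B y)%:E)).
    apply: eq_integral => y _.
    rewrite -[RHS](@prob_integral_cst _ _ R (pi t.+1 (past t.+1 w, y))).
      apply: eq_integral => a _.
      by apply: eq_indicM; rewrite /mkset past_update update_at.
    exact: prob_kernel.
  rewrite ge0_integralZl//; last by apply/measurable_EFinP; exact: measurable_indic.
  by rewrite integral_indic// setIT.
Qed.

End strategic_measures.

(** * Laws of the states and actions under a policy *)

Section strategic_marginals.
Context (R : realType) (X A : ptopologicalType).
Notation E := (borel X * borel A)%type.
Notation W := (trajectory X A).
Variables (q : R.-pker E ~> borel X) (pi : policy R X A) (x : X).

Let P := strategic_measure q pi x.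

Lemma strategic_measureP : is_strategic_measure q pi x P.
Proof. apply: (xgetPex _ (strategic_measure_exists q pi x)). Qed.

Let integral_same_law d (T : measurableType d) (h : W -> T) (m : {measure set T -> \bar R})
    (f : T -> \bar R) :
  measurable_fun setT h -> (forall B, measurable B -> P (h @^-1` B) = m B) ->
  measurable_fun setT f -> (forall t, 0 <= f t) ->
  \int[P]_w f (h w) = \int[m]_t f t.
Proof.
move=> mh hm mf f0.
have := @ge0_integral_pushforward _ _ _ _ R _ mh P setT f measurableT mf (fun t _ => f0 t).
rewrite preimage_setT => <-.
by apply: eq_measure_integral => B mB _; exact: hm.
Qed.

Lemma measurable_state t : measurable_fun setT (fun w : W => (w t).1).
Proof. exact: (measurableT_comp measurable_fst (measurable_coordinate t)). Qed.

Lemma integral_initial_state (f : borel X -> \bar R) :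
  measurable_fun setT f -> (forall y, 0 <= f y) ->
  \int[P]_w f (w 0%N).1 = f x.
Proof.
move=> mf f0; have [P0 _ _] := strategic_measureP.
rewrite (@integral_same_law _ _ (fun w => (w 0%N).1) (\d_(x : borel X)))//.
- by rewrite integral_dirac// diracT mul1e.
- exact: measurable_state.
Qed.

Lemma integral_next_state t (f : borel X -> \bar R) :
  measurable_fun setT f -> (forall y, 0 <= f y) ->
  \int[P]_w f (w t.+1).1 = \int[P]_w \int[q (w t)]_y f y.
Proof.
move=> mf f0; have [_ _ PS] := strategic_measureP.
(* the law of the next state, as a mixture of the measures [q (w t)] *)
pose m := kernel_seq (kprobability (measurable_cst (P : pprobability W R) : measurable_fun [set: unit] _))
  (kernel_precomp q (measurableT_comp (measurable_coordinate t) (@measurable_snd _ _ unit W))).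
rewrite (@integral_same_law _ _ (fun w => (w t.+1).1) (m tt))//; last 2 first.
- exact: measurable_state.
- move=> B mB; have := PS t setT B measurableT mB.
  rewrite (_ : [set w | _ /\ _] = (fun w : W => (w t.+1).1) @^-1` B); last first.
    by apply/seteqP; split => w //= [].
  by move=> ->; rewrite kernel_seqE.
by rewrite integral_kernel_seq.
Qed.

End strategic_marginals.

Section stationary_policy.
Context (R : realType) (X A : ptopologicalType).
Notation E := (borel X * borel A)%type.
Notation W := (trajectory X A).
Variables (q : R.-pker E ~> borel X) (phi : borel X -> borel A).
Hypothesis mphi : measurable_fun setT phi.

Lemma measurable_decision t :
  measurable_fun setT (fun h : history X A t => phi h.2).
Proof. exact: (measurableT_comp mphi measurable_snd). Qed.

Definition stationary_policy : policy R X A :=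
  fun t => kdirac (@measurable_decision t).

(** The law of a state and action and the law of the state with the action chosen
by [phi] agree on measurable rectangles, hence everywhere. *)
Lemma integral_stationary x t (f : E -> \bar R) :
  measurable_fun setT f -> (forall e, 0 <= f e) ->
  let P := strategic_measure q stationary_policy x in
  \int[P]_w f (w t) = \int[P]_w f ((w t).1, phi (w t).1).
Proof.
move=> mf f0 P; have [_ Pa _] := strategic_measureP q stationary_policy x.
pose h (w : W) : E := ((w t).1, phi (w t).1).
have mh : measurable_fun setT h.
  apply: measurable_fun_pair; first exact: measurable_state.
  exact: (measurableT_comp mphi (measurable_state t)).
have mt := measurable_coordinate t : measurable_fun setT (fun w : W => w t).
have := @ge0_integral_pushforward _ _ _ _ R _ mh P setT f measurableT mf (fun t _ => f0 t).
rewrite preimage_setT => <-.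
have := @ge0_integral_pushforward _ _ _ _ R _ mt P setT f measurableT mf (fun t _ => f0 t).
rewrite preimage_setT => <-.
apply: eq_measure_integral => S mS _.
(* rectangles are stable under intersection and generate the product *)
apply: (@measure_unique _ R E [set B `*` C | B in measurable & C in measurable] (fun=> setT)) => //.
- exact: measurable_prod_measurableType.
- move=> _ _ [B1 mB1 [C1 mC1 <-]] [B2 mB2 [C2 mC2 <-]].
  exists (B1 `&` B2); first exact: measurableI.
  by exists (C1 `&` C2); [exact: measurableI|rewrite setXI].
- by move=> _; exists setT => //; exists setT => //; rewrite setXTT.
- by rewrite bigcup_const.
- move=> _ [B mB [C mC <-]].
  have mHB : measurable ([set hh | B hh.2] : set (history X A t)).
    by rewrite -[X in measurable X]setTI; exact: measurable_snd.
  transitivity (P [set w | [set hh | B hh.2] (history_of t w) /\ C (w t).2]); first by [].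
  rewrite (Pa t [set hh | B hh.2] C mHB mC).
  have mBt : measurable [set w : W | B (w t).1].
    by rewrite -[X in measurable X]setTI; exact: measurable_state.
  have mCt : measurable [set w : W | C (phi (w t).1)].
    by rewrite -[X in measurable X]setTI; exact: (measurableT_comp mphi (measurable_state t)).
  transitivity (\int[P]_(w in [set w : W | B (w t).1]) (\1_[set w : W | C (phi (w t).1)] w)%:E); first by [].
  by rewrite integral_indic// setIC.
- move=> _; have : P setT < +oo by rewrite probability_setT ltry.
  exact.
Qed.

End stationary_policy.

(** * Costs of policies and the Bellman operator *)

Section costs.
Context (R : realType) (X A : ptopologicalType).
Notation E := (borel X * borel A)%type.
Notation W := (trajectory X A).
Variables (q : R.-pker E ~> borel X) (c : E -> \bar R).
Hypothesis mc : measurable_fun setT c.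
Hypothesis c0 : forall e, 0 <= c e.

Definition expected_cost (pi : policy R X A) (x : X) (t : nat) : \bar R :=
  \int[strategic_measure q pi x]_w c (w t).

Lemma expected_cost_ge0 pi x t : 0 <= expected_cost pi x t.
Proof. by apply: integral_ge0. Qed.

Let mct t : measurable_fun setT (fun w : W => c (w t)).
Proof. exact: (measurableT_comp mc (measurable_coordinate t)). Qed.

Lemma finite_horizon_costE N (b : R) pi x : (0 <= b)%R ->
  finite_horizon_cost q c N b pi x =
  \sum_(0 <= t < N) ((b ^+ t)%:E * expected_cost pi x t).
Proof.
move=> b0; rewrite /finite_horizon_cost ge0_integral_sum//.
- by apply: eq_bigr => t _; rewrite ge0_integralZl_EFin ?exprn_ge0.
- by move=> t; exact: measurable_funeM.
- by move=> t w _; apply: mule_ge0 => //; rewrite lee_fin exprn_ge0.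
Qed.

Lemma discounted_costE (b : R) pi x : (0 <= b)%R ->
  discounted_cost q c b pi x =
  \sum_(0 <= t <oo) ((b ^+ t)%:E * expected_cost pi x t).
Proof.
move=> b0; rewrite /discounted_cost integral_nneseries//.
- by apply: eq_eseriesr => t _; rewrite ge0_integralZl_EFin ?exprn_ge0.
- by move=> t; exact: measurable_funeM.
- by move=> t w _; apply: mule_ge0 => //; rewrite lee_fin exprn_ge0.
Qed.

Definition bellman (b : R) (V : X -> \bar R) (xa : E) : \bar R :=
  c xa + b%:E * \int[q xa]_y V y.

Lemma measurable_bellman b (V : X -> \bar R) :
  measurable_fun setT (V : borel X -> _) -> (forall y, 0 <= V y) ->
  measurable_fun setT (bellman b V).
Proof.
move=> mV V0; apply: emeasurable_funD => //; apply: measurable_funeM.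
apply: measurable_fun_integral_kernel => // B mB; exact: measurable_kernel.
Qed.

Lemma bellman_ge0 b V xa : (0 <= b)%R -> (forall y, 0 <= V y) -> 0 <= bellman b V xa.
Proof.
by move=> b0 V0; rewrite adde_ge0// mule_ge0 ?lee_fin//; exact: integral_ge0.
Qed.

Lemma le_bellman b b' (V V' : X -> \bar R) xa : (0 <= b <= b')%R ->
  measurable_fun setT (V : borel X -> _) -> measurable_fun setT (V' : borel X -> _) ->
  (forall y, 0 <= V y) -> (forall y, V y <= V' y) ->
  bellman b V xa <= bellman b' V' xa.
Proof.
move=> /andP[b0 bb'] mV mV' V0 VV'; rewrite leeD2l//.
have V'0 y : 0 <= V' y := le_trans (V0 y) (VV' y).
apply: (@le_trans _ _ (b%:E * \int[q xa]_y V' y)).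
  by rewrite lee_wpmul2l ?lee_fin//; apply: ge0_le_integral.
by rewrite lee_wpmul2r ?lee_fin//; exact: integral_ge0.
Qed.

Lemma integral_bellman b V pi x t : (0 <= b)%R ->
  measurable_fun setT (V : borel X -> _) -> (forall y, 0 <= V y) ->
  \int[strategic_measure q pi x]_w bellman b V (w t) =
  expected_cost pi x t + b%:E * \int[strategic_measure q pi x]_w V (w t.+1).1.
Proof.
move=> b0 mV V0.
have mI : measurable_fun setT (fun w : W => \int[q (w t)]_y V y).
  apply: (measurableT_comp (f := fun xa => \int[q xa]_y V y)); last exact: measurable_coordinate.
  by apply: measurable_fun_integral_kernel => // B mB; exact: measurable_kernel.
have I0 (w : W) : 0 <= \int[q (w t)]_y V y by exact: integral_ge0.
rewrite /bellman ge0_integralD//; last 2 first.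
- by move=> w _; rewrite mule_ge0 ?lee_fin.
- exact: measurable_funeM.
by rewrite ge0_integralZl_EFin// -integral_next_state.
Qed.

(** Replacing [V k.+1] by [bellman b (V k)] at each state of the trajectory pays
the cost of the current step and leaves [b] times [V k] at the next state; after
[n] steps the whole cost has been paid. The induction runs over the
starting time [s]. *)
Lemma subsolution_le_cost b (V : nat -> X -> \bar R) pi x n : (0 <= b)%R ->
  (forall k, measurable_fun setT (V k : borel X -> _)) ->
  (forall k y, 0 <= V k y) -> (forall y, V 0%N y = 0) ->
  (forall k y a, V k.+1 y <= bellman b (V k) (y, a)) ->
  V n x <= \sum_(0 <= t < n) ((b ^+ t)%:E * expected_cost pi x t).
Proof.
move=> b0 mV V0 V00 VS; set P := strategic_measure q pi x.
suff H s : \int[P]_w V n (w s).1 <=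
    \sum_(0 <= t < n) ((b ^+ t)%:E * expected_cost pi x (s + t)).
  have := H 0%N; rewrite (integral_initial_state q pi x (mV n) (V0 n)).
  by under eq_bigr do rewrite add0n.
elim: n s => [|n IH] s.
  rewrite big_geq// (eq_integral (cst 0)) ?integral0// => w _; exact: V00.
rewrite big_nat_recl// expr0 mul1e addn0.
apply: (@le_trans _ _ (\int[P]_w bellman b (V n) (w s))).
  apply: ge0_le_integral => //.
  - exact: (measurableT_comp (mV n.+1) (measurable_state s)).
  - by apply: (measurableT_comp (measurable_bellman b (mV n) (V0 n))); exact: measurable_coordinate.
  - by move=> w _; case: (w s) => y a; exact: VS.
rewrite integral_bellman// leeD2l//.
apply: (@le_trans _ _ (b%:E * \sum_(0 <= t < n) ((b ^+ t)%:E * expected_cost pi x (s.+1 + t)))).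
  by rewrite lee_wpmul2l ?lee_fin.
rewrite ge0_sume_distrr; last first.
  by move=> t _; rewrite mule_ge0 ?lee_fin ?exprn_ge0//; exact: expected_cost_ge0.
by apply: lee_sum => t _; rewrite muleA -EFinM -exprS addSnnS.
Qed.

(** The same argument in the other direction, along the policy [phi]: each step
costs at most [L] plus the decrease of [h]. It serves with [L = 0] for the
discounted criterion and with [b = 1] for the average one. *)
Lemma cost_le_supersolution b (L : R) (h : X -> \bar R) (phi : borel X -> borel A)
    (mphi : measurable_fun setT phi) x n :
  (0 <= b)%R -> (0 <= L)%R ->
  measurable_fun setT (h : borel X -> _) -> (forall y, 0 <= h y) ->
  (forall y, bellman b h (y, phi y) <= L%:E + h y) ->
  \sum_(0 <= t < n) ((b ^+ t)%:E * expected_cost (stationary_policy R mphi) x t) <=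
  L%:E * (\sum_(0 <= t < n) b ^+ t)%R%:E + h x.
Proof.
move=> b0 L0 mh h0 hphi; set pi := stationary_policy R mphi; set P := strategic_measure q pi x.
pose H t := \int[P]_w h (w t).1.
have H0 t : 0 <= H t by exact: integral_ge0.
have one_step t : expected_cost pi x t + b%:E * H t.+1 <= L%:E + H t.
  rewrite -integral_bellman// (integral_stationary q mphi x t)//; last 2 first.
  - exact: measurable_bellman.
  - by move=> e; exact: bellman_ge0.
  apply: (@le_trans _ _ (\int[P]_w (L%:E + h (w t).1))).
    apply: ge0_le_integral => //.
    - by move=> w _; exact: bellman_ge0.
    - apply: (measurableT_comp (measurable_bellman b mh h0)).
      apply: measurable_fun_pair; first exact: measurable_state.
      exact: (measurableT_comp mphi (measurable_state t)).
    - apply: emeasurable_funD => //.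
      exact: (measurableT_comp mh (measurable_state t)).
  rewrite ge0_integralD//; last exact: (measurableT_comp mh (measurable_state t)).
  by rewrite prob_integral_cst; [exact: lexx|exact: probability_setT].
suff : \sum_(0 <= t < n) ((b ^+ t)%:E * expected_cost pi x t) + (b ^+ n)%:E * H n <=
    L%:E * (\sum_(0 <= t < n) b ^+ t)%R%:E + h x.
  apply: le_trans; rewrite leeDl// mule_ge0 ?lee_fin ?exprn_ge0//.
have Hx : H 0%N = h x by rewrite /H integral_initial_state.
move: (expected_cost pi x) (expected_cost_ge0 pi x) one_step => e e0 one_step.
move: H H0 one_step Hx => H H0 one_step Hx.
(* what remains is an inequality between the sequences [e] and [H] *)
clear pi P.
elim: n => [|n IH].
  by rewrite !big_geq// mule0 !add0e expr0 mul1e Hx.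
rewrite !big_nat_recr//= EFinD muleDr// -addeA.
apply: (@le_trans _ _ (\sum_(0 <= t < n) ((b ^+ t)%:E * e t) +
    (b ^+ n)%:E * (L%:E + H n))).
  rewrite leeD2l// exprSr EFinM -muleA -ge0_muleDr//; last by rewrite mule_ge0 ?lee_fin.
  by rewrite lee_wpmul2l ?lee_fin ?exprn_ge0.
rewrite ge0_muleDr ?lee_fin// addeCA [X in _ <= X]addeAC [leRHS]addeC.
by rewrite [(b ^+ n)%:E * L%:E]muleC leeD2l.
Qed.

End costs.

(** * Lower semicontinuity of integrals *)

Lemma cvg_integral_nondecreasing d (T : measurableType d) (R : realType)
    (mu : {measure set T -> \bar R}) (f_ : nat -> T -> \bar R) (f : T -> \bar R) :
  (forall n, measurable_fun setT (f_ n)) -> (forall n t, 0 <= f_ n t) ->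
  (forall t, nondecreasing_seq (fun n => f_ n t)) ->
  (forall t, f_ n t @[n --> \oo] --> f t) ->
  \int[mu]_t f_ n t @[n --> \oo] --> \int[mu]_t f t.
Proof.
move=> mf f0 ndf f_f.
rewrite (_ : \int[mu]_t f t = \int[mu]_t limn (fun n => f_ n t)).
  by apply: cvg_monotone_convergence => // t _; exact: ndf.
by apply: eq_integral => t _; apply/esym/cvg_lim => //; exact: f_f.
Qed.

Section lower_semicontinuity.
Context (R : realType) (T : topologicalType).

(** Lower semicontinuity. *)
Definition closed_sublevels (f : T -> \bar R) : Prop :=
  forall r : R, closed [set a | f a <= r%:E].

Lemma closed_sublevelsD (f g : T -> \bar R) : (forall a, 0 <= f a) -> (forall a, 0 <= g a) ->
  closed_sublevels f -> closed_sublevels g -> closed_sublevels (fun a => f a + g a).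
Proof.
move=> f0 g0 lf lg r a clS; rewrite /mkset leNgt; apply/negP => rfg.
have [s [sf tg]] : exists s : R, s%:E < f a /\ (r - s)%:E < g a.
  have := g0 a; have := f0 a; move: rfg.
  case: (f a) => [p| |]//; case: (g a) => [p'| |]// + fa0 ga0; rewrite ?lee_fin in fa0 ga0.
  - rewrite -EFinD lte_fin => rpq; exists (p - (p + p' - r) / 2)%R.
    have : (0 < (p + p' - r) / 2)%R by rewrite divr_gt0// subr_gt0.
    by move=> d0; rewrite !lte_fin; split; lra.
  - by exists (p - 1)%R; rewrite lte_fin ltry; split => //; lra.
  - by exists (r + 1)%R; rewrite ltry lte_fin; split => //; lra.
  - by exists r; rewrite !ltry.
have cU : closed ([set a | f a <= s%:E] `|` [set a | g a <= (r - s)%:E]) by exact: closedU.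
have [|] : ([set a | f a <= s%:E] `|` [set a | g a <= (r - s)%:E]) a.
- apply: cU; apply: closure_subset clS => b /= fgb.
  have [fs|sfb] := leP (f b) s%:E; first by left.
  right; rewrite /= leNgt; apply/negP => gb; move: fgb; rewrite leNgt => /negP; apply.
  by rewrite -[r](subrKC s) EFinD; apply: lteD.
- by rewrite /= leNgt sf.
- by rewrite /= leNgt tg.
Qed.

Lemma closed_sublevelsZ (k : R) (f : T -> \bar R) : (0 <= k)%R ->
  (forall a, 0 <= f a) -> closed_sublevels f -> closed_sublevels (fun a => k%:E * f a).
Proof.
rewrite le_eqVlt => /predU1P[<-|k0] f0 lf r.
  rewrite [X in closed X](_ : _ = if (0 <= r)%R then setT else set0); last first.
    by apply/seteqP; split => a; rewrite /= mul0e lee_fin; case: ifP.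
  by case: ifP => _; [exact: closedT|exact: closed0].
rewrite [X in closed X](_ : _ = [set a | f a <= (k^-1 * r)%:E]); first exact: lf.
by apply/seteqP; split => a /=; rewrite EFinM lee_pdivlMl.
Qed.

Lemma closed_sublevels_sum (I : eqType) (s : seq I) (f : I -> T -> \bar R) :
  (forall i, i \in s -> forall a, 0 <= f i a) ->
  (forall i, i \in s -> closed_sublevels (f i)) ->
  closed_sublevels (fun a => \sum_(i <- s) f i a).
Proof.
elim: s => [|i s IH] f0 lf.
  move=> r; rewrite [X in closed X](_ : _ = if (0 <= r)%R then setT else set0).
    by case: ifP => _; [exact: closedT|exact: closed0].
  by apply/seteqP; split => a; rewrite /= big_nil lee_fin; case: ifP.
under eq_fun do rewrite big_cons.
have f0' j : j \in s -> forall a, 0 <= f j a.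
  by move=> js; apply: f0; rewrite inE js orbT.
apply: closed_sublevelsD.
- by apply: f0; rewrite mem_head.
- by move=> a; rewrite big_seq; apply: sume_ge0 => j js; exact: f0'.
- by apply: lf; rewrite mem_head.
- by apply: IH => // j js; apply: lf; rewrite inE js orbT.
Qed.

Lemma closed_sublevels_limit (f_ : nat -> T -> \bar R) (f : T -> \bar R) :
  (forall n, closed_sublevels (f_ n)) -> (forall n a, f_ n a <= f a) ->
  (forall a, f_ n a @[n --> \oo] --> f a) -> closed_sublevels f.
Proof.
move=> lf f_le f_f r.
rewrite [X in closed X](_ : _ = \bigcap_n [set a | f_ n a <= r%:E]).
  by apply: closed_bigI => n _; exact: lf.
apply/seteqP; split => [a fa n _|a H]; first exact: le_trans (f_le n a) fa.
rewrite /= -(cvg_lim _ (f_f a))//; apply: lime_le; first by apply/cvg_ex; exists (f a).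
by apply: nearW => n; exact: H.
Qed.

Import HBNNSimple.

(** Integrals of simple functions are continuous in [a], being finite
combinations of the functions [k a B]; the integral of [V] is the increasing limit
of such integrals. *)
Lemma closed_sublevels_integral d (Y : measurableType d)
    (k : T -> {measure set Y -> \bar R}) (V : Y -> \bar R) :
  (forall B, measurable B -> continuous (fun a => k a B)) ->
  measurable_fun setT V -> (forall y, 0 <= V y) ->
  closed_sublevels (fun a => \int[k a]_y V y).
Proof.
move=> ck mV V0; pose s n := nnsfun_approx measurableT mV n.
have s_nd y : nondecreasing_seq (fun n => (s n y)%:E).
  by move=> m n mn; rewrite lee_fin; exact/lefP/nd_nnsfun_approx.
have s_cvg y : (s n y)%:E @[n --> \oo] --> V y by exact: cvg_nnsfun_approx.
have s_V (n : nat) y : (s n y)%:E <= V y.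
  rewrite -(cvg_lim _ (s_cvg y))//; apply: lime_ge; first by apply/cvg_ex; exists (V y).
  by exists n => // m /= nm; exact: s_nd.
apply: (@closed_sublevels_limit (fun n a => \int[k a]_y (s n y)%:E)).
- move=> n r; rewrite [X in closed X](_ : _ = [set a |
      \sum_(z <- (fset_set (range (s n)))) z%:E * k a (s n @^-1` [set z]) <= r%:E]).
    have mem z : z \in (fset_set (range (s n))) -> (0 <= z)%R.
      by rewrite (in_fset_set (fimfunP (s n))) => /set_mem[y _ <-].
    apply: closed_sublevels_sum => z /mem z0; first by move=> a; rewrite mule_ge0.
    apply: closed_sublevelsZ => // r'.
    apply: (@closed_comp _ _ _ [set y | y <= r'%:E]); last exact: closed_ereal_ge_ereal.
    by move=> a _; exact: ck.
  apply/seteqP; split => a; rewrite /= integralT_nnsfun sintegralE fsbig_finite//.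
- move=> n a; apply: ge0_le_integral => //.
  + by move=> y _; rewrite lee_fin.
  + exact/measurable_EFinP.
- move=> a; apply: cvg_integral_nondecreasing => //.
  + by move=> n; exact/measurable_EFinP.
  + by move=> n y; rewrite lee_fin.
Qed.

End lower_semicontinuity.

(** * The discounted-cost optimality equation *)

(** Monotone convergence, in the form in which it passes a bound that is uniform
in [n] to the limit. *)
Lemma bellman_limit (R : realType) (X A : ptopologicalType)
    (q : R.-pker (borel X * borel A)%type ~> borel X)
    (c : borel X * borel A -> \bar R) (b : R) (V_ : nat -> X -> \bar R)
    (V : X -> \bar R) xa (l : \bar R) :
  (forall e, 0 <= c e) -> (0 <= b)%R ->
  (forall n, measurable_fun setT (V_ n : borel X -> _)) -> (forall n y, 0 <= V_ n y) ->
  (forall y, nondecreasing_seq (fun n => V_ n y)) ->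
  (forall y, V_ n y @[n --> \oo] --> V y) ->
  (forall n, bellman q c b (V_ n) xa <= l) -> bellman q c b V xa <= l.
Proof.
move=> c0 b0 mV V0 ndV cvgV Vl.
have V_V y : 0 <= V y.
  by rewrite -(cvg_lim _ (cvgV y))//; apply: lime_ge; [apply/cvg_ex; exists (V y)|exact: nearW].
have cvgI : \int[q xa]_y V_ n y @[n --> \oo] --> \int[q xa]_y V y.
  exact: cvg_integral_nondecreasing.
have cvgB : bellman q c b (V_ n) xa @[n --> \oo] --> bellman q c b V xa.
  apply: cvgeD; [|exact: cvg_cst|exact: cvgeZl].
  by apply: ge0_adde_def; rewrite inE// mule_ge0 ?lee_fin//; exact: integral_ge0.
rewrite -(cvg_lim _ cvgB)//; apply: lime_le; first by apply/cvg_ex; eexists; exact: cvgB.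
exact: nearW.
Qed.

Section discounted.
Context (R : realType) (X A : ptopologicalType).
Notation E := (borel X * borel A)%type.
Hypothesis X_borel : borel_subset_of_polish R X.
Hypothesis A_borel : borel_subset_of_polish R A.
Variables (q : R.-pker E ~> borel X) (c : E -> \bar R).
Hypothesis mc : measurable_fun setT c.
Hypothesis c0 : forall e, 0 <= c e.
Hypothesis S_star : assumption_S_star q c.

Let hausA : hausdorff_space A := borel_subset_of_polish_hausdorff A_borel.

(** The level sets are closed by lower semicontinuity of both terms, and contained
in the compact level sets of [c]. *)
Lemma inf_compact_bellman b (V : X -> \bar R) x : (0 <= b)%R ->
  measurable_fun setT (V : borel X -> _) -> (forall y, 0 <= V y) ->
  inf_compact (fun a : A => bellman q c b V (x, a)).
Proof.
move=> b0 mV V0 l; have [cc cq] := S_star.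
have I0 (a : A) : 0 <= \int[q (x, a)]_y V y by exact: integral_ge0.
apply: (subclosed_compact _ (cc x l)); last first.
  move=> a /=; apply: le_trans; rewrite leeDl// mule_ge0 ?lee_fin//.
apply: closed_sublevelsD => //.
- by move=> a; rewrite mule_ge0 ?lee_fin.
- by move=> r; apply: compact_closed => //; exact: cc.
- apply: closed_sublevelsZ => //; apply: closed_sublevels_integral => //.
  by move=> B mB; exact: cq.
Qed.

Lemma bellman_minimiser b (V : X -> \bar R) : (0 <= b)%R ->
  measurable_fun setT (V : borel X -> _) -> (forall y, 0 <= V y) ->
  exists phi : borel X -> borel A, measurable_fun setT phi /\
    forall x a, bellman q c b V (x, phi x) <= bellman q c b V (x, a).
Proof.
move=> b0 mV V0; have [U sU] := borel_subset_of_polish_standard X_borel.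
have [||| phi [mphi phiP]] := measurable_minimiser sU A_borel (g := bellman q c b V).
- exact: measurable_bellman.
- by move=> x; exact: inf_compact_bellman.
- by move=> e; exact: bellman_ge0.
exists phi; split => // x a; rewrite phiP; apply: ereal_inf_lbound; by exists a.
Qed.

Fixpoint value_iteration (b : R) (n : nat) : X -> \bar R :=
  if n is m.+1 then minimum (bellman q c b (value_iteration b m)) else fun=> 0.

(** Value iteration increases, so this supremum is its limit. *)
Definition optimal_value (b : R) (x : X) : \bar R :=
  ereal_sup (range (fun n => value_iteration b n x)).

Variable b : R.
Hypothesis b0 : (0 <= b)%R.

Notation V_ := (value_iteration b).
Notation V := (optimal_value b).

Lemma value_iteration_ge0 n x : 0 <= V_ n x.
Proof.
elim: n x => //= n IH x; apply: le_ereal_inf_tmp => _ [a _ <-]; exact: bellman_ge0.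
Qed.

Lemma measurable_value_iteration n : measurable_fun setT (V_ n : borel X -> _).
Proof.
elim: n => //= n IH; have [U sU] := borel_subset_of_polish_standard X_borel.
apply: (measurable_minimum sU A_borel).
  by apply: measurable_bellman => //; exact: value_iteration_ge0.
by move=> x; apply: inf_compact_bellman => //; exact: value_iteration_ge0.
Qed.

Lemma value_iterationS_le n x a : V_ n.+1 x <= bellman q c b (V_ n) (x, a).
Proof. by apply: ereal_inf_lbound; exists a. Qed.

Lemma nondecreasing_value_iteration x : nondecreasing_seq (fun n => V_ n x).
Proof.
apply/nondecreasing_seqP => n; elim: n x => [|n IH] x.
  exact: (value_iteration_ge0 1 x).
apply: le_ereal_inf_tmp => _ [a _ <-]; apply: le_trans (value_iterationS_le n x a) _.
apply: le_bellman => //; rewrite ?b0 ?lexx//.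
- exact: measurable_value_iteration.
- exact: (measurable_value_iteration n.+1).
- exact: value_iteration_ge0.
Qed.

Lemma cvg_value_iteration x : V_ n x @[n --> \oo] --> V x.
Proof. by apply: ereal_nondecreasing_cvgn; exact: nondecreasing_value_iteration. Qed.

Lemma value_iteration_le n x : V_ n x <= V x.
Proof. by apply: ereal_sup_ubound; exists n. Qed.

Lemma optimal_value_ge0 x : 0 <= V x.
Proof. exact: le_trans (value_iteration_ge0 0 x) (value_iteration_le 0 x). Qed.

Lemma measurable_optimal_value : measurable_fun setT (V : borel X -> _).
Proof.
apply: (emeasurable_fun_cvg (fun n => V_ n : borel X -> _)).
  exact: measurable_value_iteration.
by move=> x _; exact: cvg_value_iteration.
Qed.

(** Each iterate is below [bellman] applied to the previous one, and [bellman] is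
monotone. *)
Lemma optimal_value_le_bellman x a : V x <= bellman q c b V (x, a).
Proof.
apply: ge_ereal_sup => _ [[|n] _ <-].
  by apply: bellman_ge0 => //; exact: optimal_value_ge0.
apply: le_trans (value_iterationS_le n x a) _; apply: le_bellman => //.
- by rewrite b0 lexx.
- exact: measurable_value_iteration.
- exact: measurable_optimal_value.
- exact: value_iteration_ge0.
- by move=> y; exact: value_iteration_le.
Qed.

(** The iterates are minima of inf-compact functions that increase with [n]; one
action is good for all of them at level [V x], by nested compact level sets. *)
Lemma optimal_value_attained x : exists a, bellman q c b V (x, a) <= V x.
Proof.
have [Voo|Vfin] := eqVneq (V x) +oo.
  by exists point; rewrite Voo leey.
have {}Vfin : V x \is a fin_num by rewrite ge0_fin_numE ?optimal_value_ge0// ltey.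
have [|||a aP] := @inf_compact_nondecreasing_limit R A hausA
    (fun k a => bellman q c b (V_ k) (x, a)) (fine (V x)).
- move=> k; apply: inf_compact_bellman => //; last exact: value_iteration_ge0.
  exact: measurable_value_iteration.
- move=> k a; apply: le_bellman => //; rewrite ?b0 ?lexx//.
  + exact: measurable_value_iteration.
  + exact: (measurable_value_iteration k.+1).
  + exact: value_iteration_ge0.
  + by move=> y; exact: nondecreasing_value_iteration.
- move=> k r r0; have : V_ k.+1 x < V x + r%:E.
    by apply: le_lt_trans (value_iteration_le k.+1 x) _; rewrite lteDl.
  by move=> /ereal_inf_lt[_ [a _ <-] /ltW]; exists a; rewrite EFinD fineK.
exists a; apply: (bellman_limit (V_ := value_iteration b)) => //.
- exact: measurable_value_iteration.
- exact: value_iteration_ge0.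
- exact: nondecreasing_value_iteration.
- exact: cvg_value_iteration.
- by move=> k; rewrite -[leRHS]fineK.
Qed.

(** The iterates are subsolutions, hence below the cost of every policy; [V] is
a supersolution along a minimising stationary policy, whose cost it thus bounds
from above. *)
Lemma discounted_value_optimal x : discounted_value q c b x = V x.
Proof.
apply/eqP; rewrite eq_le; apply/andP; split; last first.
  apply: le_ereal_inf_tmp => _ [pi _ <-]; apply: ge_ereal_sup => _ [n _ <-].
  rewrite discounted_costE//.
  apply: (@le_trans _ _ (\sum_(0 <= t < n) ((b ^+ t)%:E * expected_cost q c pi x t))).
    apply: (@subsolution_le_cost _ _ _ q c) => //.
    - exact: measurable_value_iteration.
    - exact: value_iteration_ge0.
    - exact: value_iterationS_le.
  apply: nneseries_lim_ge => t _ _; rewrite mule_ge0 ?lee_fin ?exprn_ge0//.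
  exact: expected_cost_ge0.
have [phi [mphi phiP]] := bellman_minimiser b0 measurable_optimal_value optimal_value_ge0.
apply: (@le_trans _ _ (discounted_cost q c b (stationary_policy R mphi) x)).
  by apply: ereal_inf_lbound; exists (stationary_policy R mphi).
rewrite discounted_costE//; apply: lime_le.
  apply: is_cvg_nneseries => t _ _; rewrite mule_ge0 ?lee_fin ?exprn_ge0//.
  exact: expected_cost_ge0.
apply: nearW => n.
have := @cost_le_supersolution _ _ _ q c mc c0 b 0%R V phi mphi x n b0 (lexx _)
  measurable_optimal_value optimal_value_ge0.
rewrite mul0e add0e; apply => y; rewrite add0e.
by have [a aP] := optimal_value_attained y; exact: le_trans (phiP y a) aP.
Qed.

End discounted.

(** * Comparison of discounted and average costs *)

Lemma limn_esup_lt (R : realType) (s : nat -> \bar R) (y : \bar R) :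
  limn_esup s < y -> \forall n \near \oo, s n < y.
Proof.
move=> /ereal_inf_lt[_ [V FV <-] sV]; apply: filterS FV => n Vn.
by apply: le_lt_trans sV; apply: ereal_sup_ubound; exists n.
Qed.

Lemma limn_esup_le (R : realType) (s : nat -> \bar R) (y : \bar R) :
  (\forall n \near \oo, s n <= y) -> limn_esup s <= y.
Proof.
move=> sy; apply: ge_ereal_inf; exists (ereal_sup (s @` [set n | s n <= y])).
  by exists [set n | s n <= y].
by apply: ge_ereal_sup => _ [n sn <-].
Qed.

Lemma limn_esup_ge0 (R : realType) (s : nat -> \bar R) :
  (forall n, 0 <= s n) -> 0 <= limn_esup s.
Proof.
move=> s0; rewrite leNgt; apply/negP => /limn_esup_lt[N _ sN].
by have := sN N (leqnn N); rewrite /= ltNge s0.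
Qed.

(** Abel summation: a linear bound on partial sums passes to discounted sums. The
induction carries the defect of the undiscounted bound, weighted by [b ^+ M],
which is nonnegative and only loses weight at each step. *)
Lemma abel_bound (R : realType) (e : nat -> R) (C L b : R) :
  (0 <= b <= 1)%R ->
  (forall N, \sum_(0 <= t < N) e t <= C + L * N%:R)%R ->
  forall M, (\sum_(0 <= t < M) b ^+ t * e t <= C + L * \sum_(0 <= t < M) b ^+ t)%R.
Proof.
move=> /andP[b0 b1] He M.
suff : (b ^+ M * (C + L * M%:R - \sum_(0 <= t < M) e t) <=
    C + L * (\sum_(0 <= t < M) b ^+ t) - \sum_(0 <= t < M) b ^+ t * e t)%R.
  move=> H; rewrite -subr_ge0; apply: le_trans H.
  by rewrite mulr_ge0 ?exprn_ge0// subr_ge0.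
elim: M => [|M IH]; first by rewrite !big_geq// expr0; lra.
rewrite !(@big_nat_recr _ _ _ M)//=.
set S := (\sum_(0 <= t < M) e t)%R in IH *.
set G := (\sum_(0 <= t < M) b ^+ t)%R in IH *.
set D := (\sum_(0 <= t < M) b ^+ t * e t)%R in IH *.
have HM : (0 <= C + L * M.+1%:R - (S + e M))%R.
  by rewrite subr_ge0; have := He M.+1; rewrite big_nat_recr.
apply: (@le_trans _ _ (b ^+ M * (C + L * M.+1%:R - (S + e M)))%R).
  by rewrite ler_wpM2r// exprS ler_piMl// exprn_ge0.
rewrite -natr1; move: IH; set B := (b ^+ M)%R; nra.
Qed.

Lemma geometric_sum_le (R : realType) (b : R) n : (0 <= b < 1)%R ->
  (\sum_(0 <= t < n) b ^+ t <= (1 - b)^-1)%R.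
Proof.
move=> /andP[b0 b1]; have b1' : (0 < 1 - b)%R by rewrite subr_gt0.
rewrite -[leRHS]mul1r ler_pdivlMr//.
suff -> : ((\sum_(0 <= t < n) b ^+ t) * (1 - b) = 1 - b ^+ n)%R.
  by rewrite gerBl exprn_ge0.
elim: n => [|n IH]; first by rewrite big_geq// expr0; lra.
by rewrite big_nat_recr//= mulrDl IH exprS; lra.
Qed.

(** * Integrals of asymptotically uniformly integrable sequences *)

Lemma cvg_mine_cst (R : realType) (s : nat -> \bar R) (l : \bar R) (K : \bar R) :
  s n @[n --> \oo] --> l -> mine (s n) K @[n --> \oo] --> mine l K.
Proof.
move=> sl B; rewrite {1}/Order.min; case: ltgtP => [lK|Kl|lK] nB.
- have sB : \forall n \near \oo, B (s n) by exact: sl.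
  have sK : \forall n \near \oo, s n < K.
    apply: (sl [set z | z < K]); apply: open_nbhs_nbhs; split => //.
    exact: open_ereal_lt_ereal.
  by apply: filterS (filterI sB sK) => n [Bn nK]; rewrite /= /Order.min nK.
- have sK : \forall n \near \oo, K < s n.
    apply: (sl [set z | K < z]); apply: open_nbhs_nbhs; split => //.
    exact: open_ereal_gt_ereal.
  apply: filterS sK => n nK; rewrite /= /Order.min ltNge (ltW nK) /=.
  exact: nbhs_singleton nB.
- have sB : \forall n \near \oo, B (s n) by apply: sl; rewrite lK.
  apply: filterS sB => n Bn; rewrite /= /Order.min; case: ifP => // _.
  exact: nbhs_singleton nB.
Qed.

Section uniform_integrability.
Context d (T : measurableType d) (R : realType) (mu : {measure set T -> \bar R}).
Hypothesis mu1 : mu setT = 1.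

(** The functions cut off at a high level [K] converge in integral, by dominated
convergence, to at most the integral of the limit; uniform integrability bounds
what the cut removes. *)
Lemma asymptotically_uniformly_integrable_limit (f_ : nat -> T -> \bar R) (f : T -> \bar R) :
  (forall n, measurable_fun setT (f_ n)) -> (forall n t, 0 <= f_ n t) ->
  measurable_fun setT f ->
  (forall t, f_ n t @[n --> \oo] --> f t) ->
  asymptotically_uniformly_integrable mu f_ ->
  forall r : R, (0 < r)%R ->
    \forall n \near \oo, \int[mu]_t f_ n t <= \int[mu]_t f t + r%:E.
Proof.
move=> mf_ f_0 mf f_f aui r r0.
have f0 t : 0 <= f t.
  by rewrite -(cvg_lim _ (f_f t))//; apply: lime_ge; [apply/cvg_ex; exists (f t)|exact: nearW].
have [Ioo|Ifin] := eqVneq (\int[mu]_t f t) +oo.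
  by apply: nearW => n; rewrite Ioo addye ?leey// eqe.
have {}Ifin : \int[mu]_t f t \is a fin_num.
  by rewrite ge0_fin_numE ?ltey//; exact: integral_ge0.
have r2 : (0 < r / 2)%R by exact: divr_gt0.
have [K [K0 Klt]] : exists K : R, (0 < K)%R /\
    limn_esup (fun n => \int[mu]_(z in [set z | K%:E <= f_ n z]) f_ n z) < (r / 2)%:E.
  have /(_ [set z | z < (r / 2)%:E]) := aui.
  have lt_nbhs : nbhs (0 : \bar R) [set z | z < (r / 2)%:E].
    by apply: open_nbhs_nbhs; split; [exact: open_ereal_lt_ereal|rewrite /= lte_fin].
  move=> /(_ lt_nbhs) [M [Mreal MP]].
  exists (Num.max M 0 + 1)%R; split; first by rewrite ltr_pwDr// le_max lexx orbT.
  apply: MP; rewrite (@le_lt_trans _ _ (Num.max M 0)%R)// ?le_max ?lexx//.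
  by rewrite ltrDl.
have cut_cvg : \int[mu]_t mine (f_ n t) K%:E @[n --> \oo] --> \int[mu]_t mine (f t) K%:E.
  have mcut n : measurable_fun setT (fun t => mine (f_ n t) K%:E) by exact: measurable_mine.
  have mcut' : measurable_fun setT (fun t => mine (f t) K%:E) by exact: measurable_mine.
  have i1 : mu.-integrable setT (cst K%:E : T -> \bar R).
    apply/integrableP; split=> //; under eq_integral do rewrite /= ger0_norm ?ltW//.
    by rewrite prob_integral_cst ?ltry.
  have f_h : {ae mu, forall t, [set: T] t ->
      mine (f_ n t) K%:E @[n --> \oo] --> mine (f t) K%:E}.
    by apply: aeW => t _; exact: cvg_mine_cst.
  have f_g : {ae mu, forall t n, [set: T] t ->
      `|mine (f_ n t) K%:E| <= (cst K%:E : T -> \bar R) t}.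
    apply: aeW => t n _; rewrite gee0_abs; first by rewrite ge_min lexx orbT.
    by rewrite le_min f_0 lee_fin ltW.
  by have [] := dominated_convergence measurableT mcut mcut' f_h i1 f_g.
have cut_le : \int[mu]_t mine (f t) K%:E <= \int[mu]_t f t.
  apply: ge0_le_integral => //.
  - by move=> t _; rewrite le_min f0 lee_fin ltW.
  - exact: measurable_mine.
  - by move=> t _; rewrite ge_min lexx.
have near_cut : \forall n \near \oo,
    \int[mu]_t mine (f_ n t) K%:E < \int[mu]_t f t + (r / 2)%:E.
  have lt_nbhs : nbhs (\int[mu]_t mine (f t) K%:E) [set z | z < \int[mu]_t f t + (r / 2)%:E].
    apply: open_nbhs_nbhs; split; first exact: open_ereal_lt_ereal.
    by rewrite /= (le_lt_trans cut_le)// lteDl.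
  exact: cut_cvg lt_nbhs.
have near_tail := limn_esup_lt Klt.
near=> n.
have mtail : measurable [set z | K%:E <= f_ n z].
  by rewrite -[X in measurable X]setTI; exact: emeasurable_fun_c_infty.
apply: (@le_trans _ _ (\int[mu]_t mine (f_ n t) K%:E +
    \int[mu]_(z in [set z | K%:E <= f_ n z]) f_ n z)).
  have cut0 t : 0 <= mine (f_ n t) K%:E by rewrite le_min f_0 lee_fin ltW.
  have mcut : measurable_fun setT (fun t => mine (f_ n t) K%:E) by exact: measurable_mine.
  have tail0 t : 0 <= (f_ n \_ [set z | K%:E <= f_ n z]) t by apply: erestrict_ge0.
  have mtailf : measurable_fun setT (f_ n \_ [set z | K%:E <= f_ n z]).
    by apply/(measurable_restrictT _ mtail).1; exact: measurable_funTS.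
  rewrite [X in _ + X]integral_mkcond -ge0_integralD//.
  apply: ge0_le_integral => //; first exact: emeasurable_funD.
  move=> t _; rewrite patchE; case: ifPn => [_|/negP Kt]; first by rewrite leeDr.
  rewrite adde0 le_min lexx /= ltW// ltNge; apply/negP => ftK; apply: Kt.
  exact/mem_set.
apply: (@le_trans _ _ (\int[mu]_t f t + (r / 2)%:E + (r / 2)%:E)).
  by rewrite leeD// ltW//; near: n.
by rewrite -addeA -EFinD -splitr.
Unshelve. all: by end_near. Qed.

End uniform_integrability.

(** * The average-cost optimality equation for nonnegative costs *)

Section vanishing_discount.
Context (R : realType) (X A : ptopologicalType).
Notation E := (borel X * borel A)%type.
Hypothesis X_borel : borel_subset_of_polish R X.
Hypothesis A_borel : borel_subset_of_polish R A.
Variables (q : R.-pker E ~> borel X) (c : E -> \bar R).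
Hypothesis mc : measurable_fun setT c.
Hypothesis c0 : forall e, 0 <= c e.
Hypothesis S_star : assumption_S_star q c.

Let hausA : hausdorff_space A := borel_subset_of_polish_hausdorff A_borel.

Local Notation w := (min_average_value q c).

Lemma average_cost_ge0 (pi : policy R X A) x : 0 <= average_cost q c pi x.
Proof.
apply: limn_esup_ge0 => n; rewrite finite_horizon_costE// mule_ge0 ?lee_fin//.
by apply: sume_ge0 => t _; rewrite mule_ge0 ?lee_fin ?exprn_ge0//; exact: expected_cost_ge0.
Qed.

Lemma min_average_value_ge0 : 0 <= w.
Proof.
apply: le_ereal_inf_tmp => _ [x _ <-]; apply: le_ereal_inf_tmp => _ [pi _ <-].
exact: average_cost_ge0.
Qed.

Lemma min_discounted_value_ge0 b : (0 <= b)%R -> 0 <= min_discounted_value q c b.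
Proof.
move=> b0; apply: le_ereal_inf_tmp => _ [x _ <-].
by rewrite (discounted_value_optimal X_borel A_borel mc c0 S_star b0) optimal_value_ge0.
Qed.

(** If some policy has average cost less than [L] from some state, its partial
costs grow at most like [C + L * N], and [abel_bound] compares its discounted
cost with [L / (1 - b)]. *)
Lemma min_discounted_value_bound (L : R) : w < L%:E ->
  exists C : R, forall b, (0 <= b < 1)%R ->
    min_discounted_value q c b <= (C + L * (1 - b)^-1)%:E.
Proof.
move=> /ereal_inf_lt[_ [x _ <-] /ereal_inf_lt[_ [pi _ <-] piL]].
have L0 : (0 <= L)%R.
  by rewrite -lee_fin; apply: le_trans (ltW piL); exact: average_cost_ge0.
pose e t := expected_cost q c pi x t.
have e0 t : 0 <= e t by exact: expected_cost_ge0.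
pose S N := \sum_(0 <= t < N) e t.
have S_nd : nondecreasing_seq S.
  by apply: ereal_nondecreasing_series => *; exact: e0.
have [N0 _ N0P] := limn_esup_lt piL.
have SL N : (N0 <= N)%N -> S N.+1 <= (L * N.+1%:R)%:E.
  move=> /N0P /= /ltW; rewrite finite_horizon_costE//.
  under eq_bigr do rewrite expr1n mul1e.
  rewrite -/(S N.+1) => H.
  by rewrite EFinM muleC -lee_pdivrMl.
have Sfin N : S N \is a fin_num.
  rewrite ge0_fin_numE; last by apply: sume_ge0.
  apply: (@le_lt_trans _ _ (S (maxn N N0).+1)).
    by apply: S_nd; apply: leqW; exact: leq_maxl.
  by apply: le_lt_trans (SL _ (leq_maxr _ _)) _; exact: ltry.
have efin t : e t \is a fin_num.
  have := Sfin t.+1; rewrite /S big_nat_recr//= ge0_fin_numE; last first.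
    by rewrite adde_ge0// sume_ge0.
  move=> H; rewrite ge0_fin_numE//; apply: le_lt_trans H.
  by rewrite leeDr// sume_ge0.
have SE N : S N = (\sum_(0 <= t < N) fine (e t))%R%:E.
  by rewrite -sumEFin; apply: eq_bigr => t _; rewrite fineK.
exists (fine (S N0)) => b /andP[b0 b1].
have bound N : (\sum_(0 <= t < N) fine (e t) <= fine (S N0) + L * N%:R)%R.
  rewrite -lee_fin -SE EFinD fineK//; case: (leqP N N0) => NN0.
    apply: (@le_trans _ _ (S N0)); first exact: S_nd.
    by rewrite leeDl// lee_fin mulr_ge0.
  case: N NN0 => // N NN0; apply: (@le_trans _ _ (L * N.+1%:R)%:E); first exact: SL.
  by rewrite leeDr//; apply: sume_ge0.
apply: (@le_trans _ _ (discounted_cost q c b pi x)).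
  apply: (@le_trans _ _ (discounted_value q c b x)); apply: ereal_inf_lbound.
    by exists x.
  by exists pi.
rewrite discounted_costE//; apply: lime_le.
  by apply: is_cvg_nneseries => t _ _; rewrite mule_ge0 ?lee_fin ?exprn_ge0.
apply: nearW => M.
under eq_bigr => t _ do rewrite -/(e t) -(fineK (efin t)) -EFinM.
rewrite sumEFin lee_fin.
have b01 : (0 <= b <= 1)%R by rewrite b0 ltW.
apply: le_trans (abel_bound b01 bound M) _.
by rewrite lerD2l ler_wpM2l// geometric_sum_le// b0.
Qed.

Variable alpha : R^nat.
Hypothesis alpha_range : forall n, (0 <= alpha n < 1)%R.
Hypothesis alpha_increasing : nondecreasing_seq alpha.
Hypothesis alpha_cvg : alpha n @[n --> \oo] --> (1%R : R).
Hypothesis B_lower : assumption_B_lower q c alpha.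
Hypothesis LEC_ii : assumption_LEC_ii q c alpha.
Hypothesis LEC_iii : assumption_LEC_iii q c alpha.

Let a0 n : (0 <= alpha n)%R.
Proof. by have /andP[] := alpha_range n. Qed.

Let wfin : w \is a fin_num.
Proof. by rewrite ge0_fin_numE ?min_average_value_ge0//; case: B_lower. Qed.

Local Notation v n := (discounted_value q c (alpha n)).
Local Notation m n := (min_discounted_value q c (alpha n)).
Local Notation u_ n := (relative_value q c (alpha n)).
Local Notation u := (limit_relative_value q c alpha).

(** The constant that appears when the discounted optimality equation is written
for the relative values; its upper limit is the optimal average cost. *)
Definition normalised_minimum (n : nat) : R := ((1 - alpha n) * fine (m n))%R.

Local Notation lam := normalised_minimum.

Let vE n : v n = optimal_value q c (alpha n).
Proof.
apply/funext => x.
exact: (discounted_value_optimal X_borel A_borel mc c0 S_star (a0 n)).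
Qed.

Let mfin n : m n \is a fin_num.
Proof.
rewrite ge0_fin_numE ?min_discounted_value_ge0//.
have [|C CP] := @min_discounted_value_bound (fine w + 1)%R.
  by rewrite EFinD fineK// lteDl.
by apply: le_lt_trans (CP _ (alpha_range n)) _; exact: ltry.
Qed.

Lemma relative_value_ge0 n x : 0 <= u_ n x.
Proof.
rewrite /relative_value leeBrDr// add0e; apply: ereal_inf_lbound; by exists x.
Qed.

Let uK n x : v n x = u_ n x + m n.
Proof. by rewrite /relative_value subeK. Qed.

Lemma measurable_relative_value n : measurable_fun setT (u_ n : borel X -> _).
Proof.
apply: emeasurable_funB => //; rewrite vE.
exact: (measurable_optimal_value X_borel A_borel mc c0 S_star (a0 n)).
Qed.

Let lam_ge0 n : (0 <= lam n)%R.
Proof.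
have /andP[_ a1] := alpha_range n.
by rewrite mulr_ge0 ?subr_ge0 ?(ltW a1)// fine_ge0// min_discounted_value_ge0.
Qed.

Lemma bellman_relative_value n xa :
  bellman q c (alpha n) (v n) xa = bellman q c (alpha n) (u_ n) xa + (alpha n)%:E * m n.
Proof.
rewrite /bellman -addeA; congr (_ + _).
have -> : \int[q xa]_y v n y = \int[q xa]_y (u_ n y + m n).
  by apply: eq_integral => y _; rewrite uK.
rewrite ge0_integralD//; last 3 first.
- by move=> y _; exact: relative_value_ge0.
- exact: measurable_relative_value.
- by move=> _ _; exact: min_discounted_value_ge0.
rewrite prob_integral_cst; last exact: prob_kernel.
rewrite muleDr//; apply: ge0_adde_def; rewrite inE; last exact: min_discounted_value_ge0.
by apply: integral_ge0 => y _; exact: relative_value_ge0.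
Qed.

Let m_split n : m n = (lam n)%:E + (alpha n)%:E * m n.
Proof.
rewrite -{2}(fineK (mfin n)) -[LHS](fineK (mfin n)) -EFinM -EFinD /lam; congr (_%:E).
by rewrite mulrBl mul1r subrK.
Qed.

Let am_fin n : (alpha n)%:E * m n \is a fin_num.
Proof. by rewrite fin_numM. Qed.

(** This lemma and the next one are the discounted optimality equation after the
substitution of [u_ n + m n] for the value, since
[m n = lam n + alpha n * m n]. *)
Lemma relative_value_le_bellman n x a :
  u_ n x + (lam n)%:E <= bellman q c (alpha n) (u_ n) (x, a).
Proof.
rewrite -(leeD2rE _ _ (am_fin n)) -bellman_relative_value -addeA -m_split -uK vE.
exact: (optimal_value_le_bellman X_borel A_borel mc c0 S_star (a0 n)).
Qed.

Lemma relative_value_attained n x :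
  exists a, bellman q c (alpha n) (u_ n) (x, a) <= u_ n x + (lam n)%:E.
Proof.
have [a aP] := optimal_value_attained X_borel A_borel mc c0 S_star (a0 n) x.
exists a; rewrite -(leeD2rE _ _ (am_fin n)) -bellman_relative_value -addeA -m_split -uK vE.
exact: aP.
Qed.

Let u_cvg x : u_ n x @[n --> \oo] --> u x.
Proof. by rewrite /limit_relative_value is_cvg_limn_einfE; exact: LEC_ii. Qed.

Lemma limit_relative_value_ge0 x : 0 <= u x.
Proof.
rewrite -(cvg_lim _ (@u_cvg x))//; apply: lime_ge; first exact: LEC_ii.
by apply: nearW => n; exact: relative_value_ge0.
Qed.

Let u_fin x : u x \is a fin_num.
Proof.
by rewrite ge0_fin_numE ?limit_relative_value_ge0//; case: B_lower => _; exact.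
Qed.

Lemma measurable_limit_relative_value : measurable_fun setT (u : borel X -> _).
Proof.
apply: (emeasurable_fun_cvg (fun n => u_ n : borel X -> _)).
  exact: measurable_relative_value.
by move=> x _; exact: u_cvg.
Qed.

Lemma normalised_minimum_le (r : R) : (0 < r)%R ->
  \forall n \near \oo, (lam n <= fine w + r)%R.
Proof.
move=> r0; have r2 : (0 < r / 2)%R by exact: divr_gt0.
have [|C CP] := @min_discounted_value_bound (fine w + r / 2)%R.
  by rewrite EFinD fineK// lteDl.
have lim0 : ((1 - alpha n) * C @[n --> \oo] --> (1 - 1) * C)%R.
  by apply: cvgMl; apply: cvgB => //; exact: cvg_cst.
rewrite subrr mul0r in lim0.
have near0 : \forall n \near \oo, ((1 - alpha n) * C < r / 2)%R.
  exact: (cvgr_lt _ lim0).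
apply: filterS near0 => n nC.
have /andP[an0 an1] := alpha_range n.
have a1 : (0 < 1 - alpha n)%R by rewrite subr_gt0.
have : (fine (m n) <= C + (fine w + r / 2) * (1 - alpha n)^-1)%R.
  by rewrite -lee_fin fineK//; exact: CP.
move=> /(ler_wpM2l (ltW a1)) H; apply: (le_trans H).
rewrite mulrDr mulrCA divff ?gt_eqF// mulr1.
by lra.
Qed.

(** The lower envelopes [U_ n], infima of [u_ k] over [k >= n], increase to [u]
and are below [u_ n], so [bellman] at [alpha n] and [U_ n] increases with [n] and
takes, for each [n], values close to [L + u x]. By nested compact level sets one
action [a] is good for all [n]. The limit is then taken twice, in the functions
with the discount factor fixed, by monotone convergence, and then in the discount
factor. *)
Lemma optimality_inequality (L : R) :
  (forall r, (0 < r)%R -> \forall n \near \oo, (lam n <= L + r)%R) ->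
  forall x, exists a, bellman q c 1 u (x, a) <= L%:E + u x.
Proof.
move=> lamL x.
pose U_ n (y : X) := einfs (fun k => u_ k y) n.
have mU n : measurable_fun setT (U_ n : borel X -> _).
  exact: (measurable_fun_einfs measurable_relative_value).
have U0 n y : 0 <= U_ n y.
  by apply: le_ereal_inf_tmp => _ [k _ <-]; exact: relative_value_ge0.
have Unk n k y : (n <= k)%N -> U_ n y <= u_ k y.
  by move=> nk; apply: ereal_inf_lbound; exists k.
have U_nd y : nondecreasing_seq (fun n => U_ n y) by exact: nondecreasing_einfs.
have U_cvg y : U_ n y @[n --> \oo] --> u y by exact: cvg_einfs.
have [|||a aP] := @inf_compact_nondecreasing_limit R A hausA
    (fun n a => bellman q c (alpha n) (U_ n) (x, a)) (L + fine (u x))%R.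
- by move=> n; exact: (inf_compact_bellman A_borel c0 S_star).
- move=> n a; apply: le_bellman => //; first by rewrite a0 alpha_increasing.
  by move=> y; exact: U_nd.
- move=> N r r0; have r2 : (0 < r / 2)%R by exact: divr_gt0.
  have near_u : \forall n \near \oo, u_ n x < u x + (r / 2)%:E.
    apply: (@u_cvg x [set z | z < u x + (r / 2)%:E]); apply: open_nbhs_nbhs.
    by split; [exact: open_ereal_lt_ereal|rewrite /= lteDl].
  near \oo => n.
  have Nn : (N <= n)%N by near: n; exists N.
  have [a aP] := relative_value_attained n x; exists a.
  apply: (@le_trans _ _ (bellman q c (alpha n) (u_ n) (x, a))).
    apply: le_bellman => //; first by rewrite a0 alpha_increasing.
    - exact: measurable_relative_value.
    - by move=> y; exact: Unk.
  apply: (le_trans aP).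
  apply: (@le_trans _ _ (u x + (r / 2)%:E + (L + r / 2)%:E)).
    apply: leeD; first by apply: ltW; near: n.
    by rewrite lee_fin; near: n; exact: lamL.
  by rewrite -(fineK (u_fin x)) -!EFinD lee_fin; lra.
exists a.
(* the index of the discount factor is frozen at [k] while the envelopes
   increase to [u] *)
have fixed k : bellman q c (alpha k) u (x, a) <= L%:E + u x.
  apply: (bellman_limit (V_ := fun n => U_ (n + k)%N)) => //.
  - by move=> y m n mn; apply: U_nd; rewrite leq_add2r.
  - by move=> y; rewrite (@cvg_shiftn k _ (fun n => U_ n y)); exact: U_cvg.
  - move=> n; rewrite -(fineK (u_fin x)) -EFinD; apply: le_trans (aP (n + k)%N).
    by apply: le_bellman => //; rewrite a0 alpha_increasing// leq_addl.
move: fixed; rewrite /bellman mul1e.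
have : 0 <= c (x, a) by [].
have : 0 <= \int[q (x, a)]_y u y.
  by apply: integral_ge0 => y _; exact: limit_relative_value_ge0.
rewrite -(fineK (u_fin x)) -EFinD.
case: (c (x, a)) => [p| |]//; last first.
  move=> I0 _ /(_ 0%N); have : 0 <= (alpha 0%N)%:E * \int[q (x, a)]_y u y.
    by rewrite mule_ge0 ?lee_fin.
  by case: (_ * _).
case: (\int[q (x, a)]_y u y) => [p'| |]// I0 p0 fixed.
  rewrite -EFinD lee_fin.
  have lim1 : (p + alpha n * p' @[n --> \oo] --> p + 1 * p')%R.
    by apply: cvgD; [exact: cvg_cst|exact: cvgMl].
  rewrite mul1r in lim1; rewrite -(cvg_lim _ lim1)//.
  apply: limr_le; first by apply/cvg_ex; eexists; exact: lim1.
  by apply: nearW => n; have := fixed n; rewrite -EFinM -EFinD lee_fin.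
exfalso.
have [n an] : exists n, (0 < alpha n)%R.
  have : \forall n \near \oo, (0 < alpha n)%R by apply: (cvgr_gt _ alpha_cvg).
  by move=> [n _ nP]; exists n; exact: (nP n (leqnn n)).
by have := fixed n; rewrite gt0_muley ?lte_fin// addey.
Unshelve. all: by end_near. Qed.

(** A stationary policy that minimises [bellman] at [u] satisfies the optimality
inequality at every state; over [N] steps it costs at most [L * N + u x], and
[u x] is negligible after division by [N]. *)
Lemma min_average_value_le (L : R) : (0 <= L)%R ->
  (\forall n \near \oo, (lam n <= L)%R) -> w <= L%:E.
Proof.
move=> L0 lamL.
have ineq := @optimality_inequality L _.
have {}ineq x : exists a, bellman q c 1 u (x, a) <= L%:E + u x.
  apply: ineq => r r0; apply: filterS lamL => n /le_trans; apply.
  by rewrite lerDl ltW.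
have [phi [mphi phiP]] := bellman_minimiser X_borel A_borel mc c0 S_star ler01
  measurable_limit_relative_value limit_relative_value_ge0.
apply: (@le_trans _ _ (average_cost q c (stationary_policy R mphi) point)).
  apply: (@le_trans _ _ (average_value q c point)); apply: ereal_inf_lbound.
    by exists point.
  by exists (stationary_policy R mphi).
apply/lee_addgt0Pr => r r0; apply: limn_esup_le.
have lim0 : (n.+1%:R^-1 * fine (u point) @[n --> \oo] --> 0 * fine (u point))%R.
  by apply: cvgMl; exact: cvg_harmonic.
rewrite mul0r in lim0.
have near0 : \forall n \near \oo, (n.+1%:R^-1 * fine (u point) < r)%R.
  exact: (cvgr_lt _ lim0).
apply: filterS near0 => n nr.
rewrite finite_horizon_costE//.
have sum1 : (\sum_(0 <= t < n.+1) 1 ^+ t = n.+1%:R :> R)%R.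
  by under eq_bigr do rewrite expr1n; rewrite sumr_const_nat subn0.
apply: (@le_trans _ _ ((n.+1%:R^-1)%:E * (L%:E * n.+1%:R%:E + (fine (u point))%:E))).
  apply: lee_wpmul2l; first by rewrite lee_fin.
  rewrite -sum1 (fineK (u_fin point)).
  apply: (cost_le_supersolution mc c0) => //.
  - exact: measurable_limit_relative_value.
  - exact: limit_relative_value_ge0.
  - by move=> y; have [a aP] := ineq y; exact: le_trans (phiP y a) aP.
rewrite -EFinM -EFinD lee_fin mulrDr mulrCA mulVf ?pnatr_eq0// mulr1.
by rewrite lerD2l ltW.
Qed.

(** Only the bound from below of [bellman] at [u] by [w + u] is left. It comes
from the discounted inequality for a large [n] that satisfies three conditions at
once: the integrals and the values of [u_ n] are close to those of [u], which
holds for all large [n], and [lam n] is not much less than [w], which holds for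
infinitely many [n] by [min_average_value_le]. *)
Lemma optimality_equation : exists phi : borel X -> borel A,
  measurable_fun setT phi /\ forall x : X,
    w + u x = bellman q c 1 u (x, phi x) /\
    forall a, bellman q c 1 u (x, phi x) <= bellman q c 1 u (x, a).
Proof.
have [phi [mphi phiP]] := bellman_minimiser X_borel A_borel mc c0 S_star ler01
  measurable_limit_relative_value limit_relative_value_ge0.
exists phi; split => // x; split; last exact: phiP.
apply/eqP; rewrite eq_le; apply/andP; split; last first.
  have [r r0|a aP] := @optimality_inequality (fine w) _ x; first exact: normalised_minimum_le.
  by apply: le_trans (phiP x a) _; rewrite fineK in aP.
set a := phi x.
have [Boo|Bfin] := eqVneq (bellman q c 1 u (x, a)) +oo; first by rewrite Boo leey.
have I0 : 0 <= \int[q (x, a)]_y u y.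
  by apply: integral_ge0 => y _; exact: limit_relative_value_ge0.
apply/lee_addgt0Pr => r r0; have r3 : (0 < r / 3)%R by exact: divr_gt0.
have qT : q (x, a) setT = 1 by exact: prob_kernel.
have near_int := asymptotically_uniformly_integrable_limit qT
  measurable_relative_value relative_value_ge0 measurable_limit_relative_value u_cvg
  (LEC_iii x a) r3.
have near_u : \forall n \near \oo, u x - (r / 3)%:E < u_ n x.
  apply: (@u_cvg x [set z | u x - (r / 3)%:E < z]); apply: open_nbhs_nbhs.
  by split; [exact: open_ereal_gt_ereal|rewrite /mkset lteBlDr// lteDl].
have [n [lamn [intn un]]] : exists n, (fine w - r / 3 <= lam n)%R /\
    \int[q (x, a)]_t u_ n t <= \int[q (x, a)]_t u t + (r / 3)%:E /\
    u x - (r / 3)%:E < u_ n x.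
  apply: contrapT => /forallNP H.
  have lamL : \forall n \near \oo, (lam n <= fine w - r / 3)%R.
    apply: filterS (filterI near_int near_u) => n [n1 n2].
    by rewrite leNgt; apply/negP => /ltW n3; exact: (H n).
  have L0 : (0 <= fine w - r / 3)%R.
    have [n _ nP] := lamL; exact: le_trans (lam_ge0 n) (nP n (leqnn n)).
  have := min_average_value_le L0 lamL; rewrite -[leLHS](fineK wfin) lee_fin.
  by lra.
apply: (@le_trans _ _ ((lam n)%:E + (r / 3)%:E + (u_ n x + (r / 3)%:E))).
  apply: leeD; last by rewrite -leeBlDr// ltW.
  by rewrite -EFinD -[leLHS](fineK wfin) lee_fin -lerBlDr.
have := relative_value_le_bellman n x a.
have : bellman q c (alpha n) (u_ n) (x, a) <= bellman q c 1 u (x, a) + (r / 3)%:E.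
  apply: (@le_trans _ _ (bellman q c 1 (u_ n) (x, a))).
    apply: le_bellman => //; first by have /andP[? /ltW ->] := alpha_range n; rewrite a0.
    - exact: measurable_relative_value.
    - exact: measurable_relative_value.
    - exact: relative_value_ge0.
  by rewrite /bellman !mul1e -addeA leeD2l.
move=> H1 H2; rewrite addeACA [(lam n)%:E + _]addeC.
apply: le_trans (leeD2r _ (le_trans H2 H1)) _.
by rewrite -addeA leeD2l// -!EFinD lee_fin; lra.
Qed.

End vanishing_discount.

(** * Costs bounded below *)

Lemma ereal_inf_shift (R : realType) (I : Type) (f : I -> \bar R) (k : R) :
  ereal_inf (range (fun i => f i + k%:E)) = ereal_inf (range f) + k%:E.
Proof.
apply/eqP; rewrite eq_le; apply/andP; split.
  rewrite -leeBlDr//; apply: le_ereal_inf_tmp => _ [i _ <-].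
  by rewrite leeBlDr//; apply: ereal_inf_lbound; exists i.
apply: le_ereal_inf_tmp => _ [i _ <-].
by rewrite leeD2r//; apply: ereal_inf_lbound; exists i.
Qed.

Lemma limn_esup_shift (R : realType) (s : nat -> \bar R) (k : R) :
  limn_esup (fun n => s n + k%:E) = limn_esup s + k%:E.
Proof.
apply: oppe_inj; rewrite -limn_einfN oppeD ?fin_num_adde_defl// -limn_einfN addeC.
rewrite -limn_einf_shift//; congr limn_einf; apply/funext => n /=.
by rewrite oppeD ?fin_num_adde_defl// addeC.
Qed.

(** For an infinite integral additivity has to be checked by hand: the negative
part of the shifted function is bounded by [`|k|] and its positive part is not
integrable. *)
Lemma integral_shift d (T : measurableType d) (R : realType) (mu : {measure set T -> \bar R})
    (f : T -> \bar R) (k : R) :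
  mu setT = 1 -> measurable_fun setT f -> (forall t, 0 <= f t) ->
  \int[mu]_t (f t + k%:E) = \int[mu]_t f t + k%:E.
Proof.
move=> mu1 mf f0.
have ik (r : R) : mu.-integrable setT (cst r%:E : T -> \bar R).
  apply/integrableP; split=> //; under eq_integral do rewrite /=.
  by rewrite prob_integral_cst ?ltry.
have [If|] := eqVneq (\int[mu]_t f t) +oo; last first.
  rewrite -ltey => If.
  have iF : mu.-integrable setT f.
    by apply/integrableP; split => //; under eq_integral do rewrite gee0_abs//.
  by rewrite (integralD measurableT iF (ik k)) prob_integral_cst.
rewrite If addye// integralE.
have mg : measurable_fun setT (fun t => f t + k%:E) by exact: emeasurable_funD.
have neg_le : \int[mu]_t ((fun t => f t + k%:E)^\- t) <= (`|k|)%:E.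
  rewrite -[leRHS](@prob_integral_cst _ _ _ mu)//; apply: ge0_le_integral => //.
    exact: measurable_funeneg.
  move=> t _; rewrite funenegE ge_max lee_fin normr_ge0 andbT.
  rewrite leeNl -EFinN; apply: (@le_trans _ _ (0 + k%:E)); last exact: leeD2r.
  by rewrite add0e lee_fin lerNl -normrN ler_norm.
have pos_oo : \int[mu]_t ((fun t => f t + k%:E)^\+ t) = +oo.
  have : +oo <= \int[mu]_t ((fun t => f t + k%:E)^\+ t) + (`|k|)%:E.
    rewrite -[X in _ + X](@prob_integral_cst _ _ _ mu)// -If -ge0_integralD//; last first.
      exact: measurable_funepos.
    apply: ge0_le_integral => //.
      by apply: emeasurable_funD => //; exact: measurable_funepos.
    move=> t _; apply: (@le_trans _ _ (f t + k%:E + (`|k|)%:E)).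
      rewrite -addeA leeDl// -EFinD lee_fin -lerBlDl sub0r.
      by rewrite -normrN ler_norm.
    by rewrite leeD2r// funeposE le_max lexx.
  by case: (\int[mu]_t _).
rewrite pos_oo.
have : 0 <= \int[mu]_t ((fun t => f t + k%:E)^\- t) by exact: integral_ge0.
by case: (\int[mu]_t _) neg_le.
Qed.

(** Adding [k] to the one-step cost adds [k] to average costs and [k / (1 - b)] to
discounted costs; the latter cancels in relative values. *)

Section shift.
Context (R : realType) (X A : ptopologicalType).
Notation E := (borel X * borel A)%type.
Notation W := (trajectory X A).
Variables (q : R.-pker E ~> borel X) (c : E -> \bar R) (k : R).
Hypothesis mc : measurable_fun setT c.
Hypothesis c0 : forall e, 0 <= c e.

Let ck e : \bar R := c e + k%:E.

Lemma measurable_partial_cost n (b : R) :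
  measurable_fun setT (fun w : W => \sum_(0 <= t < n) ((b ^+ t)%:E * c (w t))).
Proof.
apply: emeasurable_sum => t; apply: measurable_funeM.
exact: (measurableT_comp mc (measurable_coordinate t)).
Qed.

Let partial_shift n (b : R) (w : W) :
  \sum_(0 <= t < n) ((b ^+ t)%:E * ck (w t)) =
  \sum_(0 <= t < n) ((b ^+ t)%:E * c (w t)) + ((\sum_(0 <= t < n) b ^+ t) * k)%:E.
Proof.
rewrite mulr_suml -sumEFin -big_split/=; apply: eq_bigr => t _.
by rewrite /ck muleDr// ?fin_num_adde_defl// EFinM.
Qed.

Lemma average_cost_shift pi x : average_cost q ck pi x = average_cost q c pi x + k%:E.
Proof.
rewrite /average_cost -limn_esup_shift; congr limn_esup; apply/funext => n.
rewrite /finite_horizon_cost; under eq_integral do rewrite partial_shift.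
rewrite integral_shift//; first last.
- by move=> w; apply: sume_ge0 => t _; rewrite mule_ge0 ?lee_fin ?exprn_ge0.
- exact: measurable_partial_cost.
- exact: probability_setT.
rewrite muleDr// ?fin_num_adde_defl//; congr (_ + _).
under eq_bigr do rewrite expr1n.
by rewrite -EFinM sumr_const_nat subn0 mulrA mulVf ?pnatr_eq0// mul1r.
Qed.

Lemma min_average_value_shift : min_average_value q ck = min_average_value q c + k%:E.
Proof.
have avE : average_value q ck = fun x => average_value q c x + k%:E.
  apply/funext => x; rewrite /average_value -ereal_inf_shift.
  under eq_fun do rewrite average_cost_shift.
  by [].
by rewrite /min_average_value avE ereal_inf_shift.
Qed.

Variable b : R.
Hypothesis b01 : (0 <= b < 1)%R.

Lemma discounted_cost_shift pi x :
  discounted_cost q ck b pi x = discounted_cost q c b pi x + (k / (1 - b))%:E.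
Proof.
have /andP[b0 b1] := b01.
have c_ge0 (w : W) t : 0 <= (b ^+ t)%:E * c (w t).
  by rewrite mule_ge0 ?lee_fin ?exprn_ge0.
have geo : ((\sum_(0 <= t < n) b ^+ t) * k)%:E @[n --> \oo] --> (k / (1 - b))%:E.
  have geoR : ((\sum_(0 <= t < n) b ^+ t) * k @[n --> \oo] --> k / (1 - b))%R.
    rewrite (_ : (fun n => _) = series (geometric k b)).
      by apply: cvg_geometric_series; rewrite ger0_norm.
    by apply/funext => n; rewrite /series /= mulrC mulr_sumr.
  by apply: cvg_EFin => //; exact: nearW.
have sumE (w : W) : \sum_(0 <= t <oo) ((b ^+ t)%:E * ck (w t)) =
    \sum_(0 <= t <oo) ((b ^+ t)%:E * c (w t)) + (k / (1 - b))%:E.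
  apply/cvg_lim => //; under eq_fun do rewrite partial_shift.
  apply: cvgeD; [by rewrite fin_num_adde_defl| |exact: geo].
  by apply: is_cvg_nneseries => t _ _.
rewrite /discounted_cost; under eq_integral do rewrite sumE.
rewrite integral_shift//.
- exact: probability_setT.
- apply: (emeasurable_fun_cvg _ _ (fun n => measurable_partial_cost n b)) => w _.
  by apply: is_cvg_nneseries => t _ _.
- by move=> w; apply: nneseries_ge0.
Qed.

Lemma relative_value_shift x : relative_value q ck b x = relative_value q c b x.
Proof.
have vE : discounted_value q ck b = fun y => discounted_value q c b y + (k / (1 - b))%:E.
  apply/funext => y; rewrite /discounted_value -ereal_inf_shift.
  under eq_fun do rewrite discounted_cost_shift.
  by [].
rewrite /relative_value /min_discounted_value vE ereal_inf_shift -/(min_discounted_value q c b).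
case: (discounted_value q c b x) => [r| |]; case: (min_discounted_value q c b) => [s| |] //=.
by rewrite -!EFinD; congr (_%:E); lra.
Qed.

End shift.

Lemma lty_addr_fin (R : realType) (y : \bar R) (k : R) : y + k%:E < +oo -> y < +oo.
Proof. by case: y => [r _||_] //; exact: ltry. Qed.

Lemma assumption_S_star_shift (R : realType) (X A : ptopologicalType)
    (q : R.-pker (borel X * borel A)%type ~> borel X)
    (c : borel X * borel A -> \bar R) (k : R) :
  assumption_S_star q c -> assumption_S_star q (fun e => c e - k%:E).
Proof.
move=> [cc cq]; split => // x l.
rewrite (_ : [set _ | _] = [set a : A | c (x, a) <= (l + k)%:E]); first exact: cc.
by apply/funext => a; rewrite /mkset EFinD leeBlDr.
Qed.

Unset Implicit Arguments.

Theorem theorem3p10 (R : realType) (X A : ptopologicalType)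
  (X_borel : borel_subset_of_polish R X) (A_borel : borel_subset_of_polish R A)
  (q : R.-pker (borel X * borel A)%type ~> borel X)
  (c : borel X * borel A -> \bar R)
  (c_measurable : measurable_fun setT c)
  (c_bounded_below : exists K : R, forall (x : X) (a : A), K%:E <= c (x, a))
  (alpha : R^nat)
  (alpha_range : forall n, (0 <= alpha n < 1)%R)
  (alpha_increasing : nondecreasing_seq alpha)
  (alpha_cvg : alpha n @[n --> \oo] --> (1%R : R))
  (S_star : assumption_S_star q c)
  (B_lower : assumption_B_lower q c alpha)
  (LEC_ii : assumption_LEC_ii q c alpha)
  (LEC_iii : assumption_LEC_iii q c alpha) :
  let u := limit_relative_value q c alpha in
  exists phi : borel X -> borel A,
    measurable_fun setT phi /\
    forall x : X,
      min_average_value q c + u x = c (x, phi x) + \int[q (x, phi x)]_y u y /\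
      forall a : A, c (x, phi x) + \int[q (x, phi x)]_y u y <=
                    c (x, a) + \int[q (x, a)]_y u y.
Proof.
move=> u; have [K Kc] := c_bounded_below.
(* the nonnegative cost to which [optimality_equation] applies *)
pose c' (e : borel X * borel A) : \bar R := c e - K%:E.
have mc' : measurable_fun setT c' by exact: emeasurable_funB.
have c'0 e : 0 <= c' e by case: e => x a; rewrite /c' leeBrDr// add0e.
have cE : c = fun e => c' e + K%:E by apply/funext => e; rewrite /c' subeK.
have relE n : relative_value q c (alpha n) = relative_value q c' (alpha n).
  by apply/funext => x; rewrite {1}cE relative_value_shift.
have relE' : (fun n => relative_value q c (alpha n)) = fun n => relative_value q c' (alpha n).
  by apply/funext => n; exact: relE.
have relEx x : (fun n => relative_value q c (alpha n) x) =
    fun n => relative_value q c' (alpha n) x by apply/funext => n; rewrite relE.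
have wE : min_average_value q c = min_average_value q c' + K%:E.
  by rewrite {1}cE min_average_value_shift.
have uE : u = limit_relative_value q c' alpha.
  by apply/funext => x; exact: (congr1 (@limn_einf R) (relEx x)).
have S' : assumption_S_star q c' by exact: assumption_S_star_shift.
have B' : assumption_B_lower q c' alpha.
  have [wfin uoo] := B_lower; split; last by move=> x; rewrite -relEx; exact: uoo.
  by apply: (@lty_addr_fin _ _ K); rewrite -wE; exact: wfin.
have L2 : assumption_LEC_ii q c' alpha by move=> x; rewrite -relEx; exact: LEC_ii.
have L3 : assumption_LEC_iii q c' alpha by move=> x a; rewrite -relE'; exact: LEC_iii.
have [phi [mphi phiP]] := optimality_equation X_borel A_borel mc' c'0 S' alpha_range
  alpha_increasing alpha_cvg B' L2 L3.
have addK e : c e + \int[q e]_y u y = bellman q c' 1 u e + K%:E.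
  by rewrite /bellman mul1e cE addeAC.
exists phi; split; first exact: mphi.
move=> x; have [weq wle] := phiP x.
rewrite -uE in weq; rewrite -uE in wle.
split; first by rewrite wE addeAC weq addK.
by move=> a; rewrite !addK; apply: leeD2r; exact: wle.
Qed.
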